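(* Let $d\ge 2$, and let $\alpha\in\mathbb{R}$ satisfy either $\alpha=d-1$, or $\alpha\in\mathbb{R}\setminus\mathbb{Z}$ and $\alpha<d$. Let $f\in\mathcal{E}'(\mathbb{R}^d)$, let $V\subset\mathbb{R}^d$ be any nonempty open set and let $x_0\in V$. If $f|_V=0$ and the Riesz potential $I_\alpha f$ vanishes to infinite order at $x_0$, then $f=0$. In particular, this holds for the normal operator $N=X^*X$ of the X-ray transform: if $f|_V=0$ and $Nf$ vanishes to infinite order at $x_0$, then $f=0$.
   Context: $\mathcal{E}(\Omega)$ denotes the smooth functions $\Omega\to\mathbb{C}$, $\mathcal{D}(\Omega)$ the compactly supported smooth functions, $\mathcal{D}'(\Omega)$ the distributions, and $\mathcal{E}'(\Omega)$ the compactly supported distributions. $\mathbb{N}$ contains $0$. Riesz potential: let $h_\alpha(x)=|x|^{-\alpha}$, which is locally integrable for $\alpha<d$. For $f\in\mathcal{E}'(\mathbb{R}^d)$ set $I_\alpha f=f*h_\alpha\in\mathcal{D}'(\mathbb{R}^d)$, where the convolution of $u\in\mathcal{E}'(\mathbb{R}^d)$ and $v\in\mathcal{D}'(\mathbb{R}^d)$ is defined by $\langle u*v,\varphi\rangle=\langle u,\widetilde v*\varphi\rangle$ for $\varphi\in\mathcal{D}(\mathbb{R}^d)$, with $\widetilde v$ the reflection of $v$ under $x\mapsto -x$. Vanishing to infinite order: a distribution $u$ that is smooth in a neighborhood of $x_0$ vanishes to infinite order at $x_0$ if $\partial^\beta u(x_0)=0$ for all $\beta\in\mathbb{N}^d$.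 The condition $f|_V=0$ guarantees that $I_\alpha f$ is smooth in a neighborhood of $x_0$, so these pointwise derivatives exist. X-ray transform and normal operator: let $\Gamma$ be the manifold of oriented lines in $\mathbb{R}^d$, parametrized by $\{(z,\theta):\theta\in S^{d-1},\ z\in\theta^\perp\}$. For $\varphi\in\mathcal{D}(\mathbb{R}^d)$, $X\varphi(z,\theta)=\int_{\mathbb{R}}\varphi(z+s\theta)\,ds$, and for $\psi\in\mathcal{E}(\Gamma)$, $X^*\psi(x)=\int_{S^{d-1}}\psi(x-(x\cdot\theta)\theta,\theta)\,d\theta$. These are extended by duality to $X:\mathcal{E}'(\mathbb{R}^d)\to\mathcal{E}'(\Gamma)$, $\langle Xf,\eta\rangle=\langle f,X^*\eta\rangle$ for $\eta\in\mathcal{E}(\Gamma)$, and $X^*:\mathcal{D}'(\Gamma)\to\mathcal{D}'(\mathbb{R}^d)$, $\langle X^*g,\varphi\rangle=\langle g,X\varphi\rangle$ for $\varphi\in\mathcal{D}(\mathbb{R}^d)$. The normal operator is $N=X^*X:\mathcal{E}'(\mathbb{R}^d)\to\mathcal{D}'(\mathbb{R}^d)$; it satisfies $Nf=2\,f*|\cdot|^{1-d}=2I_{d-1}f$. *)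

(* Defs.v *)
From HB Require Import structures.
From mathcomp Require Import all_boot all_order all_algebra.
From mathcomp Require Import all_classical all_reals all_analysis.
From mathcomp Require Import complex.

Set Implicit Arguments.
Unset Strict Implicit.
Unset Printing Implicit Defensive.

Import Order.TTheory GRing.Theory Num.Theory.
Import numFieldNormedType.Exports.

Local Open Scope classical_set_scope.
Local Open Scope ring_scope.

Section cons_measure.
Context {R : realType} (n : nat).

Definition cons_tuple (p : measurableTypeR R * n.-tuple (measurableTypeR R)) :
  n.+1.-tuple (measurableTypeR R) := [the n.+1.-tuple _ of p.1 :: p.2].

Lemma measurable_cons_tuple : measurable_fun setT cons_tuple.
Proof. exact: measurable_cons. Qed.

Variable m : {sigma_finite_measure set (n.-tuple (measurableTypeR R)) -> \bar R}.

Definition cons_measure : set (n.+1.-tuple (measurableTypeR R)) -> \bar R :=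
  pushforward (@lebesgue_measure R \x m)%E cons_tuple.

Let cons_measure0 : cons_measure set0 = 0%E.
Proof. by rewrite /cons_measure /pushforward preimage_set0 measure0. Qed.

Let cons_measure_ge0 A : (0 <= cons_measure A)%E.
Proof. by rewrite /cons_measure /pushforward; apply: measure_ge0. Qed.

Let cons_measure_sigma_additive : semi_sigma_additive cons_measure.
Proof.
move=> F mF tF mUF; rewrite /cons_measure /pushforward preimage_bigcup.
apply: measure_semi_sigma_additive.
- move=> k; rewrite -[X in measurable X]setTI.
  exact: measurable_cons_tuple.
- apply/trivIsetP => /= i j _ _ ij; rewrite -preimage_setI.
  by move/trivIsetP : tF => /(_ _ _ _ _ ij) ->//; rewrite preimage_set0.
- rewrite -preimage_bigcup -[X in measurable X]setTI.
  exact: measurable_cons_tuple.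
Qed.

HB.instance Definition _ := isMeasure.Build _ _ _ cons_measure
  cons_measure0 cons_measure_ge0 cons_measure_sigma_additive.

Let cons_measure_sigma_finite : sigma_finite setT cons_measure.
Proof.
have /sigma_finiteP[F [FT ndF Foo]] := sigma_finiteT (@lebesgue_measure R).
have /sigma_finiteP[G [GT ndG Goo]] := sigma_finiteT m.
pose uncons (t : n.+1.-tuple (measurableTypeR R)) :
  measurableTypeR R * n.-tuple (measurableTypeR R) :=
  (tnth t ord0, [tuple of behead t]).
have cons_tupleK p : uncons (cons_tuple p) = p.
  by case: p => x t; congr pair; exact: val_inj.
have muncons : measurable_fun setT uncons.
  apply/measurable_fun_pairP; split; first exact: measurable_tnth.
  exact: measurable_behead.
exists (fun k => uncons @^-1` (F k `*` G k)).
  apply/esym/seteqP; split=> // t _.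
  have [i _ Fi] : (\bigcup_i F i) (tnth t ord0) by rewrite -FT.
  have [j _ Gj] : (\bigcup_i G i) [tuple of behead t] by rewrite -GT.
  exists (maxn i j) => //; split => /=.
    by move: Fi; exact/subsetPset/ndF/leq_maxl.
  by move: Gj; exact/subsetPset/ndG/leq_maxr.
move=> k; have [mF Fk] := Foo k; have [mG Gk] := Goo k; split.
  by rewrite -[X in measurable X]setTI; apply: muncons => //; exact: measurableX.
rewrite /cons_measure /pushforward.
rewrite (_ : cons_tuple @^-1` _ = F k `*` G k); last first.
  by apply/funext => p; rewrite -[in RHS](cons_tupleK p).
by rewrite product_measure1E// lte_mul_pinfty// ge0_fin_numE.
Qed.

HB.instance Definition _ := Measure_isSigmaFinite.Build _ _ _ cons_measure
  cons_measure_sigma_finite.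

End cons_measure.

Fixpoint lebesgue_tuple (R : realType) (n : nat) :
    {sigma_finite_measure set (n.-tuple (measurableTypeR R)) -> \bar R} :=
  match n with
  | 0 => dirac [tuple]
  | n.+1 => cons_measure (lebesgue_tuple R n)
  end.

Section euclidean.
Context {R : realType} {d : nat}.
Implicit Types x y : 'rV[R]_d.

Definition dotp x y : R := \sum_(i < d) x 0 i * y 0 i.

(* The library norm `|x| on 'rV[R]_d is the sup norm; it only provides the
   topology here. *)
Definition enorm x : R := Num.sqrt (dotp x x).

Definition row_of_tuple (t : d.-tuple (measurableTypeR R)) : 'rV[R]_d :=
  \row_i tnth t i.

Definition cintegral (A : set 'rV[R]_d) (g : 'rV[R]_d -> R[i]) : R[i] :=
  Complex
    (\int[lebesgue_tuple R d]_(t in row_of_tuple @^-1` A)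
       complex.Re (g (row_of_tuple t)))
    (\int[lebesgue_tuple R d]_(t in row_of_tuple @^-1` A)
       complex.Im (g (row_of_tuple t))).

(* Integral over the unit sphere for the (unnormalized) surface measure,
   sigma(A) = d * Leb({x | 0 < |x| <= 1, x/|x| \in A}): its total mass is
   d * Leb(unit ball) and dx = r^(d-1) dr dsigma. *)
Definition sphere_integral (g : 'rV[R]_d -> R[i]) : R[i] :=
  d%:R * cintegral [set x | 0 < enorm x <= 1] (fun x => g ((enorm x)^-1 *: x)).

Definition pderiv (i : 'I_d) (g : 'rV[R]_d -> R[i]) : 'rV[R]_d -> R[i] :=
  fun x => Complex
    ('D_(delta_mx 0 i) (fun y => complex.Re (g y)) x)
    ('D_(delta_mx 0 i) (fun y => complex.Im (g y)) x).

(* s = [:: i1; ...; ik] gives d_i1 ... d_ik g *)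
Definition pderivs (s : seq 'I_d) (g : 'rV[R]_d -> R[i]) : 'rV[R]_d -> R[i] :=
  foldr pderiv g s.

Definition mderiv (b : 'I_d -> nat) (g : 'rV[R]_d -> R[i]) : 'rV[R]_d -> R[i] :=
  pderivs (flatten [seq nseq (b i) i | i <- enum 'I_d]) g.

(* g is of class C^oo on the open set U: all iterated partial derivatives exist
   and are continuous at the points of U. *)
Definition smooth_on (U : set 'rV[R]_d) (g : 'rV[R]_d -> R[i]) : Prop :=
  forall (s : seq 'I_d) x, U x ->
    [/\ {for x, continuous (fun y => complex.Re (pderivs s g y))},
        {for x, continuous (fun y => complex.Im (pderivs s g y))},
        forall i, derivable (fun y => complex.Re (pderivs s g y)) x
                    (delta_mx 0 i)
      & forall i, derivable (fun y => complex.Im (pderivs s g y)) x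
                    (delta_mx 0 i)].

Definition smooth (g : 'rV[R]_d -> R[i]) : Prop := smooth_on setT g.

Definition fsupp (g : 'rV[R]_d -> R[i]) : set 'rV[R]_d :=
  closure [set x | g x != 0].

(* D(U), its elements being extended by 0 outside U *)
Definition test_function (U : set 'rV[R]_d) (g : 'rV[R]_d -> R[i]) : Prop :=
  [/\ smooth g, compact (fsupp g) & fsupp g `<=` U].

(* max of sup_x |d^b g(x)| over the multi-indices b with |b| <= m *)
Definition seminorm (m : nat) (g : 'rV[R]_d -> R[i]) : R :=
  sup [set r | exists (b : 'I_d -> nat) x,
         (\sum_(i < d) b i <= m)%N /\ r = Normc.normc (mderiv b g x)].

(* A distribution is represented by a functional on all functions, of which only
   the values on test functions are relevant (for compactly supported
   distributions: the values on smooth functions). *)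
Definition functional : Type := ('rV[R]_d -> R[i]) -> R[i].

Definition distribution (u : functional) : Prop :=
  (forall (a : R[i]) g1 g2, test_function setT g1 -> test_function setT g2 ->
     u (fun x => a * g1 x + g2 x) = a * u g1 + u g2) /\
  (forall K : set 'rV[R]_d, compact K ->
     exists (C : R) (m : nat), forall g, test_function K g ->
       Normc.normc (u g) <= C * seminorm m g).

Definition vanishes_on (U : set 'rV[R]_d) (u : functional) : Prop :=
  forall g, test_function U g -> u g = 0.

Definition dsupp (u : functional) : set 'rV[R]_d :=
  ~` [set x | exists U, [/\ open U, U x & vanishes_on U u]].

(* E'(R^d): distributions with compact support. Their values on smooth functions
   are those of the canonical extension <u, g> := <u, chi g>, for any test
   function chi equal to 1 in a neighborhood of the support of u. *)
Definition compact_distribution (u : functional) : Prop :=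
  [/\ distribution u, compact (dsupp u)
    & forall g chi, smooth g -> test_function setT chi ->
        (forall x, dsupp u x -> \forall y \near x, chi y = 1) ->
        u g = u (fun x => chi x * g x)].

Definition dist_of_fun (h : 'rV[R]_d -> R[i]) : functional :=
  fun g => cintegral setT (fun x => h x * g x).

Definition reflect_dist (v : functional) : functional :=
  fun g => v (fun x => g (- x)).

(* v * g for a distribution v and a test function g *)
Definition conv_test (v : functional) (g : 'rV[R]_d -> R[i]) : 'rV[R]_d -> R[i] :=
  fun x => v (fun y => g (x - y)).

(* u * v for u in E' and v in D' *)
Definition conv_dist (u v : functional) : functional :=
  fun g => u (conv_test (reflect_dist v) g).

Definition vanishes_to_infinite_order (u : functional) (x0 : 'rV[R]_d) : Prop :=
  exists (U : set 'rV[R]_d) (g : 'rV[R]_d -> R[i]),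
    [/\ open U, U x0, smooth_on U g,
        forall phi, test_function U phi -> u phi = dist_of_fun g phi
      & forall b : 'I_d -> nat, mderiv b g x0 = 0].

Definition riesz_kernel (alpha : R) : 'rV[R]_d -> R[i] :=
  fun x => (enorm x `^ (- alpha))%:C%C.

Definition riesz_potential (alpha : R) (f : functional) : functional :=
  conv_dist f (dist_of_fun (riesz_kernel alpha)).

(* Gamma: the oriented line z + R theta is the pair (z, theta) *)
Definition line : Type :=
  {l : 'rV[R]_d * 'rV[R]_d | (dotp l.2 l.2 == 1) && (dotp l.1 l.2 == 0)}.

Definition xray (g : 'rV[R]_d -> R[i]) : line -> R[i] :=
  fun l => let z := (val l).1 in let theta := (val l).2 in
  Complex
    (\int[@lebesgue_measure R]_s complex.Re (g (z + s *: theta)))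
    (\int[@lebesgue_measure R]_s complex.Im (g (z + s *: theta))).

(* The integrand is only evaluated at unit vectors theta, where insub succeeds:
   the line through x with direction theta. *)
Definition backprojection (eta : line -> R[i]) : 'rV[R]_d -> R[i] :=
  fun x => sphere_integral (fun theta =>
    oapp eta 0 (insub (x - dotp x theta *: theta, theta) : option line)).

(* X : E'(R^d) -> E'(Gamma), <X f, eta> = <f, X^* eta> *)
Definition xray_dist (f : functional) : (line -> R[i]) -> R[i] :=
  fun eta => f (backprojection eta).

(* X^* : D'(Gamma) -> D'(R^d), <X^* w, g> = <w, X g> *)
Definition backprojection_dist (w : (line -> R[i]) -> R[i]) : functional :=
  fun g => w (xray g).

Definition normal_operator (f : functional) : functional :=
  backprojection_dist (xray_dist f).

End euclidean.

Arguments functional R d : clear implicits.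
Arguments line R d : clear implicits.

(* Main.v *)
(* Translate x0 to the origin and let q = |x|^2. Since f vanishes near 0, we may
   insert a smooth cut-off chi which vanishes near 0 and equals 1 near supp f.
   Pairing I_alpha f with mollified derivatives of the Dirac mass at 0 shows that
   vanishing to infinite order means <f, chi d^s q^a> = 0 for all s, where
   a = -alpha/2. The functions annihilated by f in this sense, up to all
   derivatives, are stable under the Laplacian, which sends q^b to a multiple of
   q^(b-1); the assumption on alpha says that this multiple is never 0 for
   b = a - j. Hence all x^c q^(a-j-|c|) are annihilated, as the leading part of a
   derivative of q^(a-j). A function v is annihilated as soon as all
   v q^(-j) with j > 0 are, because 1 - (1 - 1/(M q))^n is a polynomial in 1/q
   without constant term and tends to 1 in C^oo on the annulus supp chi if M is
   large; hence all x^c q^a are annihilated. Polynomials are dense by convolution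
   with Landau kernels, so <f, chi Phi q^a> = 0 for every test function Phi, and
   Phi = phi q^(-a) gives <f, phi> = 0.
   The normal operator reduces to alpha = d - 1 by computing X^* X phi in polar
   coordinates. *)
From HB Require Import structures.
Require Import Defs.
From mathcomp Require Import all_boot all_order all_algebra.
From mathcomp Require Import all_classical all_reals all_analysis.
From mathcomp Require Import measurable_realfun complex ring lra.

Set Implicit Arguments.
Unset Strict Implicit.
Unset Printing Implicit Defensive.

Import Order.TTheory GRing.Theory Num.Theory.
Import numFieldNormedType.Exports.

Local Open Scope classical_set_scope.
Local Open Scope ring_scope.

(** Two obstacles shape the argument. The kernel [q ^ a] may be singular at the origin and its high
    derivatives are not locally integrable, so derivatives are never put on it globally: they stay
    on a mollifier, and on the annulus [q ^ a] is replaced by a test function that agrees with it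
    there. Moreover differentiation only lowers the power of [q]: from [q ^ a] it reaches
    [x^c q ^ (a - |c|)], never [x^c q ^ a] with [c] nonzero, so the last weights can only come from
    a limit. That limit consumes every weight below the wanted one, and the Laplacian is there to
    supply them all.

    The Laplacian puts the factor [2 b (2 b - 2 + d)] in front of [q ^ (b - 1)]. For [b = a - j] it
    vanishes when [alpha = - 2 j], where [q ^ a] is a polynomial, or when [alpha = d - 2 - 2 j],
    where the iteration meets the harmonic power [q ^ ((2 - d) / 2)].

    The analysis is done for real functions and real-valued functionals; the real and imaginary
    parts of [f] are treated separately at the end. *)

(* Locked: unification must not unfold two distinct partial derivatives. *)
HB.lock Definition pd {R : realType} {d : nat} (i : 'I_d) (g : 'rV[R]_d -> R) :
  'rV[R]_d -> R := fun x => 'D_(delta_mx 0 i) g x.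

(** * Smooth real functions on open sets *)

Section smooth_functions.
Context {R : realType} {d : nat}.
Local Notation E := 'rV[R]_d.
Implicit Types (f g : E -> R) (U : set E) (x y : E) (i j : 'I_d) (s : seq 'I_d).

Lemma pdE i g : pd i g = fun x => 'D_(delta_mx 0 i) g x.
Proof. by rewrite pd.unlock. Qed.

Definition pds s g : E -> R := foldr pd g s.

(** The recursion follows the order of differentiability, so that the sum, product and chain rules
    are proved by induction on [n]. On an open [U] only the values on [U] matter, see [Cn_ext]. *)
Fixpoint Cn n U g : Prop :=
  (forall x, U x -> {for x, continuous g}) /\
  match n with
  | 0 => True
  | n.+1 => forall i, (forall x, U x -> derivable g x (delta_mx 0 i)) /\
                      Cn n U (pd i g)
  end.

Definition sm U g : Prop := forall n, Cn n U g.

Lemma pds_rcons s i g : pds (rcons s i) g = pds s (pd i g).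
Proof. by rewrite /pds foldr_rcons. Qed.

Lemma near_open U (P : set E) x : open U -> U x -> (forall y, U y -> P y) ->
  \forall y \near x, P y.
Proof. by move=> oU Ux UP; apply: filterS UP _; exact: open_nbhs_nbhs. Qed.

Lemma pd_ext U f g i : open U -> (forall x, U x -> f x = g x) ->
  forall x, U x -> pd i f x = pd i g x.
Proof.
move=> oU fg x Ux; rewrite !pdE; apply: near_eq_derive.
exact: (@near_open U (fun y => f y = g y) x oU Ux fg).
Qed.

Lemma pds_ext U f g s : open U -> (forall x, U x -> f x = g x) ->
  forall x, U x -> pds s f x = pds s g x.
Proof. by move=> oU fg; elim: s => //= i s IH; exact: pd_ext. Qed.

Lemma for_continuous_ext U f g : open U -> (forall x, U x -> f x = g x) ->
  forall x, U x -> {for x, continuous f} -> {for x, continuous g}.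
Proof.
move=> oU fg x Ux cf; rewrite /prop_for /continuous_at -fg//.
apply: cvg_trans cf; apply: (@near_eq_cvg _ _ (nbhs x)).
exact: (@near_open U (fun y => f y = g y) x oU Ux fg).
Qed.

Lemma derivable_ext U f g (v : E) : open U -> (forall x, U x -> f x = g x) ->
  forall x, U x -> derivable f x v -> derivable g x v.
Proof.
move=> oU fg x Ux; apply: near_eq_derivable.
exact: (@near_open U (fun y => f y = g y) x oU Ux fg).
Qed.

Lemma Cn_ext n U f g : open U -> (forall x, U x -> f x = g x) ->
  Cn n U f -> Cn n U g.
Proof.
move=> oU; elim: n f g => [|n IH] f g fg /= [cf df]; split=> //.
- by move=> x Ux; apply: for_continuous_ext oU fg _ Ux (cf x Ux).
- by move=> x Ux; apply: for_continuous_ext oU fg _ Ux (cf x Ux).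
move=> i; have [dfi Cfi] := df i; split.
  by move=> x Ux; apply: derivable_ext oU fg _ Ux (dfi x Ux).
by apply: IH Cfi; exact: pd_ext.
Qed.

Lemma Cn_cont n U g x : Cn n U g -> U x -> {for x, continuous g}.
Proof. by case: n => [|n] [cg _] Ux; exact: cg. Qed.

Lemma CnW n U g : Cn n.+1 U g -> Cn n U g.
Proof.
elim: n g => [|n IH] g /= [cg dg]; split=> // i.
by have [dgi Cgi] := dg i; split=> //; exact: IH.
Qed.

Lemma Cn_sub n U U' g : U' `<=` U -> Cn n U g -> Cn n U' g.
Proof.
move=> UU'; elim: n g => [|n IH] g /= [cg dg]; split=> //.
- by move=> x /UU'; exact: cg.
- by move=> x /UU'; exact: cg.
move=> i; have [dgi Cgi] := dg i; split; last exact: IH.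
by move=> x /UU'; exact: dgi.
Qed.

Lemma sm_sub U U' g : U' `<=` U -> sm U g -> sm U' g.
Proof. by move=> UU' sg n; apply: Cn_sub UU' (sg n). Qed.

Lemma sm_ext U f g : open U -> (forall x, U x -> f x = g x) -> sm U f -> sm U g.
Proof. by move=> oU fg sf n; exact: Cn_ext fg (sf n). Qed.

Lemma sm_cont U g x : sm U g -> U x -> {for x, continuous g}.
Proof. by move=> sg; exact: Cn_cont (sg 0%N). Qed.

Lemma sm_derivable U g x i : sm U g -> U x -> derivable g x (delta_mx 0 i).
Proof. by move=> sg Ux; have [_ /(_ i)[+ _]] := sg 1%N; exact. Qed.

Lemma sm_pd U g i : sm U g -> sm U (pd i g).
Proof. by move=> sg n; have [_ /(_ i)[_ +]] := sg n.+1. Qed.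

Lemma sm_pds U g s : sm U g -> sm U (pds s g).
Proof. by move=> sg; elim: s => //= i s; exact: sm_pd. Qed.

(** Passes from the form used by [smooth_on], one condition on each iterated derivative, to the
    recursive one. *)
Lemma sm_pointwise U g :
  (forall s x, U x -> {for x, continuous (pds s g)} /\
    forall i, derivable (pds s g) x (delta_mx 0 i)) -> sm U g.
Proof.
move=> H n; elim: n g H => [|n IH] g H /=; split=> //.
- by move=> x Ux; have [] := H [::] x Ux.
- by move=> x Ux; have [] := H [::] x Ux.
move=> i; split; first by move=> x Ux; have [_ +] := H [::] x Ux; exact.
by apply: IH => s x Ux; rewrite -pds_rcons; exact: H.
Qed.

(* Smoothness may be checked on any class of functions stable under
   differentiation. *)
Lemma sm_coind U (P : (E -> R) -> Prop) : open U ->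
  (forall g, P g -> (forall x, U x -> {for x, continuous g}) /\
    forall i, exists2 g', P g' & forall x, U x ->
      is_derive x (delta_mx 0 i) g (g' x)) ->
  forall g, P g -> sm U g.
Proof.
move=> oU H g Pg n; elim: n g Pg => [|n IH] g /H[cg dg]; split=> // i.
have [g' Pg' dg'] := dg i.
split; first by move=> x /dg'[].
apply: Cn_ext (IH _ Pg') => // x /dg'[_ +]; by rewrite pdE.
Qed.

Lemma sm_cst U (c : R) : open U -> sm U (fun=> c).
Proof.
move=> oU; apply: (sm_coind (P := fun g => exists c, g = fun=> c)) => //.
  move=> _ [a ->]; split; first by move=> x _; exact: cst_continuous.
  by move=> i; exists (fun=> 0); [exists 0|move=> x _; exact: is_derive_cst].
by exists c.
Qed.

Lemma pd_cst i (c : R) : pd i (fun=> c) = fun=> 0.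
Proof. by apply/funext => x; rewrite !pdE; exact: derive_cst. Qed.

Lemma is_derive_coord i j x : is_derive x (delta_mx 0 i) (fun y : E => y 0 j)
  ((i == j)%:R : R).
Proof.
have : is_derive x (delta_mx 0 i) (@id E) (delta_mx 0 i) by exact: is_derive_id.
move=> [did Did].
have dj : forall k l, derivable (fun y : E => y k l) x (delta_mx 0 i).
  exact: (@derivable_mxP _ _ _ _ (@id E) x (delta_mx 0 i)).1.
have := derive_mx did; rewrite Did => /matrixP/(_ 0 j); rewrite !mxE eqxx /= => e.
by split; [exact: dj|rewrite -e eq_sym].
Qed.

Lemma coord_cont j x : {for x, continuous (fun y : E => y 0 j)}.
Proof. exact: coord_continuous. Qed.

Lemma sm_coord U j : open U -> sm U (fun y : E => y 0 j).
Proof.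
move=> oU n; case: n => [|n]; split; try by move=> x _; exact: coord_cont.
  by [].
move=> i; split; first by move=> x _; have [] := is_derive_coord i j x.
apply: (@Cn_ext _ _ (fun=> (i == j)%:R)) => //; last exact: sm_cst.
by move=> x _; rewrite !pdE; have [_ ->] := is_derive_coord i j x.
Qed.

Lemma pd_coord i j x : pd i (fun y : E => y 0 j) x = (i == j)%:R.
Proof. by rewrite !pdE; have [_ ->] := is_derive_coord i j x. Qed.

Lemma pdD i f g x : derivable f x (delta_mx 0 i) -> derivable g x (delta_mx 0 i) ->
  pd i (fun y => f y + g y) x = pd i f x + pd i g x.
Proof. by move=> df dg; rewrite !pdE; exact: deriveD. Qed.

Lemma pdM i f g x : derivable f x (delta_mx 0 i) -> derivable g x (delta_mx 0 i) ->
  pd i (fun y => f y * g y) x = pd i f x * g x + f x * pd i g x.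
Proof.
move=> df dg; rewrite !pdE.
have -> := deriveM df dg; rewrite /GRing.scale/= addrC; congr (_ + _).
by rewrite mulrC.
Qed.

Lemma pdZ i (c : R) g x : derivable g x (delta_mx 0 i) ->
  pd i (fun y => c * g y) x = c * pd i g x.
Proof. by move=> dg; rewrite !pdE; exact: (deriveZ c dg). Qed.

Lemma CnD n U f g : open U -> Cn n U f -> Cn n U g -> Cn n U (fun x => f x + g x).
Proof.
move=> oU; elim: n f g => [|n IH] f g /= [cf df] [cg dg]; split=> //.
- by move=> x Ux; apply: continuousD; [exact: cf|exact: cg].
- by move=> x Ux; apply: continuousD; [exact: cf|exact: cg].
move=> i; have [dfi Cfi] := df i; have [dgi Cgi] := dg i; split.
  by move=> x Ux; apply: derivableD; [exact: dfi|exact: dgi].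
apply: Cn_ext (IH _ _ Cfi Cgi) => // x Ux.
by rewrite pdD//; [exact: dfi|exact: dgi].
Qed.

Lemma CnM n U f g : open U -> Cn n U f -> Cn n U g -> Cn n U (fun x => f x * g x).
Proof.
move=> oU; elim: n f g => [|n IH] f g /= [cf df] [cg dg]; split=> //.
- by move=> x Ux; apply: continuousM; [exact: cf|exact: cg].
- by move=> x Ux; apply: continuousM; [exact: cf|exact: cg].
move=> i; have [dfi Cfi] := df i; have [dgi Cgi] := dg i; split.
  by move=> x Ux; apply: derivableM; [exact: dfi|exact: dgi].
have Cf : Cn n U f by apply: CnW; split.
have Cg : Cn n U g by apply: CnW; split.
apply: Cn_ext (CnD oU (IH _ _ Cfi Cg) (IH _ _ Cf Cgi)) => // x Ux.
by rewrite pdM//; [exact: dfi|exact: dgi].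
Qed.

Lemma smD U f g : open U -> sm U f -> sm U g -> sm U (fun x => f x + g x).
Proof. by move=> oU sf sg n; exact: CnD. Qed.

Lemma smM U f g : open U -> sm U f -> sm U g -> sm U (fun x => f x * g x).
Proof. by move=> oU sf sg n; exact: CnM. Qed.

Lemma smZ U (c : R) g : open U -> sm U g -> sm U (fun x => c * g x).
Proof. by move=> oU sg; apply: smM => //; exact: sm_cst. Qed.

Lemma smN U g : open U -> sm U g -> sm U (fun x => - g x).
Proof.
move=> oU sg; apply: sm_ext (smZ (-1) oU sg) => // x _; by rewrite mulN1r.
Qed.

Lemma smB U f g : open U -> sm U f -> sm U g -> sm U (fun x => f x - g x).
Proof. by move=> oU sf sg; apply: smD => //; exact: smN. Qed.

Lemma sm_sum U (I : Type) (r : seq I) (F : I -> E -> R) : open U ->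
  (forall k, sm U (F k)) -> sm U (fun x => \sum_(k <- r) F k x).
Proof.
move=> oU sF; elim: r => [|k r IH].
  by apply: sm_ext (sm_cst 0 oU) => // x _; rewrite big_nil.
by apply: sm_ext (smD oU (sF k) IH) => // x _; rewrite big_cons.
Qed.

Lemma sm_prod U (I : Type) (r : seq I) (F : I -> E -> R) : open U ->
  (forall k, sm U (F k)) -> sm U (fun x => \prod_(k <- r) F k x).
Proof.
move=> oU sF; elim: r => [|k r IH].
  by apply: sm_ext (sm_cst 1 oU) => // x _; rewrite big_nil.
by apply: sm_ext (smM oU (sF k) IH) => // x _; rewrite big_cons.
Qed.

Lemma smX U g n : open U -> sm U g -> sm U (fun x => g x ^+ n).
Proof.
move=> oU sg; elim: n => [|n IH].
  by apply: sm_ext (sm_cst 1 oU) => // x _; rewrite expr0.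
by apply: sm_ext (smM oU sg IH) => // x _; rewrite exprS.
Qed.

Lemma pdsD U s f g x : open U -> sm U f -> sm U g -> U x ->
  pds s (fun y => f y + g y) x = pds s f x + pds s g x.
Proof.
move=> oU sf sg Ux; elim: s x Ux => //= i s IH x Ux.
rewrite (pd_ext _ oU IH)// pdD//.
  by apply: sm_derivable Ux; exact: sm_pds.
by apply: sm_derivable Ux; exact: sm_pds.
Qed.

Lemma pdsZ U s (c : R) g x : open U -> sm U g -> U x ->
  pds s (fun y => c * g y) x = c * pds s g x.
Proof.
move=> oU sg Ux; elim: s x Ux => //= i s IH x Ux.
rewrite (pd_ext _ oU IH)// pdZ//.
by apply: sm_derivable Ux; exact: sm_pds.
Qed.

Lemma pdsN U s g x : open U -> sm U g -> U x ->
  pds s (fun y => - g y) x = - pds s g x.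
Proof.
move=> oU sg Ux; rewrite -mulN1r -(pdsZ s (-1) oU sg Ux).
by apply: pds_ext Ux => // y _; rewrite mulN1r.
Qed.

End smooth_functions.

(** * Chain rule and symmetry of partial derivatives *)

Section chain_rule.
Context {R : realType}.

Lemma derive_line (V : normedModType R) (f : V -> R) (x v : V) :
  'D_v f x = 'D_1 (fun h : R => f (h *: v + x)) 0.
Proof.
rewrite /derive; set g1 := fun h => h^-1 *: _; set g2 := fun h => h^-1 *: _.
suff -> : g1 = g2 by [].
by rewrite funeqE /g1 /g2 => h /=; rewrite addr0 scale0r add0r [_%:A]mulr1.
Qed.

(** Since [g] is only derivable along [v] and need not be differentiable, the one-variable chain
    rule is applied to its restriction to the line through [x]. *)
Lemma is_derive_comp1 (V : normedModType R) (F : R -> R) (F' : R) (g : V -> R)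
    (x v : V) :
  derivable g x v -> is_derive (g x) 1 F F' ->
  is_derive x v (fun y => F (g y)) (F' * 'D_v g x).
Proof.
move=> dg [dF DF].
have dg1 := (derivable1P g x v).1 dg.
have dF0 : derivable F (g (0 *: v + x)) 1 by rewrite scale0r add0r.
split.
  apply/derivable1P; apply/derivable1_diffP.
  apply: (@differentiable_comp _ _ _ _ (fun h : R => g (h *: v + x)) F).
    exact/derivable1_diffP.
  exact/derivable1_diffP.
rewrite derive_line -derive1E (derive1_comp dg1 dF0) !derive1E scale0r add0r DF.
by rewrite (derive_line g).
Qed.

Definition smooth1 (I : set R) (F : R -> R) : Prop :=
  forall n x, I x -> derivable (derive1n n F) x 1.

Lemma smooth1_coind (I : set R) (P : (R -> R) -> Prop) : open I ->
  (forall F, P F -> exists2 F', P F' & forall x, I x -> is_derive x 1 F (F' x)) ->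
  forall F, P F -> smooth1 I F.
Proof.
move=> oI H F PF n.
suff [F' PF' eF] : exists2 F', P F' & forall x, I x -> derive1n n F x = F' x.
  move=> x Ix; have [F'' _ dF'] := H _ PF'; have [+ _] := dF' x Ix.
  apply: near_eq_derivable; apply: filterS (open_nbhs_nbhs (conj oI Ix)) => y Iy.
  by rewrite eF.
elim: n => [|n [F' PF' eF]]; first by exists F.
have [F'' PF'' dF'] := H _ PF'; exists F'' => // x Ix.
rewrite derive1nS derive1E; have [_ <-] := dF' x Ix.
apply: near_eq_derive.
by apply: filterS (open_nbhs_nbhs (conj oI Ix)) => y Iy; rewrite eF.
Qed.

Lemma smooth1_derive (I : set R) (F : R -> R) : smooth1 I F -> smooth1 I (derive1 F).
Proof. by move=> sF n x Ix; rewrite -derive1Sn; exact: sF. Qed.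

Lemma smooth1_powR (a : R) : smooth1 [set x | 0 < x] (fun x => x `^ a).
Proof.
apply: (smooth1_coind (P := fun F => exists c b, F = fun x => c * x `^ b)).
- exact: open_gt.
- move=> _ [c [b ->]]; exists (fun x => (c * b) * x `^ (b - 1)).
    by exists (c * b), (b - 1).
  move=> x x0; have := is_deriveZ c (is_derive1_powR b x0).
  by rewrite /GRing.scale/= mulrA.
- by exists 1, a; apply/funext => x; rewrite mul1r.
Qed.

End chain_rule.

Section smooth_composition.
Context {R : realType} {d : nat}.
Local Notation E := 'rV[R]_d.
Implicit Types (f g : E -> R) (U : set E).

Lemma smooth1_cont (I : set R) (F : R -> R) x : smooth1 I F -> I x ->
  {for x, continuous F}.
Proof.
move=> sF Ix; apply: differentiable_continuous; apply/derivable1_diffP.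
exact: (sF 0%N).
Qed.

Lemma pd_comp1 (F : R -> R) g i x : derivable g x (delta_mx 0 i) ->
  derivable F (g x) 1 ->
  pd i (fun y => F (g y)) x = derive1 F (g x) * pd i g x.
Proof.
move=> dg dF; rewrite !pdE.
have /(is_derive_comp1 dg)[_ ->] := DeriveDef dF erefl.
by rewrite derive1E.
Qed.

Lemma sm_comp1 U (I : set R) (F : R -> R) g : open U ->
  (forall x, U x -> I (g x)) -> smooth1 I F -> sm U g -> sm U (fun x => F (g x)).
Proof.
move=> oU UI sF sg n; elim: n F sF => [|n IH] F sF; split=> //.
- move=> x Ux; apply: continuous_comp; first exact: sm_cont sg Ux.
  by apply: smooth1_cont sF _; exact: UI.
- move=> x Ux; apply: continuous_comp; first exact: sm_cont sg Ux.
  by apply: smooth1_cont sF _; exact: UI.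
have dg i x (Ux : U x) : derivable g x (delta_mx 0 i) by exact: sm_derivable Ux.
have dF x (Ux : U x) : derivable F (g x) 1 by apply: (sF 0%N); exact: UI.
move=> i; split.
  by move=> x Ux; have [] := is_derive_comp1 (dg i x Ux) (DeriveDef (dF x Ux) erefl).
have := CnM oU (IH _ (smooth1_derive sF)) (sm_pd i sg n).
apply: Cn_ext => // x Ux.
by rewrite pd_comp1//; [exact: dg|exact: dF].
Qed.

End smooth_composition.

Section schwarz.
Context {R : realType} {d : nat}.
Local Notation E := 'rV[R]_d.
Implicit Types (f g : E -> R) (U : set E) (i j : 'I_d).

Lemma is_derive_line g (x v : E) (t : R) : derivable g (x + t *: v) v ->
  is_derive t 1 (fun s : R => g (x + s *: v)) ('D_v g (x + t *: v)).
Proof.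
move=> dg.
have e : (fun h : R => h^-1 *: (((fun s => g (x + s *: v)) \o shift t) (h *: 1) - g (x + t *: v)))
   = (fun h => h^-1 *: ((g \o shift (x + t *: v)) (h *: v) - g (x + t *: v))).
  apply/funext => h /=; congr (_ *: (g _ - _)).
  by rewrite scalerDl [_%:A]mulr1 addrCA.
by split; rewrite /derivable /derive e.
Qed.

Lemma MVT_line g (x v : E) (b : R) : 0 < b ->
  (forall t, 0 <= t <= b -> derivable g (x + t *: v) v) ->
  exists2 t, 0 < t < b & g (x + b *: v) - g x = 'D_v g (x + t *: v) * b.
Proof.
move=> b0 dg.
have [||t] := @MVT R (fun s => g (x + s *: v)) (fun s => 'D_v g (x + s *: v)) 0 b b0.
- move=> t; rewrite in_itv/= => /andP[/ltW t0 /ltW tb].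
  by apply: is_derive_line; apply: dg; rewrite t0.
- apply: derivable_within_continuous => t; rewrite in_itv/= => tb.
  by have [] := is_derive_line (dg t tb).
rewrite in_itv/= => tb; rewrite scale0r addr0 subr0 => e.
by exists t.
Qed.

(** Two mean values: one for [t |-> g (x + b u + t v) - g (x + t v)], then one for [pd j g] along
    [u]. *)
Lemma second_difference U g i j (x : E) (b : R) (u v : E) :
  u = delta_mx 0 i -> v = delta_mx 0 j -> sm U g -> 0 < b ->
  (forall s t : R, 0 <= s <= b -> 0 <= t <= b -> U (x + s *: u + t *: v)) ->
  exists s t : R, [/\ 0 <= s <= b, 0 <= t <= b &
    g (x + b *: u + b *: v) - g (x + b *: u) - (g (x + b *: v) - g x) =
    pd i (pd j g) (x + s *: u + t *: v) * b * b].
Proof.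
move=> ue ve sg b0 inU.
have bb : 0 <= (0 : R) <= b by rewrite lexx ltW.
have bB : 0 <= b <= b by rewrite lexx ltW.
have dvg y : U y -> derivable g y v by rewrite ve; exact: sm_derivable.
have dug y : U y -> derivable (pd j g) y u.
  by rewrite ue => Uy; apply: sm_derivable Uy; exact: sm_pd.
have U1 t : 0 <= t <= b -> U (x + b *: u + t *: v) by move=> tb; exact: inU.
have U0 t : 0 <= t <= b -> U (x + t *: v).
  by move=> tb; have := inU 0 t bb tb; rewrite scale0r addr0.
pose phi (t : R) := g (x + b *: u + t *: v) - g (x + t *: v).
have dphi t : 0 <= t <= b ->
    is_derive t 1 phi (pd j g (x + b *: u + t *: v) - pd j g (x + t *: v)).
  move=> tb; have h1 := is_derive_line (dvg _ (U1 t tb)).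
  have h2 := is_derive_line (dvg _ (U0 t tb)).
  by have := is_deriveB h1 h2; rewrite !pdE -ve.
have [||t tb e1] := MVT (f := phi) (df := fun t => pd j g (x + b *: u + t *: v) -
    pd j g (x + t *: v)) b0.
- by move=> t; rewrite in_itv/= => /andP[/ltW t0 /ltW tb]; apply: dphi; rewrite t0.
- apply: derivable_within_continuous => t; rewrite in_itv/= => tb.
  by have [] := dphi t tb.
have tb' : 0 <= t <= b by move: tb; rewrite in_itv/= => /andP[/ltW -> /ltW ->].
have [s' sb|s sb e2] := MVT_line (g := pd j g) (x := x + t *: v) (v := u) b0 _.
  by apply: dug; rewrite addrAC; exact: inU.
exists s, t; split => //; first by case/andP : sb => /ltW -> /ltW ->.
move: e1; rewrite /phi !scale0r !addr0 subr0 => e1.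
transitivity (g (x + b *: u + b *: v) - g (x + b *: v) - (g (x + b *: u) - g x)).
  by ring.
rewrite e1 addrAC e2 (addrAC x) (pdE i) -ue.
by [].
Qed.

Lemma pd_pdC U g i j (x : E) : open U -> sm U g -> U x -> pd i (pd j g) x = pd j (pd i g) x.
Proof.
move=> oU sg Ux.
set u : E := delta_mx 0 i; set v : E := delta_mx 0 j.
have cij : {for x, continuous (pd i (pd j g))}.
  by apply: sm_cont Ux; do 2 apply: sm_pd.
have cji : {for x, continuous (pd j (pd i g))}.
  by apply: sm_cont Ux; do 2 apply: sm_pd.
suff key (e : R) : 0 < e -> `|pd i (pd j g) x - pd j (pd i g) x| <= e.
  apply/eqP; rewrite -subr_eq0 -normr_le0; apply/ler_addgt0Pl => e /key.
  by rewrite addr0.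
move=> e0.
have e2 : 0 < e / 2 by rewrite divr_gt0.
have n0 : \forall y \near x, U y by exact: open_nbhs_nbhs.
have /cvgrPdist_lt/(_ _ e2) n1 := cij.
have /cvgrPdist_lt/(_ _ e2) n2 := cji.
have /nbhs_ballP[r /= r0 rU] : nbhs x (fun y => [/\ U y,
    `|pd i (pd j g) x - pd i (pd j g) y| < e / 2 &
    `|pd j (pd i g) x - pd j (pd i g) y| < e / 2]).
  by apply: filterS3 n0 n1 n2 => y h0 h1 h2; exact: And3 h0 h1 h2.
have dl (k : 'I_d) : `|delta_mx 0 k : E| <= 1.
  rewrite [leLHS]/Num.norm/= mx_normrE; apply/bigmax_leP; split=> //= -[a b] _ /=.
  by rewrite mxE; case: andP => _; rewrite ?normr1 ?normr0.
(* Two displacements of length at most [b] add up to at most [r / 2], which stays inside the ball of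
   radius [r]. *)
pose b := r / 4.
have b0 : 0 < b by rewrite divr_gt0.
have inball (k l : 'I_d) (s t : R) : 0 <= s <= b -> 0 <= t <= b ->
    ball x r (x + s *: delta_mx 0 k + t *: delta_mx 0 l).
  move=> /andP[s0 sb] /andP[t0 tb].
  rewrite -ball_normE /= -addrA opprD addrA subrr sub0r normrN.
  rewrite (le_lt_trans (ler_normD _ _))// !normrZ !ger0_norm//.
  rewrite (@le_lt_trans _ _ (b + b))//.
    by apply: lerD; rewrite -[leRHS]mulr1; apply: ler_pM.
  by rewrite /b; lra.
have inU (k l : 'I_d) (s t : R) (sb : 0 <= s <= b) (tb : 0 <= t <= b) : U (x + s *: delta_mx 0 k + t *: delta_mx 0 l).
  by have [] := rU _ (inball k l s t sb tb).
(* The mean value theorem computes the second difference of [g] over a small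
   square in both orders. *)
have [s [t [sb tb D1]]] := second_difference erefl erefl sg b0 (inU i j).
have [s' [t' [sb' tb' D2]]] := second_difference erefl erefl sg b0 (inU j i).
clearbody b.
have bn : b * b != 0 by rewrite mulf_neq0// gt_eqF.
have E0 : pd i (pd j g) (x + s *: u + t *: v) = pd j (pd i g) (x + s' *: v + t' *: u).
  apply: (mulIf bn); rewrite /u /v /= !mulrA -D1 -D2 (addrAC x (b *: delta_mx 0 i)).
  by ring.
have [_ h1 _] := rU _ (inball i j s t sb tb).
have [_ _ h2] := rU _ (inball j i s' t' sb' tb').
rewrite -/u -/v E0 in h1.
rewrite -(subrK (pd j (pd i g) (x + s' *: v + t' *: u)) (pd i (pd j g) x)) -addrA.
rewrite (splitr e); apply: le_trans (ler_normD _ _) _; apply: lerD; apply: ltW.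
  exact: h1.
by rewrite distrC; exact: h2.
Qed.

Lemma pds_move U g i s1 s2 x : open U -> sm U g -> U x ->
  pds (s1 ++ i :: s2) g x = pds (i :: s1 ++ s2) g x.
Proof.
move=> oU sg; elim: s1 x => //= j s1 IH x Ux.
rewrite (pd_ext _ oU IH)//= (pd_pdC _ _ oU _ Ux)//.
exact: sm_pds.
Qed.

(** A multi-index prescribes one order of differentiation; this makes a hypothesis on [mderiv]
    available for every sequence of indices. *)
Lemma pds_perm U g s1 s2 x : open U -> sm U g -> U x -> perm_eq s1 s2 ->
  pds s1 g x = pds s2 g x.
Proof.
move=> oU sg; elim: s1 s2 x => [|i s1 IH] s2 x Ux.
  by rewrite perm_sym => /perm_nilP ->.
move=> p; have i2 : i \in s2 by rewrite -(perm_mem p) mem_head.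
case/path.splitPr : i2 p => a b p.
rewrite (pds_move i a b oU sg Ux) /=; apply: pd_ext Ux => // y Uy.
apply: IH => //; move: p.
by rewrite (perm_sym _ (a ++ _)) -cat1s perm_catCA /= perm_cons perm_sym.
Qed.

End schwarz.

(** * Integration over row vectors *)

Section affine_change.
Context {R : realType}.
Local Notation T n := (n.-tuple (measurableTypeR R)).
Local Notation leb := (@lebesgue_measure R).
Local Open Scope ereal_scope.

Lemma measurable_affine1 (c b : R) :
  measurable_fun [set: measurableTypeR R] (fun x : measurableTypeR R => c * x + b : measurableTypeR R)%R.
Proof.
apply: continuous_measurable_fun => x.
apply: cvgD; last exact: cvg_cst.
by apply: cvgM; [exact: cvg_cst|exact: cvg_id].
Qed.

(** The pushforward of Lebesgue measure under [x |-> c x + b], scaled by [|c|], agrees with Lebesgue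
    measure on intervals, hence everywhere by uniqueness. *)
Lemma ge0_integral_affine1 (c b : R) (F : measurableTypeR R -> \bar R) : (c != 0)%R ->
  measurable_fun setT F -> (forall x, 0 <= F x) ->
  \int[leb]_x F x = `|c|%:E * \int[leb]_x F (c * x + b)%R.
Proof.
move=> c0 mF F0.
pose f : measurableTypeR R -> measurableTypeR R := fun x => (c * x + b)%R.
have mf : measurable_fun setT f by exact: measurable_affine1.
pose pf : {measure set (measurableTypeR R) -> \bar R} :=
  measure_function_pushforward__canonical__measure_function_Measure leb mf.
have nc : (0 <= `|c|)%R by [].
pose mu : {measure set (measurableTypeR R) -> \bar R} := mscale (NngNum nc) pf.
have cgt : (0 < `|c|)%R by rewrite normr_gt0.
have muE A : measurable A -> leb A = mu A.
  apply: lebesgue_measure_unique => _ [[x y] /= _ <-].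
  rewrite /mu /mscale/= /pf/= /pushforward/=.
  have [c1|c1|/eqP] := ltgtP c 0%R; last by rewrite (negbTE c0).
    (* For [c < 0] the map reverses the order, so the preimage is half-open on the other side. *)
    rewrite (_ : _ @^-1` _ = `[(y - b) / c, (x - b) / c[%classic)%R; last first.
      apply/seteqP; split => z /=; rewrite /f !in_itv/=.
        by rewrite ler_ndivrMr// ltr_ndivlMr// lerBrDr ltrBlDr mulrC andbC.
      by rewrite ler_ndivrMr// ltr_ndivlMr// lerBrDr ltrBlDr mulrC andbC.
    rewrite !lebesgue_measure_itv/= !lte_fin ltr_ndivrMr// divfK//.
    rewrite ltrD2r; case: ifPn => _; last by rewrite mule0.
    rewrite -!EFinD -EFinM; congr EFin.
    by rewrite ltr0_norm// -mulrBl mulrC mulrN mulfVK//; ring.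
  rewrite (_ : _ @^-1` _ = `](x - b) / c, (y - b) / c]%classic)%R; last first.
    apply/seteqP; split => z /=; rewrite /f !in_itv/=.
      by rewrite ler_pdivlMr// ltr_pdivrMr// lerBrDr ltrBlDr mulrC.
    by rewrite ler_pdivlMr// ltr_pdivrMr// lerBrDr ltrBlDr mulrC.
  rewrite !lebesgue_measure_itv/= !lte_fin ltr_pdivrMr// divfK//.
  rewrite ltrD2r; case: ifPn => _; last by rewrite mule0.
  rewrite -!EFinD -EFinM; congr EFin.
  by rewrite gtr0_norm// -mulrBl mulrC divfK//; ring.
rewrite (eq_measure_integral mu); last by move=> A mA _; exact: muE.
rewrite ge0_integral_mscale//; congr (_ * _).
by rewrite ge0_integral_pushforward.
Qed.

Lemma ge0_integral_cons n (F : T n.+1 -> \bar R) :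
  measurable_fun setT F -> (forall t, 0 <= F t) ->
  \int[lebesgue_tuple R n.+1]_t F t =
  \int[leb]_x \int[lebesgue_tuple R n]_t F [the n.+1.-tuple _ of x :: t].
Proof.
move=> mF F0 /=; rewrite /cons_measure.
have mc := @measurable_cons_tuple R n.
have mFc : measurable_fun setT (F \o (@Defs.cons_tuple R n)) by exact: measurableT_comp.
rewrite ge0_integral_pushforward// preimage_setT.
by apply: (fubini_tonelli1 _ mFc) => z; exact: F0.
Qed.

Definition tuple_affine n (c : R) (b t : T n) : T n :=
  [tuple (c * tnth t i + tnth b i)%R | i < n].

Lemma measurable_tuple_affine n c (b : T n) : measurable_fun setT (tuple_affine c b).
Proof.
apply/measurable_fun_tnthP => i.
rewrite (_ : _ \o _ = (fun x => c * x + tnth b i)%R \o (@tnth n R ^~ i)).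
  apply: measurableT_comp; first exact: measurable_affine1.
  exact: measurable_tnth.
by apply/funext => t /=; rewrite tnth_mktuple.
Qed.

(** Tonelli's theorem peels off one coordinate at a time, and each contributes a factor [|c|]. *)
Lemma ge0_integral_affine n (c : R) (b : T n) (F : T n -> \bar R) : (c != 0)%R ->
  measurable_fun setT F -> (forall t, 0 <= F t) ->
  \int[lebesgue_tuple R n]_t F t =
  (`|c| ^+ n)%:E * \int[lebesgue_tuple R n]_t F (tuple_affine c b t).
Proof.
move=> c0; elim: n b F => [|n IH] b F mF F0.
  rewrite expr0 mul1e; apply: eq_integral => t _; congr F.
  by rewrite (tuple0 t) (tuple0 (tuple_affine _ _ _)).
pose b0 := tnth b ord0; pose b' : T n := [tuple of behead b].
have affE x (t : T n) : tuple_affine c b [the n.+1.-tuple _ of x :: t] =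
    [the n.+1.-tuple _ of (c * x + b0)%R :: tuple_affine c b' t].
  apply: eq_from_tnth => i; rewrite tnth_mktuple.
  have [j ->|->] := unliftP ord0 i; last by rewrite !tnth0.
  rewrite !tnthS tnth_mktuple /b' tnth_behead; congr (_ + tnth _ _)%R.
  by apply/val_inj; rewrite /= inordK// ltnS.
have mF1 x : measurable_fun setT (fun t : T n => F [the n.+1.-tuple _ of x :: t]).
  apply: measurableT_comp => //.
  exact: (@measurable_cons _ _ _ _ (fun=> x) _ id).
have mG : measurable_fun setT (fun x => \int[lebesgue_tuple R n]_t F [the n.+1.-tuple _ of x :: t]).
  have mFc : measurable_fun setT (F \o (@Defs.cons_tuple R n)).
    by apply: measurableT_comp => //; exact: measurable_cons_tuple.
  by apply: (measurable_fun_fubini_tonelli_F _ mFc) => z; exact: F0.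
rewrite ge0_integral_cons// (@ge0_integral_affine1 c b0)//; last first.
  by move=> x; exact: integral_ge0.
rewrite ge0_integral_cons//; last first.
  by apply: measurableT_comp => //; exact: measurable_tuple_affine.
under eq_integral => x _ do rewrite (IH b')//.
have mI : measurable_fun setT (fun x : measurableTypeR R => \int[lebesgue_tuple R n]_t
    F [the n.+1.-tuple _ of (c * x + b0)%R :: tuple_affine c b' t]).
  have mFc : measurable_fun setT (F \o (@Defs.cons_tuple R n) \o 
      (fun p : measurableTypeR R * T n =>
        ((c * p.1 + b0)%R : measurableTypeR R, tuple_affine c b' p.2))).
    apply: measurableT_comp; first by apply: measurableT_comp => //; exact: measurable_cons_tuple.
    apply/measurable_fun_pairP; split => /=.
      exact: (measurableT_comp (measurable_affine1 c b0) measurable_fst).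
    exact: (measurableT_comp (measurable_tuple_affine c b') measurable_snd).
  by apply: (measurable_fun_fubini_tonelli_F _ mFc) => z; exact: F0.
rewrite ge0_integralZl//; last by move=> x _; exact: integral_ge0.
rewrite muleA -EFinM -exprS; congr (_ * _).
by apply: eq_integral => x _; apply: eq_integral => t _; rewrite affE.
Qed.

End affine_change.

Section row_integral.
Context {R : realType} {d : nat}.
Local Notation E := 'rV[R]_d.
Local Notation T := (d.-tuple (measurableTypeR R)).
Local Notation mu := (lebesgue_tuple R d).
Implicit Types (f g h : E -> R).

Lemma measurable_row_box (q : E) (e : R) :
  measurable [set t : T | forall i, `|tnth t i - q 0 i| < e].
Proof.
rewrite (_ : [set _ | _] =
    \bigcap_(i in [set: 'I_d]) [set t : T | `|tnth t i - q 0 i| < e]); last first.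
  by apply/seteqP; split => t /= H i; [move=> _; exact: H|exact: (H i)].
apply: fin_bigcap_measurable => // i _.
have mt : measurable_fun [set: T] (fun t : T => tnth t i : measurableTypeR R).
  exact: measurable_tnth.
have mB : measurable ([set x : measurableTypeR R | `|x - q 0 i| < e]).
  rewrite (_ : [set _ | _] = `](q 0 i - e), (q 0 i + e)[%classic); last first.
    by apply/seteqP; split => x /=; rewrite in_itv/= ltr_distl.
  exact: measurable_itv.
by have := mt measurableT _ mB; rewrite setTI.
Qed.

(** The topology lives on row vectors and the sigma-algebra on tuples. They are compared by writing
    an open set as the countable union of the sup-norm cubes with rational centre and radius
    [1 / (k + 1)] that it contains. *)
Lemma measurable_row_open (U : set E) : open U ->
  measurable ((@row_of_tuple R d) @^-1` U).
Proof.
move=> oU.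
pose rd (q : {ffun 'I_d -> rat}) : E := \row_i ratr (q i).
pose B (p : {ffun 'I_d -> rat} * nat) : set T :=
  [set t : T | (forall i, `|tnth t i - rd p.1 0 i| < p.2.+1%:R^-1) ].
pose F (p : {ffun 'I_d -> rat} * nat) : set T :=
  if `[< B p `<=` (@row_of_tuple R d) @^-1` U >] then B p else set0.
rewrite (_ : _ @^-1` _ = \bigcup_p F p); last first.
  apply/seteqP; split => [t /= Ut|t [p _]]; last first.
    by rewrite /F; case: asboolP => // H /H.
  have /nbhs_ballP[r /= r0 rU] : nbhs (row_of_tuple t) U by exact: open_nbhs_nbhs.
  have [k k2] : exists k : nat, k.+1%:R^-1 < r / 2.
    have r2 : 0 < r / 2 by rewrite divr_gt0.
    by have [k _ /(_ k (leqnn k))] := near_infty_natSinv_lt (PosNum r2); exists k.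
  have k0 : 0 < k.+1%:R^-1 :> R by rewrite invr_gt0.
  have /fin_all_exists[q qP] i : exists q : rat, `|tnth t i - ratr q| < k.+1%:R^-1.
    have [q] : exists q, ratr q \in `](tnth t i - k.+1%:R^-1), (tnth t i + k.+1%:R^-1)[.
      by apply: rat_in_itvoo; rewrite ltrBlDr -addrA ltrDl addr_gt0.
    rewrite in_itv/= => /andP[a b]; exists q.
    by rewrite distrC ltr_distl a.
  have Bt : B ([ffun i => q i], k) t by move=> i; rewrite /= mxE ffunE; exact: qP.
  exists ([ffun i => q i], k) => //.
  rewrite /F asboolT//.
  move=> t' Bt' /=; apply: rU; rewrite -ball_normE /=.
  rewrite [ltLHS]/Num.norm/= mx_normrE; apply/bigmax_ltP; split => //= -[a i] _ /=.
  rewrite !mxE.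
  rewrite (_ : _ - _ = (tnth t i - ratr (q i)) - (tnth t' i - ratr (q i))); last by ring.
  apply: le_lt_trans (ler_normB _ _) _; rewrite (splitr r).
  have := Bt' i; rewrite /= mxE ffunE => h1.
  by apply: ltrD; apply: lt_trans k2 => //; exact: qP.
apply: countable_bigcupT_measurable => // p.
rewrite /F; case: ifP => _ //.
exact: measurable_row_box.
Qed.

(** Smoothness is stated on row vectors but [lebesgue_tuple] is a measure on tuples; [mrow], [integ]
    and [Int] hide the passage between the two. *)
Definition mrow g := measurable_fun [set: T] (fun t : T => g (row_of_tuple t)).

Definition integ g := mu.-integrable [set: T] (fun t : T => (g (row_of_tuple t))%:E).

Definition Int g : R := \int[mu]_t g (row_of_tuple t).

Lemma mrow_continuous g : continuous g -> mrow g.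
Proof.
move=> cg; apply: (measurability _ (RGenOpens.measurableE R)).
move=> _ [_ [a [b ->] <-]]; rewrite setTI.
rewrite (_ : _ @^-1` _ = (@row_of_tuple R d) @^-1` (g @^-1` `]a, b[%classic))//.
apply: measurable_row_open; move/continuousP : cg; apply; exact: interval_open.
Qed.

End row_integral.

Section product_integral.
Context {R : realType}.
Local Notation leb := (@lebesgue_measure R).
Local Notation T n := (n.-tuple (measurableTypeR R)).

Lemma measurable_prod_tnth n (F : 'I_n -> measurableTypeR R -> R) :
  (forall i, measurable_fun setT (F i)) ->
  measurable_fun [set: T n] (fun t : T n => \prod_(i < n) F i (tnth t i)).
Proof.
move=> mF; apply: measurable_prod => i _.
by apply: measurableT_comp => //; exact: measurable_tnth.
Qed.

(** Induction on [n] by Tonelli's theorem. It serves to compute the volume of cubes. *)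
Lemma ge0_integral_prod n (F : 'I_n -> measurableTypeR R -> R) (c : 'I_n -> R) :
  (forall i, measurable_fun setT (F i)) -> (forall i x, 0 <= F i x) ->
  (forall i, (\int[leb]_x (F i x)%:E = (c i)%:E)%E) ->
  (\int[lebesgue_tuple R n]_t (\prod_(i < n) F i (tnth t i))%:E =
   (\prod_(i < n) c i)%:E)%E.
Proof.
elim: n F c => [|n IH] F c mF F0 Fc.
  under eq_integral => t _ do rewrite big_ord0.
  by rewrite integral_dirac// diracT mul1e big_ord0.
have P0 m (G : 'I_m -> measurableTypeR R -> R) (t : T m) :
    (forall i x, 0 <= G i x) -> (0 <= (\prod_(i < m) G i (tnth t i))%:E)%E.
  by move=> G0; rewrite lee_fin; apply: prodr_ge0.
rewrite ge0_integral_cons; last 2 first.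
- by apply/measurable_EFinP; exact: (measurable_prod_tnth mF).
- by move=> t; exact: P0.
have IH' := IH (fun i => F (lift ord0 i)) (fun i => c (lift ord0 i))
  (fun i => mF _) (fun i => F0 _) (fun i => Fc _).
have inner x : (\int[lebesgue_tuple R n]_t
    (\prod_(i < n.+1) F i (tnth [the n.+1.-tuple _ of x :: t] i))%:E =
    (F ord0 x)%:E * (\prod_(i < n) c (lift ord0 i))%:E)%E.
  rewrite -IH' -ge0_integralZl; last 4 first.
  - by [].
  - apply/measurable_EFinP.
    exact: (measurable_prod_tnth (fun i => mF (lift ord0 i))).
  - by move=> t _; exact: (P0 n (fun i => F (lift ord0 i))).
  - by rewrite lee_fin.
  apply: eq_integral => t _; rewrite big_ord_recl tnth0 EFinM.
  by congr (_ * (_)%:E)%E; apply: eq_bigr => i _; rewrite tnthS.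
under eq_integral do rewrite inner.
rewrite ge0_integralZr//; last 3 first.
- exact/measurable_EFinP.
- by move=> x _; rewrite lee_fin.
- rewrite lee_fin; apply: prodr_ge0 => i _.
  by rewrite -lee_fin -Fc; apply: integral_ge0 => x _; rewrite lee_fin.
by rewrite Fc -EFinM big_ord_recl.
Qed.

End product_integral.

Section row_integral_theory.
Context {R : realType} {d : nat}.
Local Notation E := 'rV[R]_d.
Local Notation T := (d.-tuple (measurableTypeR R)).
Local Notation mu := (lebesgue_tuple R d).
Implicit Types (f g h : E -> R).

Lemma mrowM f g : mrow f -> mrow g -> mrow (fun y => f y * g y).
Proof. by move=> mf mg; exact: measurable_funM. Qed.

Lemma integP g : integ g <->
  mrow g /\ (\int[mu]_t `|g (row_of_tuple t)|%:E < +oo)%E.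
Proof.
split=> [/integrableP[mg ig]|[mg ig]].
  by split; [exact/measurable_EFinP|].
by apply/integrableP; split; [exact/measurable_EFinP|].
Qed.

Lemma integ_mrow g : integ g -> mrow g.
Proof. by move=> /integP[]. Qed.

Lemma integ_le f g : mrow f -> (forall y, `|f y| <= `|g y|) -> integ g -> integ f.
Proof.
move=> mf fg ig; apply: le_integrable ig => //.
  exact/measurable_EFinP.
by move=> t _; rewrite lee_fin; exact: fg.
Qed.

Lemma integD f g : integ f -> integ g -> integ (fun y => f y + g y).
Proof. by move=> iF ig; have := integrableD measurableT iF ig. Qed.

Lemma integZ (c : R) g : integ g -> integ (fun y => c * g y).
Proof. by move=> ig; have := integrableZl measurableT c ig. Qed.

Lemma integB f g : integ f -> integ g -> integ (fun y => f y - g y).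
Proof.
move=> iF ig; have := integD iF (integZ (-1) ig).
by under eq_fun do rewrite mulN1r.
Qed.

Lemma IntD f g : integ f -> integ g -> Int (fun y => f y + g y) = Int f + Int g.
Proof. by move=> iF ig; rewrite /Int RintegralD. Qed.

Lemma IntZ (c : R) g : integ g -> Int (fun y => c * g y) = c * Int g.
Proof. by move=> ig; rewrite /Int RintegralZl. Qed.

Lemma IntB f g : integ f -> integ g -> Int (fun y => f y - g y) = Int f - Int g.
Proof. by move=> iF ig; rewrite /Int RintegralB. Qed.

Lemma integ_abs g : integ g -> integ (fun y => `|g y|).
Proof. by move=> ig; have := integrable_norm ig. Qed.

Lemma Int_le f g : integ f -> integ g -> (forall y, f y <= g y) -> Int f <= Int g.
Proof. by move=> iF ig fg; apply: le_Rintegral => // t _; exact: fg. Qed.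

Lemma Int_norm g : integ g -> `|Int g| <= Int (fun y => `|g y|).
Proof. by move=> ig; exact: le_normr_Rintegral. Qed.

Lemma Int_ge0 g : (forall y, 0 <= g y) -> 0 <= Int g.
Proof. by move=> g0; apply: Rintegral_ge0 => t _; exact: g0. Qed.

Lemma ge0_IntE g (c : R) : (forall y, 0 <= g y) ->
  (\int[mu]_t (g (row_of_tuple t))%:E = c%:E)%E -> Int g = c.
Proof. by move=> g0; rewrite /Int /Rintegral => ->. Qed.

Lemma ge0_integ g (c : R) : mrow g -> (forall y, 0 <= g y) ->
  (\int[mu]_t (g (row_of_tuple t))%:E = c%:E)%E -> integ g.
Proof.
move=> mg g0 gc; apply/integP; split=> //.
under eq_integral do rewrite ger0_norm//.
by rewrite gc ltry.
Qed.

Lemma row_of_affine (c : R) (b : E) (t : T) :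
  row_of_tuple (tuple_affine c ([tuple b 0 i | i < d] : T) t) = c *: row_of_tuple t + b.
Proof.
by apply/rowP => i; rewrite !mxE !tnth_mktuple.
Qed.

Lemma ge0_Int_affineE (c : R) (b : E) (G : E -> \bar R) : c != 0 ->
  measurable_fun [set: T] (fun t : T => G (row_of_tuple t)) -> (forall y, 0 <= G y)%E ->
  (\int[mu]_t G (row_of_tuple t) =
   (`|c| ^+ d)%:E * \int[mu]_t G (c *: row_of_tuple t + b)%R)%E.
Proof.
move=> c0 mG G0; rewrite (ge0_integral_affine ([tuple b 0 i | i < d] : T) c0)//.
by congr (_ * _)%E; apply: eq_integral => t _; rewrite row_of_affine.
Qed.

Lemma mrow_affine (c : R) (b : E) g : mrow g -> mrow (fun y => g (c *: y + b)).
Proof.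
move=> mg; rewrite /mrow.
rewrite (_ : (fun t : T => _) = (fun t => g (row_of_tuple t)) \o
    tuple_affine c ([tuple b 0 i | i < d] : T)).
  by apply: measurableT_comp => //; exact: measurable_tuple_affine.
by apply/funext => t /=; rewrite row_of_affine.
Qed.

Lemma integ_affine (c : R) (b : E) g : c != 0 ->
  integ g -> integ (fun y => g (c *: y + b)).
Proof.
move=> c0 /integP[mg ig]; apply/integP; split; first exact: mrow_affine.
have ci0 : c^-1 != 0 by rewrite invr_neq0.
(* The change of variables along the inverse affine map brings the integral back to that of
   [|g|]. *)
rewrite (ge0_Int_affineE (G := fun y => `|g (c *: y + b)|%:E) (- (c^-1 *: b)) ci0)//.
  rewrite (eq_integral (fun t => `|g (row_of_tuple t)|%:E)); last first.
    move=> t _; congr (`|g _|%:E).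
    by rewrite scalerDr scalerN !scalerA divff// !scale1r subrK.
  by apply: lte_mul_pinfty => //; rewrite ?lee_fin ?exprn_ge0.
by apply/measurable_EFinP; apply: measurableT_comp => //; exact: mrow_affine.
Qed.

(** The nonnegative formula is applied to the positive and the negative part, whose integrals are
    finite. *)
Lemma Int_affine (c : R) (b : E) g : c != 0 -> integ g ->
  Int g = `|c| ^+ d * Int (fun y => g (c *: y + b)).
Proof.
move=> c0 ig; have mg := integ_mrow ig; have iga := integ_affine b c0 ig.
have mga := integ_mrow iga.
have Iposneg f : integ f -> Int f = fine (\int[mu]_t (fun y => (f y)%:E)^\+%E (row_of_tuple t))
   - fine (\int[mu]_t (fun y => (f y)%:E)^\-%E (row_of_tuple t)).
  move=> iF; rewrite /Int /Rintegral integralE fineB.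
  - by congr (fine _ - fine _); apply: eq_integral => t _; rewrite ?funeposE ?funenegE.
  - by apply: integrable_pos_fin_num.
- by apply: integrable_neg_fin_num.
rewrite !Iposneg// mulrBr.
pose G (y : E) : \bar R := (g y)%:E.
have mG : measurable_fun [set: T] (fun t : T => G (row_of_tuple t)) by exact/measurable_EFinP.
rewrite (ge0_Int_affineE (G := (G^\+)%E) b c0)//; last first.
  by have := measurable_funepos mG; rewrite (funepos_comp G).
rewrite (ge0_Int_affineE (G := (G^\-)%E) b c0)//; last first.
  by have := measurable_funeneg mG; rewrite (funeneg_comp G).
have fp := integrable_pos_fin_num measurableT iga.
have fn := integrable_neg_fin_num measurableT iga.
rewrite (_ : (fun t => _)^\+%E = (fun t => (G^\+ (c *: row_of_tuple t + b)%R))%E) in fp; last first.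
  by apply/funext => t; rewrite !funeposE.
rewrite (_ : (fun t => _)^\-%E = (fun t => (G^\- (c *: row_of_tuple t + b)%R))%E) in fn; last first.
  by apply/funext => t; rewrite !funenegE.
rewrite !fineM//; congr (_ * fine _ - _ * fine _).
  by apply: eq_integral => t _; rewrite !funeposE.
by apply: eq_integral => t _; rewrite !funenegE.
Qed.

End row_integral_theory.

(** A quadratic remainder near [t = 0] replaces limit arguments twice: in differentiation under the
    integral sign, and for the derivatives of the flat function at the origin. *)
Lemma is_derive_quad {R : realType} (V : normedModType R) (g : V -> R) (x v : V) (L C : R) :
  (forall t : R, `|t| <= 1 -> `|g (x + t *: v) - g x - t * L| <= C * t ^+ 2) ->
  is_derive x v g L.
Proof.
move=> H.
have cv : (fun h => h^-1 *: ((g \o shift x) (h *: v) - g x)) @ 0^' --> L.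
  apply/cvgrPdist_le => /= e e0.
  pose dl := Num.min 1 (e / (`|C| + 1)).
  have C1 : 0 < `|C| + 1 by rewrite ltr_wpDl.
  have dl0 : 0 < dl by rewrite lt_min ltr01 divr_gt0.
  near=> h.
  have h0 : h != 0 by near: h; exact: nbhs_dnbhs_neq.
  have hd : `|h| < dl.
    by near: h; apply: dnbhs0_lt.
  have := hd; rewrite lt_min => /andP[h1 h2].
  rewrite /= [h *: v + x]addrC.
  rewrite distrC (_ : _ - L = h^-1 * (g (x + h *: v) - g x - h * L)); last first.
    by rewrite mulrBr mulKf.
  rewrite normrM normfV ler_pdivrMl ?normr_gt0//.
  apply: le_trans (H h (ltW h1)) _.
  rewrite -[h ^+ 2]ger0_norm ?sqr_ge0// normrX expr2 mulrCA ler_wpM2l//.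
  apply: (@le_trans _ _ (`|h| * (`|C| + 1))).
    rewrite mulrC ler_wpM2l//; apply: le_trans (ler_norm _) _.
    by rewrite lerDl.
  by rewrite -ler_pdivlMr// ltW.
split; first by apply/cvg_ex; exists L.
exact: cvg_lim cv.
Unshelve. all: by end_near. Qed.

(** * Test functions and convolution *)

Section test_functions.
Context {R : realType} {d : nat}.
Local Notation E := 'rV[R]_d.
Implicit Types (f g Phi : E -> R) (x y v : E).

Lemma norm_coord x (i : 'I_d) : `|x 0 i| <= `|x|.
Proof.
rewrite [leRHS]/Num.norm/= mx_normrE.
have := @le_bigmax_seq _ _ _ (index_enum ('I_1 * 'I_d)%type) 0 (0, i) xpredT
  (fun p => `|x p.1 p.2|).
by apply; rewrite ?mem_index_enum.
Qed.

Lemma norm_le_coord x (r : R) : 0 <= r -> (forall i, `|x 0 i| <= r) -> `|x| <= r.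
Proof.
move=> r0 H; rewrite [leLHS]/Num.norm/= mx_normrE.
by apply/bigmax_leP; split => //= -[a i] _ /=; rewrite (ord1 a).
Qed.

Lemma norm_delta (i : 'I_d) : `|delta_mx 0 i : E| <= 1.
Proof.
apply: norm_le_coord => // j.
by rewrite mxE; case: andP => _; rewrite ?normr1 ?normr0.
Qed.

(** Real test functions. A bound on the support replaces compactness of its closure, and is easier
    to carry through translations and products. *)
Definition rtest Phi : Prop :=
  sm setT Phi /\ exists r : R, forall x, r < `|x| -> Phi x = 0.

Lemma rtest_sm Phi : rtest Phi -> sm setT Phi.
Proof. by case. Qed.

Lemma sm_continuous Phi : sm setT Phi -> continuous Phi.
Proof. by move=> sP x; exact: (sm_cont sP). Qed.

Lemma rtest_continuous Phi : rtest Phi -> continuous Phi.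
Proof. by move=> /rtest_sm/sm_continuous. Qed.

Lemma open_norm_gt (r : R) : open [set x : E | r < `|x|].
Proof.
apply: (@open_comp _ _ (fun x : E => `|x|) [set y | r < y]); last exact: open_gt.
by move=> x _; exact: norm_continuous.
Qed.

Lemma open_norm_lt (r : R) : open [set x : E | `|x| < r].
Proof.
apply: (@open_comp _ _ (fun x : E => `|x|) [set y | y < r]); last exact: open_lt.
by move=> x _; exact: norm_continuous.
Qed.

Lemma pds_zero (U : set E) s g : open U -> (forall x, U x -> g x = 0) ->
  forall x, U x -> pds s g x = 0.
Proof.
move=> oU g0 x Ux; rewrite (pds_ext s oU (g := fun=> 0) g0 Ux).
elim: s x {Ux} => //= i s IH x.
by have -> : pds s (fun=> 0) = (fun=> 0 : R) :> (E -> R); [exact/funext|rewrite pd_cst].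
Qed.

Lemma rtest_pds Phi s : rtest Phi -> rtest (pds s Phi).
Proof.
move=> [sP [r P0]]; split; first exact: sm_pds.
exists r => x rx; apply: (pds_zero (U := [set x | r < `|x|])) => //.
exact: open_norm_gt.
Qed.

Lemma rtest_pd Phi i : rtest Phi -> rtest (pd i Phi).
Proof. exact: (@rtest_pds Phi [:: i]). Qed.

Lemma compact_norm_le (r : R) : compact [set x : E | `|x| <= r].
Proof.
apply: bounded_closed_compact.
  by exists r; split; [exact: num_real|move=> M rM x /= /le_trans; apply; exact: ltW].
apply: (@closed_comp _ _ (fun x : E => `|x|) [set y | y <= r]); last exact: closed_le.
by move=> x _; exact: norm_continuous.
Qed.

Lemma cont_bounded_on (K : set E) g : compact K ->
  (forall x, K x -> {for x, continuous g}) -> exists2 M : R, 0 <= M & forall x, K x -> `|g x| <= M.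
Proof.
move=> cK cg; have [K0|/set0P/negP] := pselect (K !=set0); last first.
  rewrite negbK => /eqP K0; exists 0 => // x; by rewrite K0.
have cng : {within K, continuous (fun x => `|g x|)}.
  apply: continuous_in_subspaceT => x /set_mem Kx.
  apply: continuous_comp; [exact: cg|exact: norm_continuous].
have [c cK' cm] := compact_EVT_max K0 cK cng.
by exists `|g c| => // x Kx; apply: cm; exact: mem_set.
Qed.

Lemma rtest_bounded Phi : rtest Phi -> exists2 M : R, 0 <= M & forall x, `|Phi x| <= M.
Proof.
move=> tP; have [_ [r P0]] := tP.
have [M M0 HM] := @cont_bounded_on _ Phi (@compact_norm_le r) (fun x _ => @rtest_continuous _ tP x).
exists M => // x; have [xr|rx] := leP `|x| r; first exact: HM.
by rewrite P0// normr0.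
Qed.

Lemma MVT_delta g x (t : R) i : sm setT g -> exists2 s : R, `|s| <= `|t| &
  g (x + t *: delta_mx 0 i) - g x = t * pd i g (x + s *: delta_mx 0 i).
Proof.
move=> sg; have dg y : derivable g y (delta_mx 0 i) by exact: (sm_derivable sg).
have [t0|t0|->] := ltgtP t 0; last first.
- by exists 0 => //; rewrite scale0r addr0 subrr mul0r.
- have [|s /andP[s0 st] ->] := @MVT_line _ _ g x (delta_mx 0 i) t t0; first by move=> *; exact: dg.
  by exists s; [rewrite !gtr0_norm// ltW|rewrite pdE mulrC].
have nt : 0 < - t by rewrite oppr_gt0.
have [|s /andP[s0 st]] := @MVT_line _ _ g (x + t *: delta_mx 0 i) (delta_mx 0 i) (- t) nt.
  by move=> *; exact: dg.
rewrite scaleNr addrK -addrA -scalerDl => e; exists (t + s).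
  by rewrite !ltr0_norm//; lra.
by rewrite pdE -[LHS]opprB e mulrN opprK mulrC.
Qed.

Lemma MVT_bound g x (t M : R) i : sm setT g -> (forall y, `|pd i g y| <= M) ->
  `|g (x + t *: delta_mx 0 i) - g x| <= `|t| * M.
Proof.
by move=> sg HM; have [s _ ->] := MVT_delta x t i sg; rewrite normrM ler_wpM2l.
Qed.

(** The point [x + v] is reached from [x] by [d] moves parallel to the axes, each controlled by the
    mean value theorem. *)
Lemma lipschitz_bound g x v (M : R) : 0 <= M -> sm setT g ->
  (forall i y, `|pd i g y| <= M) -> `|g (x + v) - g x| <= d%:R * (`|v| * M).
Proof.
move=> M0 sg HM.
have key (r : seq 'I_d) :
    `|g (x + \sum_(i <- r) v 0 i *: delta_mx 0 i) - g x| <= (size r)%:R * (`|v| * M).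
  elim: r => [|i r IH] /=; first by rewrite big_nil addr0 subrr normr0 mul0r.
  rewrite big_cons [_ *: _ + _]addrC addrA.
  set y := x + _ in IH *.
  rewrite -(subrK (g y) (g _)) -addrA -natr1 addrC mulrDl mul1r.
  apply: le_trans (ler_normD _ _) _; apply: lerD; first exact: IH.
  apply: le_trans (MVT_bound y (v 0 i) sg (HM i)) _.
  by apply: ler_wpM2r => //; exact: norm_coord.
have := key (enum 'I_d); rewrite size_enum_ord big_enum/=.
suff -> : \sum_(i < d) v 0 i *: delta_mx 0 i = v by [].
by rewrite -row_sum_delta.
Qed.

(** Two applications of the mean value theorem stand in for Taylor's formula; the missing factor
    [1 / 2] is immaterial. *)
Lemma MVT_bound2 g x (t M : R) i : sm setT g -> (forall y, `|pd i (pd i g) y| <= M) ->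
  `|g (x + t *: delta_mx 0 i) - g x - t * pd i g x| <= M * t ^+ 2.
Proof.
move=> sg HM.
have M0 : 0 <= M by apply: le_trans (HM 0).
have [s st ->] := MVT_delta x t i sg.
rewrite -mulrBr normrM -[t ^+ 2]ger0_norm ?sqr_ge0// normrX expr2 mulrCA ler_wpM2l//.
apply: le_trans (MVT_bound x s (sm_pd i sg) HM) _.
by rewrite mulrC ler_wpM2l.
Qed.

End test_functions.

Section convolution.
Context {R : realType} {d : nat}.
Local Notation E := 'rV[R]_d.
Local Notation T := (d.-tuple (measurableTypeR R)).
Local Notation leb := (@lebesgue_measure R).
Implicit Types (f g k Phi Psi : E -> R) (x y v : E).

(** A sup-norm ball is a cube, so this indicator is a product of one-variable indicators and its
    integral is explicit. *)
Definition bx (r : R) : E -> R := fun y => (`|y| <= r)%R%:R.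

Lemma bx_ge0 r y : 0 <= bx r y. Proof. exact: ler0n. Qed.

Lemma bx1 r y : `|y| <= r -> bx r y = 1. Proof. by rewrite /bx => ->. Qed.

Lemma bx0 r y : r < `|y| -> bx r y = 0. Proof. by rewrite /bx ltNge => /negbTE ->. Qed.

Lemma mrow_bx r : mrow (bx r).
Proof.
have mA : measurable (~` ((@row_of_tuple R d) @^-1` [set x | r < `|x|])).
  by apply: measurableC; apply: measurable_row_open; exact: open_norm_gt.
rewrite /mrow (_ : (fun t => _) =
  \1_(~` ((@row_of_tuple R d) @^-1` [set x | r < `|x|]))); first exact: measurable_indic.
apply/funext => t; rewrite indicE /bx; congr (_%:R); congr nat_of_bool.
apply/idP/idP.
  by move=> h; apply/mem_set => /=; apply/negP; rewrite -leNgt.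
by move=> /set_mem /= /negP; rewrite -leNgt.
Qed.

Lemma bx_prod r y : 0 <= r -> bx r y = \prod_(i < d) (`|y 0 i| <= r)%R%:R.
Proof.
move=> r0; have [yr|ry] := leP `|y| r.
  rewrite bx1// big1// => i _; by rewrite (le_trans (norm_coord _ _) yr).
rewrite bx0//; have [i yi] : exists i, r < `|y 0 i|.
  apply: contrapT => /forallNP H.
  move: ry; rewrite ltNge => /negP; apply; apply: norm_le_coord => // i.
  by rewrite leNgt; apply/negP.
by rewrite (bigD1 i)//= leNgt yi mul0r.
Qed.

Lemma measurable_interval1 (r : R) :
  measurable_fun [set: measurableTypeR R] (fun x : measurableTypeR R => (`|x| <= r)%R%:R : R).
Proof.
rewrite (_ : (fun _ => _) = \1_(`[- r, r]%classic : set (measurableTypeR R))).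
  exact: measurable_indic.
apply/funext => x; rewrite indicE; congr (nat_of_bool _)%:R.
by rewrite mem_setE in_itv/= ler_norml.
Qed.

Lemma integral_interval1 (r : R) : 0 <= r ->
  (\int[leb]_x ((`|x| <= r)%R%:R : R)%:E = (2 * r)%:E)%E.
Proof.
move=> r0; rewrite (eq_integral (fun x : measurableTypeR R => (\1_(`[- r, r]%classic : set (measurableTypeR R)) x)%:E)).
  rewrite integral_indic//= setIT lebesgue_measure_itv/= lte_fin.
  case: ltgtP => [|h|h].
  - by rewrite -EFinD => _; congr EFin; ring.
  - exfalso; lra.
  - by congr EFin; lra.
move=> x _; congr EFin; rewrite indicE; congr (nat_of_bool _)%:R.
by rewrite mem_setE in_itv/= ler_norml.
Qed.

Lemma integral_bx r : 0 <= r ->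
  (\int[lebesgue_tuple R d]_t (bx r (row_of_tuple t))%:E = ((2 * r) ^+ d)%:E)%E.
Proof.
move=> r0; under eq_integral do rewrite bx_prod//.
under eq_integral => t _ do under eq_bigr do rewrite mxE.
rewrite (ge0_integral_prod (F := fun _ (x : measurableTypeR R) => (`|x| <= r)%R%:R) (c := fun=> 2 * r)).
- by rewrite prodr_const card_ord.
- by move=> _; exact: measurable_interval1.
- by move=> _ x; exact: ler0n.
- by move=> _; exact: integral_interval1.
Qed.

Lemma bx_le0 r : r < 0 -> bx r = fun=> 0.
Proof. by move=> r0; apply/funext => y; rewrite bx0// (lt_le_trans r0). Qed.

Lemma integ0 : integ (fun _ : E => 0 : R).
Proof.
by apply/integP; split; [exact: measurable_cst|rewrite normr0 integral0].
Qed.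

Lemma integ_bx r : integ (bx r).
Proof.
have [r0|r0] := leP 0 r; last by rewrite bx_le0//; exact: integ0.
by apply: ge0_integ (integral_bx r0); [exact: mrow_bx|move=> y; exact: bx_ge0].
Qed.

Definition locint k : Prop := mrow k /\ forall r, integ (fun y => k y * bx r y).

Lemma locint_cont k : continuous k -> locint k.
Proof.
move=> ck; have mk := mrow_continuous ck; split=> // r.
have [M M0 HM] := cont_bounded_on (@compact_norm_le R d r) (fun x _ => ck x).
apply: integ_le (integZ M (integ_bx r)); first exact: mrowM mk (mrow_bx r).
move=> y; rewrite !normrM (ger0_norm M0).
have [yr|ry] := leP `|y| r; last by rewrite bx0// !normr0 !mulr0.
by apply: ler_wpM2r => //; exact: HM.
Qed.

Lemma locint_abs k : locint k -> locint (fun y => `|k y|).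
Proof.
move=> [mk ik]; split; first exact: measurableT_comp.
move=> r; have := integ_abs (ik r).
by under eq_fun do rewrite normrM (ger0_norm (bx_ge0 _ _)).
Qed.

Lemma integ_locintM k Psi (r M : R) : locint k -> mrow Psi ->
  (forall y, `|Psi y| <= M * bx r y) -> integ (fun y => k y * Psi y).
Proof.
move=> [mk ik] mP HP; apply: integ_le (integZ M (ik r)); first exact: mrowM.
move=> y; rewrite normrM mulrCA normrM ler_wpM2l//.
exact: le_trans (HP y) (ler_norm _).
Qed.

Lemma Int_locint_bound k Psi (r M : R) : locint k -> mrow Psi ->
  (forall y, `|Psi y| <= M * bx r y) ->
  `|Int (fun y => k y * Psi y)| <= M * Int (fun y => `|k y| * bx r y).
Proof.
move=> lk mP HP; have iP := integ_locintM lk mP HP.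
apply: le_trans (Int_norm iP) _.
have [_ ik] := locint_abs lk.
rewrite -IntZ//; apply: Int_le; [exact: integ_abs|exact: integZ|move=> y].
by rewrite normrM mulrCA; apply: ler_wpM2l.
Qed.

(* The convolution of [Phi] with the reflection of [k]. *)
Definition conv k Phi : E -> R := fun x => Int (fun y => k y * Phi (x + y)).

Lemma mrow_shift Phi x : continuous Phi -> mrow (fun y => Phi (x + y)).
Proof.
move=> cP; apply: mrow_continuous => y; apply: continuous_comp; last exact: cP.
by apply: continuousD; [exact: cst_continuous|exact: id].
Qed.

Lemma shift_supp Phi (r M : R) x : (forall y, r < `|y| -> Phi y = 0) ->
  (forall y, `|Phi y| <= M) -> forall y, `|Phi (x + y)| <= M * bx (r + `|x|) y.
Proof.
move=> P0 PM y; have M0 : 0 <= M by apply: le_trans (PM 0).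
have [yr|ry] := leP `|y| (r + `|x|); first by rewrite bx1// mulr1.
rewrite P0 ?normr0 ?mulr_ge0 ?bx_ge0//.
have := ler_normB (x + y) x; rewrite addrAC subrr add0r => h.
by rewrite -(ltrD2r `|x|); exact: lt_le_trans h.
Qed.

Lemma integ_conv k Phi x : locint k -> rtest Phi -> integ (fun y => k y * Phi (x + y)).
Proof.
move=> lk tP; have [_ [r P0]] := tP; have [M _ PM] := rtest_bounded tP.
apply: (integ_locintM lk (mrow_shift x (@rtest_continuous _ _ _ tP))).
exact: shift_supp P0 PM.
Qed.

Lemma bx_mono (r r' : R) y : r <= r' -> bx r y <= bx r' y.
Proof.
move=> rr; rewrite /bx ler_nat.
by have [/le_trans ->|] := leP `|y| r.
Qed.

(** The increment falls on [Phi] alone, with a quadratic remainder supported in a fixed cube; local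
    integrability of [k] therefore suffices. *)
Lemma is_derive_conv k Phi x i : locint k -> rtest Phi ->
  is_derive x (delta_mx 0 i) (conv k Phi) (conv k (pd i Phi) x).
Proof.
move=> lk tP; have tP1 := rtest_pd i tP.
have [_ [r P0]] := tP; have [M M0 PM] := rtest_bounded (rtest_pd i tP1).
have dP0 y : r < `|y| -> pd i Phi y = 0.
  by apply: (@pds_zero _ _ [set z | r < `|z|] [:: i] Phi); [exact: open_norm_gt|exact: P0].
(* The extra 1 makes room for the increments [t e] with [|t| <= 1], so that one cube serves all of
   them. *)
pose r' := r + `|x| + 1.
apply: (@is_derive_quad _ _ _ _ _ _ (M * Int (fun y => `|k y| * bx r' y))) => t t1.
set e : E := delta_mx 0 i.
pose Psi y := Phi (x + y + t *: e) - Phi (x + y) - t * pd i Phi (x + y).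
have iC := integ_conv _ lk tP; have iC1 := integ_conv _ lk tP1.
have -> : conv k Phi (x + t *: e) - conv k Phi x - t * conv k (pd i Phi) x =
    Int (fun y => k y * Psi y).
  rewrite /conv -IntZ// -!IntB//; last 2 first.
  - exact: integB.
  - exact: integZ.
  congr Int; apply/funext => y; rewrite /Psi (addrAC x (t *: e) y); ring.
have mPsi : mrow Psi.
  have -> : Psi = fun y => Phi (x + t *: e + y) - Phi (x + y) - t * pd i Phi (x + y).
    by apply/funext => y; rewrite /Psi (addrAC x).
  apply: measurable_funB.
    by apply: measurable_funB; apply: mrow_shift; exact: rtest_continuous.
  apply: measurable_funM; first exact: measurable_cst.
  by apply: mrow_shift; exact: rtest_continuous.
rewrite mulrAC; apply: Int_locint_bound => // y.
have [yr|ry] := leP `|y| r'.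
  by rewrite bx1// mulr1; apply: MVT_bound2 => //; exact: rtest_sm.
have ny : r + 1 < `|x + y|.
  have := ler_normB (x + y) x; rewrite addrAC subrr add0r => h.
  rewrite -(ltrD2r `|x|); apply: lt_le_trans h.
  by rewrite addrAC.
have ny1 : r < `|x + y| by apply: lt_trans ny; rewrite ltrDl.
have ny2 : r < `|x + y + t *: e|.
  have := ler_normB (x + y + t *: e) (t *: e); rewrite addrK => h.
  have te : `|t *: e| <= 1.
    by rewrite normrZ -[leRHS]mulr1 ler_pM// norm_delta.
  rewrite -(ltrD2r 1); apply: lt_le_trans ny _; apply: le_trans h _.
  by rewrite lerD2l.
rewrite /Psi !P0// dP0// mulr0 !subr0 normr0 mulr_ge0 ?bx_ge0//.
by rewrite mulr_ge0// sqr_ge0.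
Qed.

(** Same estimate as for the derivative, with the Lipschitz bound on [Phi] in place of the quadratic
    remainder. *)
Lemma conv_cont k Phi : locint k -> rtest Phi -> continuous (conv k Phi).
Proof.
move=> lk tP.
suff H (x : E) : conv k Phi @ x --> conv k Phi x by move=> x; exact: H.
have [_ [r P0]] := tP.
have HM : exists2 M : R, 0 <= M & forall i y, `|pd i Phi y| <= M.
  have /fin_all_exists[M HM] i : exists M, 0 <= M /\ forall y, `|pd i Phi y| <= M.
    by have [M] := rtest_bounded (rtest_pd i tP); exists M.
  exists (\sum_i M i) => [|i y]; first by apply: sumr_ge0 => i _; case: (HM i).
  apply: le_trans ((HM i).2 y) _.
  by rewrite (bigD1 i)//= lerDl; apply: sumr_ge0 => j _; case: (HM j).
have [M M0 {}HM] := HM.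
pose r' := r + `|x| + 1.
pose C := d%:R * (M * Int (fun y => `|k y| * bx r' y)).
have C0 : 0 <= C.
  rewrite mulr_ge0// mulr_ge0//; apply: Int_ge0 => y.
  by rewrite mulr_ge0// bx_ge0.
have key v : `|v| <= 1 -> `|conv k Phi (x + v) - conv k Phi x| <= `|v| * C.
  move=> v1; pose Psi y := Phi (x + v + y) - Phi (x + y).
  have -> : conv k Phi (x + v) - conv k Phi x = Int (fun y => k y * Psi y).
    rewrite /conv -IntB//; [|exact: integ_conv|exact: integ_conv].
    by congr Int; apply/funext => y; rewrite mulrBr.
  have mPsi : mrow Psi.
    apply: measurable_funB; apply: mrow_shift; exact: rtest_continuous.
  have -> : `|v| * C = (d%:R * (`|v| * M)) * Int (fun y => `|k y| * bx r' y).
    by rewrite /C; ring.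
  apply: Int_locint_bound => // y.
  have [yr|ry] := leP `|y| r'.
    rewrite bx1// mulr1 /Psi addrAC; apply: lipschitz_bound => //; exact: rtest_sm.
  have ny : r + 1 < `|x + y|.
    have := ler_normB (x + y) x; rewrite addrAC subrr add0r => h.
    rewrite -(ltrD2r `|x|); apply: lt_le_trans h.
    by rewrite addrAC.
  have ny1 : r < `|x + y| by apply: lt_trans ny; rewrite ltrDl.
  have ny2 : r < `|x + v + y|.
    have := ler_normB (x + y + v) v; rewrite addrK [in X in _ <= X]addrAC => h.
    rewrite -(ltrD2r 1); apply: lt_le_trans ny _; apply: le_trans h _.
    by rewrite lerD2l.
  by rewrite /Psi !P0// subr0 normr0 !mulr_ge0 ?bx_ge0.
apply/(@cvgrPdist_le _ _ _ _ (nbhs_filter x)) => /= e e0.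
have C1 : 0 < C + 1 by rewrite ltr_wpDl.
have dl0 : 0 < Num.min 1 (e / (C + 1)) by rewrite lt_min ltr01 divr_gt0.
apply: (@filterS _ _ (nbhs_filter x) _ _ _ (nbhsx_ballx x _ dl0)) => z.
rewrite -ball_normE /= distrC lt_min => /andP[zx1 zx2].
have zE : z = x + (z - x) by rewrite addrC subrK.
rewrite distrC zE; apply: le_trans (key _ (ltW zx1)) _.
apply: (@le_trans _ _ (`|z - x| * (C + 1))); first by rewrite ler_wpM2l// lerDl.
by rewrite -ler_pdivlMr// ltW.
Qed.

Lemma pd_conv k Phi i : locint k -> rtest Phi -> pd i (conv k Phi) = conv k (pd i Phi).
Proof.
move=> lk tP; apply/funext => x; rewrite pdE.
by have [_ ->] := is_derive_conv x i lk tP; rewrite pdE.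
Qed.

Lemma sm_conv k Phi : locint k -> rtest Phi -> sm setT (conv k Phi).
Proof.
move=> lk tP; apply: (sm_coind (P := fun g => exists2 Phi, rtest Phi & g = conv k Phi)).
- exact: openT.
- move=> _ [Psi tPsi ->]; split; first by move=> x _; exact: conv_cont.
  move=> i; exists (conv k (pd i Psi)); first by exists (pd i Psi) => //; exact: rtest_pd.
  by move=> x _; exact: is_derive_conv.
by exists Phi.
Qed.

Lemma pds_conv k Phi s : locint k -> rtest Phi -> pds s (conv k Phi) = conv k (pds s Phi).
Proof.
move=> lk tP; elim: s => //= i s ->; rewrite pd_conv//; exact: rtest_pds.
Qed.

End convolution.

(** * Flat functions, smooth steps and bump functions *)

Section flat_function.
Context {R : realType}.

(** All derivatives of [exp (- 1 / t)], extended by 0 to [t <= 0], have this form, so the class is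
    stable under differentiation. *)
Definition flat_mul (q : {poly R}) (t : R) : R :=
  if 0 < t then q.[t^-1] * expR (- t^-1) else 0.

(** Comes from the single Taylor term [s ^ (n + 2) / (n + 2)!] of [expR s]; the two spare powers
    become the factor [t ^ 2] in [flat_mul_quad]. *)
Lemma expR_decay (n : nat) (s : R) : 0 < s -> s ^+ n * expR (- s) <= n.+2`!%:R / s ^+ 2.
Proof.
move=> s0; have := expR_ge1Dxn n.+1 (ltW s0).
rewrite expRN => h.
have f0 : 0 < n.+2`!%:R :> R by rewrite ltr0n fact_gt0.
have h' : s ^+ n.+2 / n.+2`!%:R <= expR s.
  by apply: le_trans h; rewrite lerDr.
rewrite ler_pdivlMr ?exprn_gt0// mulrAC -exprD addn2.
rewrite ler_pdivrMr ?expR_gt0// -ler_pdivrMl//.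
by rewrite mulrC.
Qed.

Lemma flat_mul_quad (q : {poly R}) : exists C : R, forall t, `|flat_mul q t| <= C * t ^+ 2.
Proof.
exists (\sum_(i < size q) `|q`_i| * i.+2`!%:R) => t; rewrite /flat_mul.
case: ifPn => [t0|_]; last first.
  rewrite normr0 mulr_ge0 ?sqr_ge0//; apply: sumr_ge0 => i _.
  by rewrite mulr_ge0.
rewrite horner_coef mulr_suml (le_trans (ler_norm_sum _ _ _))//.
rewrite mulr_suml; apply: ler_sum => i _.
have s0 : 0 < t^-1 by rewrite invr_gt0.
rewrite -mulrA normrM -mulrA; apply: ler_wpM2l => //.
rewrite ger0_norm; last by rewrite mulr_ge0 ?expR_ge0// exprn_ge0// ltW.
by apply: le_trans (expR_decay i s0) _; rewrite exprVn invrK.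
Qed.

(** For [t > 0] both factors depend on [1 / t], whose derivative [- 1 / t ^ 2] accounts for ['X^2]
    and the signs. At [t = 0] the quadratic bound forces the derivative to be 0. *)
Lemma is_derive_flat_mul (q : {poly R}) (t : R) :
  is_derive t 1 (flat_mul q) (flat_mul ('X^2 * (q - q^`())) t).
Proof.
have [t0|t0|->] := ltgtP t 0.
- rewrite /flat_mul ltNge (ltW t0)/=.
  apply: (near_eq_is_derive (f := fun=> 0 : R)).
  near=> s; rewrite ltNge ltW//=.
  by near: s; exact: lt_nbhsl.
- rewrite {2}/flat_mul t0.
  apply: (near_eq_is_derive (f := fun t : R => q.[t^-1] * expR (- t^-1))).
    near=> s; rewrite /flat_mul ifT//.
    by near: s; exact: lt_nbhsr.
  have tn0 : t != 0 by rewrite gt_eqF.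
  have dinv : is_derive t 1 (fun s : R => s^-1) (- t ^- 2).
    have di : derivable (@id R) t 1 by exact: derivable_id.
    split; first exact: (derivableV tn0 di).
    by rewrite (deriveV tn0 di) derive_id [_ *: _]mulr1.
  have dexp : is_derive (t^-1) 1 (fun s : R => expR (- s)) (- expR (- t^-1)).
    have h := @is_derive_comp1 _ _ expR (expR (- t^-1)) (-%R) (t^-1) 1
      (@derivable_opp R (t^-1) 1) (is_derive_expR _).
    by apply: (is_derive_eq h); rewrite (@derive_val _ _ _ (t^-1) 1 -%R (-1)) mulrN1.
  have dF : is_derive (t^-1) 1 (fun s : R => q.[s] * expR (- s))
     (q^`().[t^-1] * expR (- t^-1) - q.[t^-1] * expR (- t^-1)).
    have h := is_deriveM (is_derive_poly q (t^-1)) dexp.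
    by apply: (is_derive_eq h); rewrite /GRing.scale/=; ring.
  have [dinv1 dinv2] := dinv.
  have h := is_derive_comp1 dinv1 dF; apply: (is_derive_eq h).
  rewrite dinv2 hornerM hornerXn hornerD hornerN exprVn; ring.
- have -> : flat_mul ('X^2 * (q - q^`())) 0 = 0 by rewrite /flat_mul ltxx.
  have [C HC] := flat_mul_quad q.
  apply: (is_derive_quad (C := C)) => s _.
  by rewrite mulr0 subr0 add0r [_ *: _]mulr1 {2}/flat_mul ltxx subr0.
Unshelve. all: by end_near. Qed.

Definition flat (t : R) : R := flat_mul 1 t.

Lemma smooth1_flat : smooth1 setT flat.
Proof.
apply: (smooth1_coind (P := fun F => exists q, F = flat_mul q)).
- exact: openT.
- move=> _ [q ->]; exists (flat_mul ('X^2 * (q - q^`()))); first by eexists.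
  by move=> x _; exact: is_derive_flat_mul.
- by exists 1.
Qed.

Lemma flat_gt0 t : 0 < t -> 0 < flat t.
Proof. by move=> t0; rewrite /flat /flat_mul t0 hornerC mul1r expR_gt0. Qed.

Lemma flat_eq0 t : t <= 0 -> flat t = 0.
Proof. by move=> t0; rewrite /flat /flat_mul ltNge t0. Qed.

Lemma flat_ge0 t : 0 <= flat t.
Proof. by have [/flat_eq0 ->|/flat_gt0/ltW] := leP t 0. Qed.

(** A smooth transition from 1 on [t <= 0] to 0 on [t >= 1]. The inverse is written as a real power
    so that [smooth1_powR] gives its smoothness. *)
Definition step (t : R) : R := flat (1 - t) * (flat t + flat (1 - t)) `^ (-1).

Lemma step_den t : 0 < flat t + flat (1 - t).
Proof.
have [t0|t0] := leP t 0.
  by rewrite ltr_wpDl ?flat_ge0// flat_gt0// subr_gt0 (le_lt_trans t0).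
by rewrite ltr_pwDl ?flat_ge0// flat_gt0.
Qed.

Lemma stepE t : step t = flat (1 - t) / (flat t + flat (1 - t)).
Proof. by rewrite /step powR_inv1// ltW// step_den. Qed.

Lemma step1 t : t <= 0 -> step t = 1.
Proof.
by move=> t0; rewrite stepE (flat_eq0 t0) add0r divff// gt_eqF// flat_gt0// subr_gt0 (le_lt_trans t0).
Qed.

Lemma step0 t : 1 <= t -> step t = 0.
Proof. by move=> t1; rewrite stepE [flat (1 - t)]flat_eq0 ?mul0r// subr_le0. Qed.

Lemma step_ge0 t : 0 <= step t.
Proof. by rewrite stepE divr_ge0 ?flat_ge0// ltW// step_den. Qed.

End flat_function.

Section bump_functions.
Context {R : realType} {d : nat}.
Local Notation E := 'rV[R]_d.

(** The sup norm is not smooth, hence a product over the coordinates; neither is [|x_i|], hence the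
    squares. It is 1 on the cube of radius [a] and 0 outside that of radius [b]. *)
Definition bump (a b : R) (x : E) : R :=
  \prod_(i < d) step ((x 0 i ^+ 2 - a ^+ 2) / (b ^+ 2 - a ^+ 2)).

Lemma sm_step (U : set E) (u : E -> R) : open U -> sm U u -> sm U (fun x => step (u x)).
Proof.
move=> oU su.
have s1 : sm U (fun x => flat (1 - u x)).
  apply: (sm_comp1 (I := setT) (F := flat)) => //; first exact: smooth1_flat.
  by apply: smB => //; exact: sm_cst.
have s0 : sm U (fun x => flat (u x)).
  by apply: (sm_comp1 (I := setT) (F := flat)) => //; exact: smooth1_flat.
apply: smM => //.
apply: (sm_comp1 (I := [set x | 0 < x]) (F := fun x => x `^ (-1))) => //.
- by move=> x _; exact: step_den.
- exact: smooth1_powR.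
- exact: smD.
Qed.

Lemma sm_bump (a b : R) : sm setT (bump a b).
Proof.
apply: sm_prod; first exact: openT.
move=> i; apply: sm_step; first exact: openT.
have o := @openT E.
under eq_fun do rewrite mulrC.
by apply: smZ => //; apply: smB => //; [apply: smX => //; exact: sm_coord|exact: sm_cst].
Qed.

Lemma bump_ge0 a b x : 0 <= bump a b x.
Proof. by apply: prodr_ge0 => i _; exact: step_ge0. Qed.

Lemma bump1 a b x : 0 < a -> a < b -> `|x| <= a -> bump a b x = 1.
Proof.
move=> a0 ab xa; apply: big1 => i _; apply: step1.
have xi := le_trans (norm_coord x i) xa.
have ba : 0 < b ^+ 2 - a ^+ 2 by rewrite subr_gt0 ltrXn2r// ?ltW//; lra.
by rewrite pmulr_lle0 ?invr_gt0// subr_le0 -real_normK ?num_real// lerXn2r// nnegrE ltW.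
Qed.

Lemma bump0 a b x : 0 < a -> a < b -> b <= `|x| -> bump a b x = 0.
Proof.
move=> a0 ab xb.
have b0 : 0 < b by lra.
have [i xi] : exists i, b <= `|x 0 i|.
  apply: contrapT => /forallNP H.
  suff : `|x| < b by rewrite ltNge xb.
  rewrite [ltLHS]/Num.norm/= mx_normrE; apply/bigmax_ltP; split=> //= -[k i] _ /=.
  by rewrite (ord1 k) ltNge; apply/negP.
rewrite /bump (bigD1 i)//= step0 ?mul0r//.
have ba : 0 < b ^+ 2 - a ^+ 2 by rewrite subr_gt0 ltrXn2r// ?ltW//; lra.
rewrite ler_pdivlMr// mul1r lerB// -[leRHS]real_normK ?num_real// lerXn2r// nnegrE ltW//.
Qed.

Lemma bumpN a b x : bump a b (- x) = bump a b x.
Proof. by apply: eq_bigr => i _; rewrite mxE sqrrN. Qed.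

Lemma rtest_bump a b : 0 < a -> a < b -> rtest (bump a b).
Proof.
move=> a0 ab; split; first exact: sm_bump.
by exists b => x /ltW bx; exact: bump0.
Qed.

End bump_functions.

(** * Powers of the Euclidean norm *)

Section power_kernel.
Context {R : realType} {d : nat}.
Local Notation E := 'rV[R]_d.
Local Notation T := (d.-tuple (measurableTypeR R)).
Implicit Types (x y : E) (a : R).

Lemma dotp_ge0 x : 0 <= dotp x x.
Proof. by apply: sumr_ge0 => i _; rewrite -expr2 sqr_ge0. Qed.

Lemma dotp_ge_norm x : `|x| ^+ 2 <= dotp x x.
Proof.
rewrite -[leRHS]sqr_sqrtr ?dotp_ge0// lerXn2r ?nnegrE ?sqrtr_ge0//.
apply: norm_le_coord; first exact: sqrtr_ge0.
move=> i; rewrite -sqrtr_sqr ler_wsqrtr// /dotp (bigD1 i)//= -expr2 lerDl.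
by apply: sumr_ge0 => j _; rewrite -expr2 sqr_ge0.
Qed.

Lemma dotp_le_norm x : dotp x x <= d%:R * `|x| ^+ 2.
Proof.
rewrite mulr_natl -[X in _ <= _ *+ X]card_ord -sumr_const; apply: ler_sum => i _.
by rewrite -expr2 -real_normK ?num_real// lerXn2r ?nnegrE// norm_coord.
Qed.

Lemma dotp_gt0 x : x != 0 -> 0 < dotp x x.
Proof. by move=> x0; apply: lt_le_trans (dotp_ge_norm x); rewrite exprn_gt0// normr_gt0. Qed.

Lemma dotp0 : dotp (0 : E) 0 = 0.
Proof. by rewrite /dotp big1// => i _; rewrite mxE mul0r. Qed.

Lemma dotpZ (c : R) x : dotp (c *: x) (c *: x) = c ^+ 2 * dotp x x.
Proof. by rewrite /dotp mulr_sumr; apply: eq_bigr => i _; rewrite !mxE; ring. Qed.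

Lemma dotpN x : dotp (- x) (- x) = dotp x x.
Proof. by rewrite -scaleN1r dotpZ sqrrN expr1n mul1r. Qed.

(** The function [q ^ a] with [q = |x| ^ 2]. By the convention on real powers its value at the
    origin is 0 for [a < 0]. *)
Definition Rp a x : R := dotp x x `^ a.

Lemma enorm_powR (b : R) x : enorm x `^ b = Rp (b / 2) x.
Proof. by rewrite /enorm -powR12_sqrt ?dotp_ge0// -powRrM /Rp mulrC. Qed.

Definition punctured : set E := [set x | x != 0].

Lemma open_punctured : open punctured.
Proof.
rewrite (_ : punctured = [set x | 0 < `|x|]); first exact: open_norm_gt.
by apply/seteqP; split => x /=; rewrite /punctured /= normr_gt0.
Qed.

Lemma sm_dotp (U : set E) : open U -> sm U (fun x => dotp x x).
Proof.
by move=> oU; apply: sm_sum => // i; apply: smM => //; exact: sm_coord.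
Qed.

Lemma sm_Rp a : sm punctured (Rp a).
Proof.
have oP := open_punctured.
apply: (@sm_comp1 _ _ _ [set t : R | 0 < t] (fun t : R => t `^ a) (fun x : E => dotp x x)) => //.
- by move=> x; exact: dotp_gt0.
- exact: smooth1_powR.
- exact: sm_dotp.
Qed.

Lemma pd_sum (I : Type) (r : seq I) (F : I -> E -> R) i x :
  (forall k, sm setT (F k)) ->
  pd i (fun y => \sum_(k <- r) F k y) x = \sum_(k <- r) pd i (F k) x.
Proof.
move=> sF; have oT := @openT E; elim: r => [|k r IH].
  rewrite big_nil (pd_ext i oT (g := fun=> 0))// ?pd_cst// => y _.
  by rewrite big_nil.
rewrite big_cons -IH (pd_ext i oT (g := fun y => F k y + \sum_(k <- r) F k y))//.
  rewrite pdD//; first exact: (sm_derivable (sF k)).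
  exact: (sm_derivable (sm_sum r oT sF)).
by move=> y _; rewrite big_cons.
Qed.

Lemma pd_dotp i x : pd i (fun x => dotp x x) x = 2 * x 0 i.
Proof.
have oT := @openT E; rewrite pd_sum; last first.
  by move=> k; apply: smM => //; exact: sm_coord.
rewrite (bigD1 i)//= big1 => [|j ji]; rewrite pdM ?pd_coord;
  try exact: (sm_derivable (sm_coord _ oT)).
  by rewrite eqxx /=; ring.
by rewrite eq_sym (negbTE ji) mul0r mulr0 addr0.
Qed.

Lemma pd_Rp a i x : x != 0 -> pd i (Rp a) x = 2 * a * (x 0 i * Rp (a - 1) x).
Proof.
move=> x0; have q0 := dotp_gt0 x0.
have [dd _] := is_derive1_powR a q0.
rewrite (pd_comp1 (F := fun t : R => t `^ a) (g := fun x => dotp x x))//.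
  by rewrite powR_derive1 ?in_itv/= ?q0// pd_dotp /Rp; ring.
by apply: (sm_derivable (sm_dotp (@openT E))).
Qed.

Lemma RpZ a (c : R) x : Rp a (c *: x) = (c ^+ 2) `^ a * Rp a x.
Proof. by rewrite /Rp dotpZ powRM ?sqr_ge0 ?dotp_ge0. Qed.

Lemma Rp_ge0 a x : 0 <= Rp a x. Proof. exact: powR_ge0. Qed.

Lemma RpN a x : Rp a (- x) = Rp a x. Proof. by rewrite /Rp dotpN. Qed.

Lemma continuous_dotp : continuous (fun x : E => dotp x x).
Proof. exact: (sm_continuous (sm_dotp openT)). Qed.

Lemma mrow_Rp a : mrow (Rp a).
Proof.
by apply: (measurableT_comp (measurable_powR a)); exact: mrow_continuous continuous_dotp.
Qed.

Lemma mrow_Rpbx a r : mrow (fun y => Rp a y * bx r y).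
Proof. by apply: mrowM; [exact: mrow_Rp|exact: mrow_bx]. Qed.

(** For [r1 <= r2] this is [q ^ a] restricted to [r1 < |y| <= r2] in the sup norm. Cubical shells
    scale as well as round ones and keep the domains of integration simple. *)
Definition shell a (r1 r2 : R) y : R := Rp a y * (bx r2 y - bx r1 y).

Lemma shell_ge0 a r1 r2 y : r1 <= r2 -> 0 <= shell a r1 r2 y.
Proof. by move=> r12; rewrite mulr_ge0 ?Rp_ge0// subr_ge0 bx_mono. Qed.

Lemma integ_shell a (r1 r2 : R) : 0 < r1 -> r1 <= r2 -> integ (shell a r1 r2).
Proof.
move=> r1p r12; pose K : set E := [set x | `|x| <= r2] `&` [set x | r1 <= `|x|].
have cK : compact K.
  apply: compact_closedI; first exact: compact_norm_le.
  apply: (@closed_comp _ _ (fun x : E => `|x|) [set y | r1 <= y]); last exact: closed_ge.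
  by move=> x _; exact: norm_continuous.
have [|M M0 HM] := @cont_bounded_on _ _ K (Rp a) cK.
  move=> x [_ /= r1x]; apply: (sm_cont (sm_Rp a)).
  by rewrite /punctured /= -normr_gt0 (lt_le_trans r1p).
have ms : mrow (shell a r1 r2).
  by apply: mrowM; [exact: mrow_Rp|apply: measurable_funB; exact: mrow_bx].
apply: (integ_le ms _ (integZ M (integ_bx (Num.max r1 r2)))) => y.
rewrite /shell !normrM (ger0_norm M0) (ger0_norm (Rp_ge0 _ _)) (ger0_norm (bx_ge0 _ _)).
have [yr2|yr2] := leP `|y| r2; have [yr1|yr1] := leP `|y| r1.
- by rewrite (bx1 yr2) (bx1 yr1) subrr normr0 mulr0 mulr_ge0 ?bx_ge0.
- rewrite (bx1 yr2) (bx0 yr1) bx1 ?le_max ?yr2 ?orbT// subr0 normr1 !mulr1.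
  apply: le_trans (ler_norm _) _; apply: HM; split => //=; exact: ltW.
- by move: yr2; rewrite ltNge (le_trans yr1 r12).
- by rewrite (bx0 yr1) (bx0 yr2) subrr normr0 mulr0 mulr_ge0// bx_ge0.
Qed.

Lemma shell_split a (r1 r2 r3 : R) y : shell a r1 r3 y = shell a r2 r3 y + shell a r1 r2 y.
Proof. by rewrite /shell; ring. Qed.

Lemma bxZ (r : R) (y : E) : bx r (2 *: y) = bx (r / 2) y.
Proof. by rewrite /bx normrZ ger0_norm// ler_pdivlMr// mulrC. Qed.

(* The integral over a dyadic shell scales by [2 ^ - (d + 2 a)], so the shells
   of radii [r / 2 ^ n] sum up to a geometric series. *)
Lemma Int_shell_bound a (r : R) : 0 < r -> - (d%:R / 2) < a ->
  exists C : R, forall n, Int (shell a (r / 2 ^+ n) r) <= C.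
Proof.
move=> r0 ad.
(* Here [p = 2 ^ (d + 2 a)], and [p > 1] is what the hypothesis [a > - d / 2] provides. *)
pose p : R := 2 ^+ d * (2 ^+ 2) `^ a.
have p0 : 0 < p by rewrite mulr_gt0 ?exprn_gt0 ?powR_gt0 ?exprn_gt0.
have p1 : 1 < p.
  rewrite /p -powR_mulrn// -[2 ^+ 2]powR_mulrn// -powRrM -powRD ?pnatr_eq0 ?implybT//.
  rewrite -[ltLHS](powRr0 2) /powR ?pnatr_eq0/=.
  rewrite ltr_expR ltr_pM2r ?ln_gt0 ?ltr1n//; lra.
have rn n : 0 < r / 2 ^+ n by rewrite divr_gt0 ?exprn_gt0.
have rnr n : r / 2 ^+ n <= r.
  by rewrite ler_pdivrMr ?exprn_gt0// ler_peMr ?(ltW r0)// exprn_ege1// ler1n.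
pose J := Int (shell a (r / 2) r).
have rec n : Int (shell a (r / 2 ^+ n.+1) r) = J + p^-1 * Int (shell a (r / 2 ^+ n) r).
  have e1 : shell a (r / 2 ^+ n.+1) r =
     fun y => shell a (r / 2) r y + shell a (r / 2 ^+ n.+1) (r / 2) y.
    by apply/funext => y; exact: shell_split.
  have r12 : r / 2 ^+ n.+1 <= r / 2.
    by rewrite ler_pM2l// lef_pV2 ?posrE ?exprn_gt0// exprS ler_peMr// exprn_ege1// ler1n.
  rewrite e1 IntD; last 2 first.
  - by apply: integ_shell; rewrite ?divr_gt0// ler_pdivrMr//; lra.
  - by apply: integ_shell.
  congr (_ + _).
  rewrite (Int_affine (c := 2) 0 _ (integ_shell a (rn n) (rnr n)))//.
  have -> : (fun y : E => shell a (r / 2 ^+ n) r (2 *: y + 0)) =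
      fun y => (2 ^+ 2) `^ a * shell a (r / 2 ^+ n.+1) (r / 2) y.
    apply/funext => y; rewrite addr0 /shell RpZ !bxZ -mulrA.
    by rewrite -[r / _ / 2]mulrA -invfM -exprSr.
  rewrite IntZ; last exact: integ_shell.
  by rewrite gtr0_norm// (mulrA (2 ^+ d)) -/p mulKf// gt_eqF.
have J0 : 0 <= J by apply: Int_ge0 => y; apply: shell_ge0; rewrite ler_pdivrMr//; lra.
(* The sum of the geometric series, that is, the fixed point of the recursion [rec]. *)
exists (J / (1 - p^-1)).
have q1 : 0 < 1 - p^-1 by rewrite subr_gt0 invf_lt1.
elim=> [|n IH].
  rewrite expr0 divr1 (_ : shell a r r = fun=> 0).
    by rewrite /Int Rintegral_cst// mul0r divr_ge0// ltW.
  by apply/funext => y; rewrite /shell subrr mulr0.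
rewrite rec (_ : J / (1 - p^-1) = J + p^-1 * (J / (1 - p^-1))).
  by rewrite lerD2l ler_pM2l ?invr_gt0.
have pn : p != 0 by rewrite gt_eqF.
have p1n : p - 1 != 0 by rewrite subr_eq0 gt_eqF.
by field; rewrite pn p1n.
Qed.

(** Monotone convergence along the shells [r / 2 ^ n < |y| <= r], whose integrals are bounded
    uniformly in [n]. *)
Lemma locint_Rp_neg a : - (d%:R / 2) < a -> a < 0 -> locint (Rp a).
Proof.
move=> ad a0; split=> [|r]; first exact: mrow_Rp.
have [r0|r0] := ltP 0 r; last first.
  apply: (integ_le (mrow_Rpbx a r) _ integ0) => y.
  have [->|y0] := eqVneq y 0.
    by rewrite /Rp dotp0 powR0 ?lt_eqF// mul0r.
  by rewrite bx0 ?mulr0// (le_lt_trans r0)// normr_gt0.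
have [C HC] := Int_shell_bound r0 ad.
have rn n : 0 < r / 2 ^+ n by rewrite divr_gt0 ?exprn_gt0.
have rnr n : r / 2 ^+ n <= r.
  by rewrite ler_pdivrMr ?exprn_gt0// ler_peMr ?(ltW r0)// exprn_ege1// ler1n.
pose F n (t : T) : \bar R := (shell a (r / 2 ^+ n) r (row_of_tuple t))%:E.
have mF n : measurable_fun [set: T] (F n).
  by apply/measurable_EFinP; exact: (integ_mrow (integ_shell a (rn n) (rnr n))).
have F0 n t : [set: T] t -> (0 <= F n t)%E.
  by move=> _; rewrite lee_fin shell_ge0.
have ndF t : [set: T] t -> {homo F ^~ t : n m / (n <= m)%N >-> (n <= m)%E}.
  move=> _ n m nm; rewrite lee_fin ler_wpM2l ?Rp_ge0// lerD2l lerN2 bx_mono//.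
  by rewrite ler_pM2l// lef_pV2 ?posrE ?exprn_gt0// ler_weXn2l// ler1n.
(* The sequence is eventually constant: away from the origin once [r / 2 ^ n < |y|], and at the
   origin because the power has the value 0 there. *)
have limF t : limn (F ^~ t) = (Rp a (row_of_tuple t) * bx r (row_of_tuple t))%:E.
  apply: lim_near_cst => //.
  set y := row_of_tuple t.
  have [y0|y0] := eqVneq y 0.
    by apply: nearW => n; rewrite /F -/y y0 /shell /Rp dotp0 powR0 ?lt_eqF// !mul0r.
  have ny : 0 < `|y| / r by rewrite divr_gt0// normr_gt0.
  have h2 : (2^-1 : R) ^+ n @[n --> \oo] --> (0 : R).
    by apply: cvg_expr; rewrite ger0_norm// invf_lt1// ltr1n.
  move/cvgrPdist_lt : h2 => /(_ _ ny); apply: filterS => n.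
  rewrite sub0r normrN ger0_norm ?exprn_ge0// ltr_pdivlMr// exprVn mulrC => h.
  by rewrite /F -/y /shell (bx0 h) subr0.
have := monotone_convergence (lebesgue_tuple R d) measurableT mF F0 ndF.
under eq_integral do rewrite limF.
move=> e; apply/integP; split; first exact: mrow_Rpbx.
under eq_integral do rewrite ger0_norm ?mulr_ge0 ?Rp_ge0 ?bx_ge0//.
rewrite e (@le_lt_trans _ _ C%:E) ?ltry//.
apply: lime_le.
  apply: ereal_nondecreasing_is_cvgn => n m nm.
  by apply: ge0_le_integral => // t tT; [exact: F0|exact: (ndF t tT n m nm)].
apply: nearW => n.
have in_ := integ_shell a (rn n) (rnr n).
rewrite -(@fineK _ (\int[_]_x F n x)%E); last exact: (integrable_fin_num measurableT in_).
by rewrite lee_fin; exact: HC.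
Qed.

Lemma locint_Rp a : - (d%:R / 2) < a -> locint (Rp a).
Proof.
move=> ad; have [a0|a0] := ltP a 0; first exact: locint_Rp_neg.
split=> [|r]; first exact: mrow_Rp.
apply: (integ_le (mrow_Rpbx a r) _ (integZ ((d%:R * r ^+ 2) `^ a) (integ_bx r))) => y.
rewrite !normrM (ger0_norm (Rp_ge0 _ _)) (ger0_norm (powR_ge0 _ _)).
have [yr|ry] := leP `|y| r; last by rewrite bx0// normr0 !mulr0.
apply: ler_wpM2r => //; apply: ge0_ler_powR; rewrite ?nnegrE ?dotp_ge0//.
  by rewrite mulr_ge0// sqr_ge0.
apply: le_trans (dotp_le_norm y) _; rewrite ler_wpM2l// lerXn2r ?nnegrE//.
exact: le_trans yr.
Qed.

End power_kernel.

(** * Approximation away from the origin *)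

Section annular_functions.
Context {R : realType} {d : nat}.
Local Notation E := 'rV[R]_d.
Implicit Types (f g e X Phi : E -> R) (x y : E) (s : seq 'I_d).

Lemma Cn_union n (U W : set E) g : Cn n U g -> Cn n W g -> Cn n (U `|` W) g.
Proof.
elim: n g => [|n IH] g /= [cU dU] [cW dW]; split=> //.
- by move=> x [/cU|/cW].
- by move=> x [/cU|/cW].
move=> i; have [a b] := dU i; have [a' b'] := dW i; split; last exact: IH.
by move=> x [/a|/a'].
Qed.

Lemma sm_union (U W : set E) g : sm U g -> sm W g -> sm (U `|` W) g.
Proof. by move=> sU sW n; exact: Cn_union. Qed.

(* Vanishing of all derivatives up to a given order is uniform over the finitely
   many sequences of indices of bounded length. *)
Lemma fin_lists (P : seq 'I_d -> nat -> Prop) :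
  (forall s, exists N, forall n, (N <= n)%N -> P s n) ->
  forall m, exists N, forall n, (N <= n)%N -> forall s, (size s <= m)%N -> P s n.
Proof.
move=> HP m; elim: m P HP => [|m IH] P HP.
  have [N HN] := HP [::]; exists N => n Nn s.
  by rewrite leqn0 size_eq0 => /eqP ->; exact: HN.
have [N0 HN0] := HP [::].
have /fin_all_exists[N HN] i : exists N, forall n, (N <= n)%N ->
    forall s, (size s <= m)%N -> P (i :: s) n.
  by apply: (IH (fun s n => P (i :: s) n)) => s; exact: HP.
exists (maxn N0 (\max_i N i)) => n; rewrite geq_max => /andP[n0 nN] [|i s] sm'.
  exact: HN0.
by apply: (HN i) => //; apply: leq_trans nN; exact: leq_bigmax.
Qed.

Variables dl rho : R.
Hypothesis dl0 : 0 < dl.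

Definition annulus : set E := [set x | dl <= `|x| <= rho].

(** Multiplication by such a function turns anything smooth off the origin into a test function,
    which is how singular powers become admissible arguments of a distribution. *)
Definition annular X : Prop :=
  [/\ sm setT X, (forall x, `|x| < dl -> X x = 0) &
      (forall x, rho < `|x| -> X x = 0)].

Lemma annular_rtest X : annular X -> rtest X.
Proof. by case=> sX _ X0; split=> //; exists rho. Qed.

Lemma annulus_punctured x : annulus x -> punctured x.
Proof.
by move=> /andP[dx _]; rewrite /punctured /= -normr_gt0 (lt_le_trans dl0).
Qed.

Lemma annular0 X x : annular X -> ~ annulus x -> X x = 0.
Proof.
move=> [_ X0 X1] nx; have [xd|dx] := ltP `|x| dl; first exact: X0.
have [xr|rx] := leP `|x| rho; last exact: X1.
by exfalso; apply: nx; rewrite /annulus /= dx.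
Qed.

Lemma open_cover_punctured : punctured `|` [set x | `|x| < dl] = [set: E].
Proof.
apply/seteqP; split=> // x _; have [->|x0] := eqVneq x 0; last by left.
by right; rewrite /= normr0.
Qed.

(** Smoothness is glued along a cover by two open sets: the complement of the origin, and the ball
    [|x| < dl] on which the product is 0. *)
Lemma annularM X e : annular X -> sm punctured e -> annular (fun x => X x * e x).
Proof.
move=> [sX X0 X1] se; split=> [|x xd|x rx]; last 2 first.
- by rewrite X0// mul0r.
- by rewrite X1// mul0r.
rewrite -open_cover_punctured; apply: sm_union.
  by apply: smM => //; [exact: open_punctured|exact: sm_sub sX].
apply: (sm_ext (f := fun=> 0)); first exact: open_norm_lt.
  by move=> x xd; rewrite X0// mul0r.
by apply: sm_cst; exact: open_norm_lt.
Qed.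

Lemma annular_pd X i : annular X -> annular (pd i X).
Proof.
move=> [sX X0 X1]; split; first exact: sm_pd.
  by apply: (@pds_zero _ _ _ [:: i] X); [exact: open_norm_lt|exact: X0].
by apply: (@pds_zero _ _ _ [:: i] X); [exact: open_norm_gt|exact: X1].
Qed.

Lemma pd_annularM X e i : annular X -> sm punctured e ->
  pd i (fun x => X x * e x) = fun x => pd i X x * e x + X x * pd i e x.
Proof.
move=> aX se; apply/funext => x; have [[sX X0 X1] aP] := (aX, annular_pd i aX).
have : [set: E] x by []; rewrite -open_cover_punctured => -[xp|xd].
  rewrite pdM//; first exact: (sm_derivable sX).
  exact: (sm_derivable se).
have [_ P0 _] := aP; rewrite X0// P0// !mul0r addr0.
apply: (@pds_zero _ _ [set x | `|x| < dl] [:: i]) => //; first exact: open_norm_lt.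
by move=> y yd; rewrite X0// mul0r.
Qed.

Definition unif0 (e : nat -> E -> R) : Prop :=
  forall s (eps : R), 0 < eps -> exists N, forall n, (N <= n)%N ->
    forall x, annulus x -> `|pds s (e n) x| <= eps.

Lemma unif0_pd (e : nat -> E -> R) i : unif0 e -> unif0 (fun n => pd i (e n)).
Proof.
by move=> He s eps eps0; have [N HN] := He (rcons s i) eps eps0; exists N => n nN x Ax; rewrite -pds_rcons HN.
Qed.

(** By Leibniz's rule the innermost derivative falls on [X] or on [e], and both products are again
    of the form treated. Hence the induction on [s] from its end, for all [X] and [e]. *)
Lemma annular_lim X (e : nat -> E -> R) s (eps : R) : annular X ->
  (forall n, sm punctured (e n)) -> unif0 e -> 0 < eps ->
  exists N, forall n, (N <= n)%N -> forall x, `|pds s (fun x => X x * e n x) x| <= eps.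
Proof.
elim/last_ind: s X e eps => [|s i IH] X e eps aX se ue eps0.
  have [M M0 HM] := rtest_bounded (annular_rtest aX).
  have M1 : 0 < M + 1 by rewrite ltr_wpDl.
  have [N HN] := ue [::] (eps / (M + 1)) (divr_gt0 eps0 M1).
  exists N => n nN x /=; have [Ax|nAx] := pselect (annulus x); last first.
    by rewrite (annular0 aX nAx) mul0r normr0 ltW.
  rewrite normrM; apply: le_trans (ler_pM _ _ (HM x) (HN n nN x Ax)) _ => //.
  rewrite mulrCA ger_pMr// ler_pdivrMr// mul1r.
  by rewrite lerDl.
have e2 : 0 < eps / 2 by rewrite divr_gt0.
have [N1 H1] := IH _ _ _ (annular_pd i aX) se ue e2.
have [N2 H2] := IH X _ _ aX (fun n => sm_pd i (se n)) (unif0_pd i ue) e2.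
exists (maxn N1 N2) => n; rewrite geq_max => /andP[n1 n2] x.
rewrite pds_rcons (pd_annularM i aX (se n)) (pdsD s openT)//; last 2 first.
- by have [] := annularM (annular_pd i aX) (se n).
- by have [] := annularM aX (sm_pd i (se n)).
rewrite (splitr eps); apply: le_trans (ler_normD _ _) _.
by apply: lerD; [exact: H1|exact: H2].
Qed.

(** Distributions on real test functions. Any common bound [M] on the derivatives replaces the
    seminorm, which avoids handling suprema. *)
Definition rdist (u : (E -> R) -> R) : Prop :=
  (forall (c : R) g1 g2, rtest g1 -> rtest g2 ->
     u (fun x => c * g1 x + g2 x) = c * u g1 + u g2) /\
  (forall r : R, exists (C : R) (m : nat), forall g (M : R), rtest g ->
     (forall x, r < `|x| -> g x = 0) ->
     (forall s, (size s <= m)%N -> forall x, `|pds s g x| <= M) -> `|u g| <= C * M).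

Lemma rdist_lim (u : (E -> R) -> R) X (e : nat -> E -> R) (eps : R) : rdist u -> annular X ->
  (forall n, sm punctured (e n)) -> unif0 e -> 0 < eps ->
  exists N, forall n, (N <= n)%N -> `|u (fun x => X x * e n x)| <= eps.
Proof.
move=> [_ ub] aX se ue eps0; have [C [m HC]] := ub rho.
have C1 : 0 < `|C| + 1 by rewrite ltr_wpDl.
have e1 : 0 < eps / (`|C| + 1) by rewrite divr_gt0.
have [N HN] := fin_lists (fun s => annular_lim s aX se ue e1) m.
exists N => n nN; have aXe := annularM aX (se n).
have [_ _ Xe0] := aXe.
apply: le_trans (HC _ _ (annular_rtest aXe) Xe0 (HN n nN)) _.
rewrite mulrCA ger_pMr// ler_pdivrMr// mul1r.
by apply: le_trans (ler_norm _) _; rewrite lerDl.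
Qed.

Lemma rdistD u g1 g2 : rdist u -> rtest g1 -> rtest g2 ->
  u (fun x => g1 x + g2 x) = u g1 + u g2.
Proof.
move=> [ul _] t1 t2; rewrite -[u g1]mul1r -ul//; congr u.
by apply/funext => x; rewrite mul1r.
Qed.

Lemma rdist0 u : rdist u -> u (fun=> 0) = 0.
Proof.
move=> ru; have t0 : rtest (fun _ : E => 0 : R).
  split; last by exists 0.
  by apply: sm_cst; exact: openT.
have := rdistD ru t0 t0.
under eq_fun do rewrite addr0.
by move/(congr1 (fun z => z - u (fun=> 0))); rewrite subrr addrK.
Qed.

Lemma rdistZ u (c : R) g : rdist u -> rtest g -> u (fun x => c * g x) = c * u g.
Proof.
move=> ru tg; have t0 : rtest (fun _ : E => 0 : R).
  split; last by exists 0.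
  by apply: sm_cst; exact: openT.
have := ru.1 c g _ tg t0; rewrite (rdist0 ru) addr0 => <-; congr u.
by apply/funext => x; rewrite addr0.
Qed.

End annular_functions.

(** * Approximate identities and mollifiers *)

Section approximate_identity.
Context {R : realType} {d : nat}.
Local Notation E := 'rV[R]_d.
Implicit Types (f g e k Phi : E -> R) (x y : E) (s : seq 'I_d).

Lemma bx_le1 (r : R) y : bx r y <= 1.
Proof. by rewrite /bx lern1 leq_b1. Qed.

Definition approx_id (k : nat -> E -> R) : Prop :=
  [/\ forall n, locint (k n), forall n, integ (k n), forall n y, 0 <= k n y,
      forall n, Int (k n) = 1 &
      forall r eps : R, 0 < r -> 0 < eps -> exists N, forall n, (N <= n)%N ->
        Int (fun y => k n y * (1 - bx r y)) <= eps].

(** Since [k n] has integral 1, the error is the integral of [k n y (Phi (x + y) - Phi x)]: the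
    Lipschitz bound controls it for [|y| <= r], the small mass of the tail beyond. *)
Lemma approx_id_conv (k : nat -> E -> R) Phi (eps : R) : approx_id k -> rtest Phi -> 0 < eps ->
  exists N, forall n, (N <= n)%N -> forall x, `|conv (k n) Phi x - Phi x| <= eps.
Proof.
move=> [lk ik k0 k1 kt] tP eps0.
have [M M0 HM] := rtest_bounded tP.
have [M' M'0 HM'] : exists2 M : R, 0 <= M & forall i y, `|pd i Phi y| <= M.
  have /fin_all_exists[B HB] i : exists B, 0 <= B /\ forall y, `|pd i Phi y| <= B.
    by have [B] := rtest_bounded (rtest_pd i tP); exists B.
  exists (\sum_i B i) => [|i y]; first by apply: sumr_ge0 => i _; case: (HB i).
  apply: le_trans ((HB i).2 y) _.
  by rewrite (bigD1 i)//= lerDl; apply: sumr_ge0 => j _; case: (HB j).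
(* Each region contributes [eps / 2]. The summands 1 in [C] and [D] only keep the divisors
   positive. *)
pose C := d%:R * M' + 1; have C0 : 0 < C by rewrite ltr_wpDl// mulr_ge0.
pose r := eps / 2 / C; have r0 : 0 < r by rewrite !divr_gt0.
pose D := 2 * M + 1; have D0 : 0 < D by rewrite ltr_wpDl// mulr_ge0.
have [N HN] := kt r (eps / 2 / D) r0 (divr_gt0 (divr_gt0 eps0 (ltr0Sn _ 1)) D0).
exists N => n nN x.
have itail : integ (fun y => k n y * (1 - bx r y)).
  have := integB (ik n) ((lk n).2 r).
  by under eq_fun do rewrite -[X in X - _]mulr1 -mulrBr.
have ibx := (lk n).2 r.
have -> : conv (k n) Phi x - Phi x = Int (fun y => k n y * (Phi (x + y) - Phi x)).
  rewrite -[X in _ - X]mulr1 -(k1 n) -IntZ// /conv -IntB//; last 2 first.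
  - exact: integ_conv.
  - exact: integZ.
  by congr Int; apply/funext => y; rewrite mulrBr [Phi x * _]mulrC.
have iL : integ (fun y => k n y * (Phi (x + y) - Phi x)).
  have := integB (integ_conv x (lk n) tP) (integZ (Phi x) (ik n)).
  by under eq_fun do rewrite [Phi x * _]mulrC -mulrBr.
apply: le_trans (Int_norm iL) _.
have iR : integ (fun y => (eps / 2) * (k n y * bx r y) + (2 * M) * (k n y * (1 - bx r y))).
  by apply: integD; exact: integZ.
apply: (@le_trans _ _ (Int (fun y => (eps / 2) * (k n y * bx r y) + (2 * M) * (k n y * (1 - bx r y))))).
  apply: Int_le => //; first exact: integ_abs.
  move=> y; rewrite normrM (ger0_norm (k0 n y)).
  rewrite mulrCA [X in _ <= _ + X]mulrCA -mulrDr; apply: ler_wpM2l => //.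
  have [yr|ry] := leP `|y| r.
    rewrite bx1// subrr mulr0 addr0 mulr1.
    apply: le_trans (lipschitz_bound x y M'0 (rtest_sm tP) HM') _.
    rewrite mulrCA; apply: (@le_trans _ _ (r * C)).
      by apply: ler_pM => //; [rewrite mulr_ge0|rewrite lerDl].
    by rewrite /r divfK// gt_eqF.
  rewrite bx0// subr0 mulr0 add0r mulr1 mulr_natl mulr2n.
  by apply: le_trans (ler_normB _ _) _; apply: lerD.
rewrite IntD; [|exact: integZ|exact: integZ].
rewrite !IntZ// [leRHS](splitr eps); apply: lerD.
  rewrite -[leRHS]mulr1; apply: ler_wpM2l; first by rewrite ltW// divr_gt0.
  rewrite -(k1 n); apply: Int_le => // y.
  rewrite -[leRHS]mulr1; apply: ler_wpM2l => //.
  exact: bx_le1.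
apply: (@le_trans _ _ (D * (eps / 2 / D))).
  apply: ler_pM => //; first by rewrite mulr_ge0.
  - apply: Int_ge0 => y; rewrite mulr_ge0// subr_ge0 bx_le1//.
  - by rewrite lerDl.
  - exact: HN.
by rewrite mulrC divfK// gt_eqF.
Qed.

(** Derivatives of the convolution pass to [Phi], so each order reduces to [approx_id_conv] for a
    derivative of [Phi]. *)
Lemma approx_id_unif0 dl rho (k : nat -> E -> R) Phi : approx_id k -> rtest Phi ->
  unif0 dl rho (fun n x => conv (k n) Phi x - Phi x).
Proof.
move=> ak tP s eps eps0.
have [N HN] := approx_id_conv ak (rtest_pds s tP) eps0.
have [lk _ _ _ _] := ak.
exists N => n nN x _; have sc := sm_conv (lk n) tP.
have oT := @openT E.
rewrite (pdsD s oT sc (smN oT (rtest_sm tP)))// (pdsN s oT (rtest_sm tP))//.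
by rewrite pds_conv//; exact: HN.
Qed.

Definition mollifier (n : nat) : E -> R :=
  let b : E -> R := bump (n.+1%:R^-1 / 2) n.+1%:R^-1 in
  fun x => (Int b)^-1 * b x.

Lemma rtest_integ Phi : rtest Phi -> integ Phi.
Proof.
move=> tP; have [_ [r P0]] := tP.
have := (locint_cont (@rtest_continuous _ _ _ tP)).2 r.
suff -> : (fun y => Phi y * bx r y) = Phi by [].
apply/funext => y; have [yr|ry] := leP `|y| r; first by rewrite bx1// mulr1.
by rewrite P0// mul0r.
Qed.

Lemma Int_bump_gt0 (a b : R) : 0 < a -> a < b -> 0 < Int (bump a b : E -> R).
Proof.
move=> a0 ab; apply: (@lt_le_trans _ _ (Int (bx a : E -> R))).
  rewrite (ge0_IntE (@bx_ge0 _ _ a) (integral_bx (ltW a0))).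
  by rewrite exprn_gt0// mulr_gt0.
apply: Int_le; [exact: integ_bx|exact/rtest_integ/rtest_bump|move=> y].
have [ya|ay] := leP `|y| a; last by rewrite bx0// bump_ge0.
by rewrite bx1// bump1.
Qed.

Lemma mollifier_radius n : 0 < n.+1%:R^-1 / 2 :> R /\ n.+1%:R^-1 / 2 < n.+1%:R^-1 :> R.
Proof.
have h : 0 < n.+1%:R^-1 :> R by rewrite invr_gt0.
by split; [rewrite divr_gt0|rewrite ltr_pdivrMr// ltr_pMr// ltr1n].
Qed.

Lemma rtestZ (c : R) Phi : rtest Phi -> rtest (fun x => c * Phi x).
Proof.
move=> [sP [r P0]]; split; first by apply: smZ => //; exact: openT.
by exists r => x /P0 ->; rewrite mulr0.
Qed.

Lemma rtest_mollifier n : rtest (mollifier n).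
Proof.
have [h1 h2] := mollifier_radius n.
by apply: rtestZ; exact: rtest_bump.
Qed.

Lemma mollifier0 n x : n.+1%:R^-1 <= `|x| -> mollifier n x = 0.
Proof. by have [h1 h2] := mollifier_radius n; move=> hx; rewrite /mollifier bump0// mulr0. Qed.

Lemma mollifierN n x : mollifier n (- x) = mollifier n x.
Proof. by rewrite /mollifier bumpN. Qed.

Lemma mollifier_ge0 n x : 0 <= mollifier n x.
Proof.
have [h1 h2] := mollifier_radius n.
by rewrite mulr_ge0 ?bump_ge0// invr_ge0 ltW// Int_bump_gt0.
Qed.

Lemma Int_mollifier n : Int (mollifier n) = 1.
Proof.
have [h1 h2] := mollifier_radius n.
rewrite /mollifier IntZ; last exact/rtest_integ/rtest_bump.
by rewrite mulVf// gt_eqF// Int_bump_gt0.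
Qed.

Lemma approx_id_mollifier : approx_id mollifier.
Proof.
split.
- by move=> n; apply/locint_cont/rtest_continuous/rtest_mollifier.
- by move=> n; apply/rtest_integ/rtest_mollifier.
- by move=> n y; exact: mollifier_ge0.
- exact: Int_mollifier.
move=> r eps r0 eps0.
have [N HN] : exists N : nat, N.+1%:R^-1 < r.
  by have [N _ /(_ N (leqnn N))] := near_infty_natSinv_lt (PosNum r0); exists N.
exists N => n nN.
rewrite (_ : (fun y => _) = fun=> 0); first by rewrite /Int Rintegral_cst// mul0r ltW.
apply/funext => y; have [yr|ry] := leP `|y| r; first by rewrite bx1// subrr mulr0.
rewrite mollifier0 ?mul0r// ltW//; apply: le_lt_trans ry; apply: le_trans (ltW HN).
by rewrite lef_pV2 ?posrE// ler_nat ltnS.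
Qed.

End approximate_identity.

(** * Integration by parts near the origin *)

Section integration_by_parts.
Context {R : realType} {d : nat}.
Local Notation E := 'rV[R]_d.
Implicit Types (f g Phi phi : E -> R) (x y : E) (s : seq 'I_d).

Lemma Int_pd_eq0 Phi i : rtest Phi -> Int (pd i Phi) = 0.
Proof.
move=> tP; have l1 : locint (fun _ : E => 1 : R) by apply: locint_cont => ?; exact: cst_continuous.
(* The integral of [Phi (x + y)] in [y] does not depend on [x]. *)
have hc x : conv (fun=> 1) Phi x = Int Phi.
  rewrite /conv (Int_affine x (oner_neq0 R) (rtest_integ tP)) normr1 expr1n mul1r.
  by congr Int; apply/funext => y; rewrite mul1r scale1r addrC.
have : pd i (conv (fun=> 1) Phi) 0 = 0.
  by rewrite (pd_ext i (@openT E) (fun x _ => hc x))// pd_cst.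
rewrite pd_conv// /conv => e; rewrite -[RHS]e; congr Int.
by apply/funext => y; rewrite mul1r add0r.
Qed.

Variable eta : R.
Local Notation B := ([set x : E | `|x| < eta]).

Definition small_supp phi := exists2 r : R, r < eta & forall x, r < `|x| -> phi x = 0.

Lemma small_supp_pds s phi : small_supp phi -> small_supp (pds s phi).
Proof.
move=> [r re p0]; exists r => // x rx.
by apply: (@pds_zero _ _ [set x | r < `|x|] s phi) => //; exact: open_norm_gt.
Qed.

(** Nothing is known of [g] outside the ball, but [phi] vanishes beyond a radius [r < eta]; the two
    regions overlap and cover the space, so smoothness can be glued. *)
Lemma rtest_small_mul g phi : sm B g -> rtest phi -> small_supp phi ->
  rtest (fun x => g x * phi x).
Proof.
move=> sg [sp _] [r re p0]; split; last first.
  by exists r => x rx; rewrite p0// mulr0.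
have -> : [set: E] = B `|` [set x | r < `|x|].
  apply/esym/seteqP; split=> // x _.
  have [xe|ex] := ltP `|x| eta; [by left|right => /=].
  exact: lt_le_trans ex.
have oB : open B by exact: open_norm_lt.
have oC : open [set x : E | r < `|x|] by exact: open_norm_gt.
apply: sm_union; first by apply: smM => //; exact: sm_sub sp.
apply: (sm_ext (f := fun=> 0)) => //; last exact: sm_cst.
by move=> x rx; rewrite p0// mulr0.
Qed.

Lemma Int_by_parts g phi i : sm B g -> rtest phi -> small_supp phi ->
  Int (fun x => g x * pd i phi x) = - Int (fun x => pd i g x * phi x).
Proof.
move=> sg tp hp; have hp1 := small_supp_pds [:: i] hp.
have tF := rtest_small_mul sg tp hp.
have i1 := rtest_integ (rtest_small_mul sg (rtest_pd i tp) hp1).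
have i2 := rtest_integ (rtest_small_mul (sm_pd i sg) tp hp).
apply/eqP; rewrite -addr_eq0 -IntD//; apply/eqP.
rewrite -[RHS](Int_pd_eq0 i tF); congr Int; apply/funext => x.
have [xe|ex] := ltP `|x| eta.
  rewrite pdM; [by rewrite addrC| |].
    exact: (sm_derivable sg).
  exact: (sm_derivable (rtest_sm tp)).
have [r re p0] := hp; have rx := lt_le_trans re ex.
have p1 : pd i phi x = 0.
  by apply: (@pds_zero _ _ [set x | r < `|x|] [:: i] phi) => //; exact: open_norm_gt.
rewrite p0// p1 !mulr0 addr0; apply/esym.
apply: (@pds_zero _ _ [set x | r < `|x|] [:: i]) => //; first exact: open_norm_gt.
by move=> y ry; rewrite p0// mulr0.
Qed.

(** Each step takes the outermost derivative off [phi] and applies it innermost to [g], hence the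
    reversal of [s]. *)
Lemma Int_by_parts_seq g phi s : sm B g -> rtest phi -> small_supp phi ->
  Int (fun x => g x * pds s phi x) =
  (-1) ^+ size s * Int (fun x => pds (rev s) g x * phi x).
Proof.
elim: s g phi => [|i s IH] g phi sg tp hp; first by rewrite /= mul1r.
rewrite /= Int_by_parts//; [|exact: rtest_pds|exact: small_supp_pds].
rewrite IH//; last exact: sm_pd.
by rewrite rev_cons pds_rcons exprS -mulrA mulN1r.
Qed.

Lemma mollifier_cvg g (eps : R) : 0 < eta -> {for (0 : E), continuous g} -> sm B g -> 0 < eps ->
  exists N, forall n, (N <= n)%N ->
    `|Int (fun x => g x * mollifier n x) - g 0| <= eps.
Proof.
move=> eta0 cg sg eps0.
have : \forall y \near (0 : E), `|g 0 - g y| < eps by move/cvgrPdist_lt : cg; exact.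
move=> /nbhs_ballP[r /= r0 Hr].
have m0 : 0 < Num.min r eta by rewrite lt_min r0.
have [N HN] : exists N : nat, N.+1%:R^-1 < Num.min r eta.
  by have [N _ /(_ N (leqnn N))] := near_infty_natSinv_lt (PosNum m0); exists N.
exists N => n nN.
have nr : n.+1%:R^-1 < Num.min r eta.
  by apply: le_lt_trans HN; rewrite lef_pV2 ?posrE// ler_nat ltnS.
move: (nr); rewrite lt_min => /andP[nr1 nr2].
have tm := @rtest_mollifier R d n.
have hm : small_supp (mollifier n : E -> R).
  by exists n.+1%:R^-1 => // x /ltW; exact: mollifier0.
have im := rtest_integ tm.
have igm := rtest_integ (rtest_small_mul sg tm hm).
have -> : Int (fun x => g x * mollifier n x) - g 0 =
    Int (fun x => g x * mollifier n x - g 0 * mollifier n x).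
  by rewrite IntB//; [rewrite IntZ// Int_mollifier mulr1|exact: integZ].
have iB : integ (fun x => g x * mollifier n x - g 0 * mollifier n x).
  by apply: integB => //; exact: integZ.
apply: le_trans (Int_norm iB) _.
rewrite -[leRHS]mulr1 -(@Int_mollifier R d n) -IntZ//.
apply: Int_le => [| |x]; [exact: integ_abs|exact: integZ|].
rewrite -mulrBl normrM (ger0_norm (mollifier_ge0 _ _)).
have [nx|xn] := leP n.+1%:R^-1 `|x|; first by rewrite mollifier0// !mulr0.
apply: ler_wpM2r; first exact: mollifier_ge0.
rewrite distrC ltW//; apply: Hr; rewrite -ball_normE /= sub0r normrN.
exact: lt_trans nr1.
Qed.

End integration_by_parts.

(** * Geometric decay against polynomial growth *)

Section exponential_decay.
Context {R : realType}.

(** With [a = - ln q] one has [q ^ n = exp (- n a)], and [expR_decay] leaves a factor [1 / n ^ 2].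
    The case [q = 0], which has no logarithm, is separate. *)
Lemma poly_geometric_cvg (l : nat) (q eps : R) : 0 <= q -> q < 1 -> 0 < eps ->
  exists N, forall n, (N <= n)%N -> n%:R ^+ l * q ^+ n <= eps.
Proof.
move=> q0 q1 eps0; have [->|qn0] := eqVneq q 0.
  exists 1%N => -[//|n] _; by rewrite expr0n/= mulr0 ltW.
have qp : 0 < q by rewrite lt_neqAle eq_sym qn0.
pose a := - ln q; have a0 : 0 < a by rewrite oppr_gt0 ln_lt0// qp.
have qE n : q ^+ n = expR (- (n%:R * a)).
  by rewrite /a mulrN opprK expRM_natl lnK.
pose K := l.+2`!%:R / a ^+ l.+2; have K0 : 0 < K.
  by rewrite divr_gt0 ?exprn_gt0// ltr0n fact_gt0.
have [N HN] : exists N : nat, K / eps <= N%:R.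
  by exists (Num.bound (K / eps)); apply/ltW; apply: archi_boundP; rewrite divr_ge0// ltW.
exists N.+1 => n nN; have n0 : 0 < n%:R :> R by rewrite ltr0n (leq_trans _ nN).
have := expR_decay l (mulr_gt0 n0 a0); rewrite -qE exprMn mulrC.
move=> h.
have al0 : a ^+ l != 0 by rewrite expf_neq0// gt_eqF.
have h' : n%:R ^+ l * q ^+ n <= K / n%:R ^+ 2.
  have -> : n%:R ^+ l * q ^+ n = q ^+ n * (n%:R ^+ l * a ^+ l) / a ^+ l.
    by rewrite mulrA mulfK// mulrC.
  have -> : K / n%:R ^+ 2 = l.+2`!%:R / (n%:R * a) ^+ 2 / a ^+ l.
    rewrite /K -addn2 exprD; field.
    by rewrite al0 !gt_eqF.
  by apply: ler_wpM2r => //; rewrite invr_ge0 exprn_ge0// ltW.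
apply: le_trans h' _.
rewrite ler_pdivrMr ?exprn_gt0// mulrC -ler_pdivrMr//.
apply: le_trans HN _; rewrite expr2.
have Nn : N%:R <= n%:R :> R by rewrite ler_nat ltnW.
apply: (le_trans Nn); rewrite ler_peMr ?(ltW n0)// ler1n.
exact: leq_ltn_trans nN.
Qed.

End exponential_decay.

Section geometric_decay.
Context {R : realType} {d : nat}.
Local Notation E := 'rV[R]_d.
Implicit Types (v t : E -> R) (x y : E) (s : seq 'I_d).
Variables dl rho : R.
Hypothesis dl0 : 0 < dl.

Lemma compact_annulus : compact (@annulus R d dl rho).
Proof.
rewrite (_ : annulus _ _ = [set x | `|x| <= rho] `&` [set x | dl <= `|x|]).
  apply: compact_closedI; first exact: compact_norm_le.
  apply: (@closed_comp _ _ (fun x : E => `|x|) [set y | dl <= y]); last exact: closed_ge.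
  by move=> x _; exact: norm_continuous.
by apply/seteqP; split=> x /=; [move=> /andP[]|move=> [? ?]; apply/andP].
Qed.

(** Each derivative of [t ^ n] brings down a factor [n], so the induction on the order is
    strengthened by an arbitrary power [n ^ l]. *)
Lemma geometric_unif0 v t (q : R) : sm punctured v -> sm punctured t ->
  0 <= q -> q < 1 -> (forall x, annulus dl rho x -> `|t x| <= q) ->
  unif0 dl rho (fun n x => v x * t x ^+ n).
Proof.
move=> sv st q0 q1 tq s.
have oP := @open_punctured R d.
suff key l (eps : R) : 0 < eps -> exists N, forall n, (N <= n)%N ->
    forall x, annulus dl rho x ->
    n%:R ^+ l * `|pds s (fun x => v x * t x ^+ n) x| <= eps.
  move=> eps /(key 0%N)[N HN]; exists N => n /HN H x /H.
  by rewrite expr0 mul1r.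
elim/last_ind: s v sv l eps => [|s i IH] v sv l eps eps0.
  have [|M M0 HM] := @cont_bounded_on _ _ _ v compact_annulus.
    by move=> x Ax; apply: (sm_cont sv); exact: annulus_punctured Ax.
  have M1 : 0 < M + 1 by rewrite ltr_wpDl.
  have [N HN] := poly_geometric_cvg l q0 q1 (divr_gt0 eps0 M1).
  exists N => n nN x Ax /=; rewrite normrM normrX mulrCA.
  apply: (@le_trans _ _ ((M + 1) * (n%:R ^+ l * q ^+ n))).
    apply: ler_pM => //.
      by apply: le_trans (HM x Ax) _; rewrite lerDl.
    by apply: ler_wpM2l; [rewrite exprn_ge0|rewrite lerXn2r ?nnegrE// tq].
  by rewrite mulrC -ler_pdivlMr// HN.
have e2 : 0 < eps / 2 by rewrite divr_gt0.
have c0 : 0 < 2 ^+ l.+1 :> R by rewrite exprn_gt0.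
have [N1 H1] := IH _ (sm_pd i sv) l _ e2.
have sv' : sm punctured (fun x => v x * pd i t x) by apply: smM => //; exact: sm_pd.
have [N2 H2] := IH _ sv' l.+1 _ (divr_gt0 e2 c0).
(* The second term carries [(n + 1) ^ (l + 1)] but the exponent [n]. For [n >= 1] it is at most
   [2 ^ (l + 1) * n ^ (l + 1)], hence the tolerance chosen for [N2] and the shift by one. *)
exists (maxn N1 (maxn N2 1).+1) => -[|n]; first by rewrite geq_max ltn0 andbF.
rewrite geq_max => /andP[n1 n2] x Ax.
have xp : punctured x := annulus_punctured dl0 Ax.
have stn m : sm punctured (fun x => t x ^+ m) by apply: smX.
have pdE1 y : punctured y -> pd i (fun x => v x * t x ^+ n.+1) y =
    pd i v y * t y ^+ n.+1 + n.+1%:R * (v y * pd i t y * t y ^+ n).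
  move=> yp; rewrite pdM; [|exact: (sm_derivable sv)|exact: (sm_derivable (stn n.+1))].
  congr (_ + _).
  rewrite (pd_comp1 (F := fun z : R => z ^+ n.+1)); [|exact: (sm_derivable st)|exact: exprn_derivable].
  by rewrite exp_derive1 /GRing.scale/=; ring.
rewrite pds_rcons (pds_ext s oP pdE1 xp) (pdsD s oP)//; last 2 first.
- by apply: smM => //; exact: sm_pd.
- by apply: smZ => //; apply: smM.
rewrite (pdsZ s _ oP)//; last exact: smM.
rewrite (splitr eps); apply: (@le_trans _ _ (n.+1%:R ^+ l * (
    `|pds s (fun y => pd i v y * t y ^+ n.+1) x| +
    n.+1%:R * `|pds s (fun y => v y * pd i t y * t y ^+ n) x|))).
  apply: ler_wpM2l; first by rewrite exprn_ge0.
  by apply: le_trans (ler_normD _ _) _; rewrite normrM ger0_norm.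
rewrite mulrDr; apply: lerD; first exact: H1.
have n2' : (N2 <= n)%N by apply: leq_trans (leq_maxl _ 1%N) n2.
have n1' : (1 <= n)%N by apply: leq_trans (leq_maxr N2 1%N) n2.
rewrite mulrA -exprSr; apply: (@le_trans _ _ (2 ^+ l.+1 * (n%:R ^+ l.+1 *
    `|pds s (fun y => v y * pd i t y * t y ^+ n) x|))).
  rewrite [leRHS]mulrA -exprMn; apply: ler_wpM2r => //.
  rewrite lerXn2r ?nnegrE ?mulr_ge0//.
  by rewrite -natrM ler_nat mul2n -addnn -addn1 leq_add2l.
by rewrite mulrC -ler_pdivlMr// H2.
Qed.

End geometric_decay.

(** * The annihilator argument *)

Section homogeneous_polynomials.
Context {R : realType} {d : nat}.
Local Notation E := 'rV[R]_d.
Implicit Types (p q : E -> R) (x y : E).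

(** Homogeneous polynomials given by generators: the proofs about them are inductions on this
    construction, and no coefficients are needed. *)
Inductive hom : nat -> (E -> R) -> Prop :=
| hom0 c : hom 0 (fun=> c)
| homX i n p : hom n p -> hom n.+1 (fun x => x 0 i * p x)
| homD n p q : hom n p -> hom n q -> hom n (fun x => p x + q x).

Lemma homZ n p (c : R) : hom n p -> hom n (fun x => c * p x).
Proof.
elim=> {n p} [b|i n p _ IH|n p q _ IHp _ IHq].
- exact: hom0.
- have := homX i IH; congr hom; apply/funext => x; ring.
- have := homD IHp IHq; congr hom; apply/funext => x; ring.
Qed.

Lemma sm_hom n p (U : set E) : open U -> hom n p -> sm U p.
Proof.
move=> oU; elim=> {n p} [b|i n p _ IH|n p q _ IHp _ IHq].
- exact: sm_cst.
- by apply: smM => //; exact: sm_coord.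
- exact: smD.
Qed.

Lemma hom_pd n p i : hom n p ->
  match n with 0 => pd i p = fun=> 0 | m.+1 => hom m (pd i p) end.
Proof.
have oT := @openT E.
elim=> {n p} [b|j n p hp IH|n p q hp IHp hq IHq]; first exact: pd_cst.
- have sp := sm_hom oT hp.
  have -> : pd i (fun x => x 0 j * p x) = fun x => (i == j)%:R * p x + x 0 j * pd i p x.
    apply/funext => x; rewrite pdM ?pd_coord//.
      exact: (sm_derivable (sm_coord j oT)).
    exact: (sm_derivable sp).
  have h1 := homZ (i == j)%:R hp.
  case: n => [|n] in hp IH h1 *; last exact: homD h1 (homX j IH).
  by move: h1; congr hom; apply/funext => x; rewrite IH mulr0 addr0.
- have -> : pd i (fun x => p x + q x) = fun x => pd i p x + pd i q x.
    apply/funext => x; rewrite pdD//.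
      exact: (sm_derivable (sm_hom oT hp)).
    exact: (sm_derivable (sm_hom oT hq)).
  case: n => [|n] in hp IHp hq IHq *; last exact: homD.
  by rewrite IHp IHq; apply/funext => x; rewrite addr0.
Qed.

End homogeneous_polynomials.

Section annihilator.
Context {R : realType} {d : nat}.
Local Notation E := 'rV[R]_d.
Implicit Types (k p v : E -> R) (x y : E) (s : seq 'I_d).
Variables (u : (E -> R) -> R) (chi : E -> R) (dl rho : R).
Hypotheses (ru : rdist u) (dl0 : 0 < dl) (achi : annular dl rho chi).

Let oP := @open_punctured R d.

Let chi0 x : ~ punctured x -> chi x = 0.
Proof. by move=> nx; apply: (annular0 achi) => /(annulus_punctured dl0). Qed.

Lemma chi_ext k k' : (forall x, punctured x -> k x = k' x) ->
  (fun x => chi x * k x) = (fun x => chi x * k' x).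
Proof.
move=> kk'; apply/funext => x; have [xp|xp] := pselect (punctured x).
  by rewrite kk'.
by rewrite chi0// !mul0r.
Qed.

Lemma rtest_chi k : sm punctured k -> rtest (fun x => chi x * k x).
Proof. by move=> sk; apply: (annular_rtest (rho := rho)); exact: (annularM dl0 achi). Qed.

Definition killed k : Prop := sm punctured k /\ u (fun x => chi x * k x) = 0.

(** The cut-off stays outside the derivatives. Unlike [killed], this class is stable under
    differentiation, which is what the Laplacian and the reduction to leading terms require. *)
Definition allkilled k : Prop :=
  sm punctured k /\ forall s, u (fun x => chi x * pds s k x) = 0.

Lemma allkilledW k : allkilled k -> killed k.
Proof. by move=> [sk uk]; split=> //; exact: (uk [::]). Qed.

Lemma killed_ext k k' : (forall x, punctured x -> k x = k' x) -> killed k -> killed k'.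
Proof.
move=> kk' [sk uk]; split; first exact: sm_ext sk.
by rewrite -(chi_ext kk').
Qed.

Lemma killed_lin (c : R) k k' : killed k -> killed k' -> killed (fun x => c * k x + k' x).
Proof.
move=> [sk uk] [sk' uk']; split; first by apply: smD => //; exact: smZ.
have := ru.1 c _ _ (rtest_chi sk) (rtest_chi sk'); rewrite uk uk' mulr0 addr0 => <-.
by congr u; apply/funext => x; ring.
Qed.

Lemma killed0 : killed (fun=> 0).
Proof.
split; first exact: sm_cst.
by rewrite -[RHS](rdist0 ru); congr u; apply/funext => x; rewrite mulr0.
Qed.

Lemma killedZ (c : R) k : killed k -> killed (fun x => c * k x).
Proof. by move=> kk; apply: killed_ext (killed_lin c kk killed0) => x _; rewrite addr0. Qed.

Lemma killedD k k' : killed k -> killed k' -> killed (fun x => k x + k' x).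
Proof. by move=> kk kk'; apply: killed_ext (killed_lin 1 kk kk') => x _; rewrite mul1r. Qed.

Lemma allkilled_ext k k' : (forall x, punctured x -> k x = k' x) -> allkilled k -> allkilled k'.
Proof.
move=> kk' [sk uk]; split; first exact: sm_ext sk.
by move=> s; rewrite -(chi_ext (fun x xp => pds_ext s oP kk' xp)).
Qed.

Lemma allkilled_lin (c : R) k k' : allkilled k -> allkilled k' ->
  allkilled (fun x => c * k x + k' x).
Proof.
move=> [sk uk] [sk' uk']; split; first by apply: smD => //; exact: smZ.
move=> s; have [_ <-] := killed_lin c (conj (sm_pds s sk) (uk s)) (conj (sm_pds s sk') (uk' s)).
congr u; apply: chi_ext => x xp.
by rewrite (pdsD s oP)//; [rewrite (pdsZ s _ oP)|exact: smZ].
Qed.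

Lemma allkilled0 : allkilled (fun=> 0).
Proof.
split=> [|s]; first exact: sm_cst.
rewrite -[RHS](rdist0 ru); congr u; apply/funext => x.
by rewrite (@pds_zero _ _ setT s (fun=> 0))// ?mulr0//; exact: openT.
Qed.

Lemma allkilledZ (c : R) k : allkilled k -> allkilled (fun x => c * k x).
Proof. by move=> kk; apply: allkilled_ext (allkilled_lin c kk allkilled0) => x _; rewrite addr0. Qed.

Lemma allkilledD k k' : allkilled k -> allkilled k' -> allkilled (fun x => k x + k' x).
Proof. by move=> kk kk'; apply: allkilled_ext (allkilled_lin 1 kk kk') => x _; rewrite mul1r. Qed.

Lemma allkilled_sum (r : seq 'I_d) (F : 'I_d -> E -> R) : (forall i, allkilled (F i)) ->
  allkilled (fun x => \sum_(i <- r) F i x).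
Proof.
move=> kF; elim: r => [|i r IH].
  by apply: allkilled_ext allkilled0 => x _; rewrite big_nil.
by apply: allkilled_ext (allkilledD (kF i) IH) => x _; rewrite big_cons.
Qed.

Lemma allkilled_pd i k : allkilled k -> allkilled (pd i k).
Proof.
move=> [sk uk]; split; first exact: sm_pd.
by move=> s; rewrite -pds_rcons.
Qed.

Lemma pd2_Rp (b : R) i x : punctured x ->
  pd i (pd i (Rp b)) x =
  2 * b * (Rp (b - 1) x + 2 * (b - 1) * (x 0 i ^+ 2 * Rp (b - 2) x)).
Proof.
move=> xp; have e y : punctured y -> pd i (Rp b) y = 2 * b * (y 0 i * Rp (b - 1) y).
  by move=> yp; exact: pd_Rp.
have sc := sm_coord i (@openT E).
have sR := sm_Rp (d := d) (b - 1).
have dc : derivable (fun y : E => y 0 i) x (delta_mx 0 i) by exact: (sm_derivable sc).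
have dR : derivable (Rp (b - 1)) x (delta_mx 0 i) by exact: (sm_derivable sR).
rewrite (pd_ext i oP e xp) pdZ; last exact: derivableM.
rewrite pdM// pd_coord eqxx pd_Rp// -addrA -opprD (_ : 1 + 1 = 2) ?mulr1n; last by [].
by rewrite /=; ring.
Qed.

(** Off the origin the Laplacian of [q ^ b] is [2 b (2 b - 2 + d) q ^ (b - 1)], and the hypotheses
    make the factor invertible. *)
Lemma allkilled_laplacian (b : R) : b != 0 -> 2 * b - 2 + d%:R != 0 ->
  allkilled (Rp b) -> allkilled (Rp (b - 1)).
Proof.
move=> b0 bd kb.
pose c := 2 * b * (2 * b - 2 + d%:R).
have c0 : c != 0 by rewrite !mulf_neq0// pnatr_eq0.
have := allkilled_sum (index_enum 'I_d) (fun i => allkilled_pd i (allkilled_pd i kb)).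
move=> /(allkilledZ c^-1); apply: allkilled_ext => x xp.
under eq_bigr => i _ do rewrite pd2_Rp//.
rewrite -mulr_sumr big_split/= sumr_const card_ord -mulr_sumr -mulr_suml.
have -> : \sum_(i < d) x 0 i ^+ 2 = dotp x x by apply: eq_bigr => i _; rewrite expr2.
have -> : dotp x x * Rp (b - 2) x = Rp (b - 1) x.
  have q0 := dotp_gt0 xp.
  rewrite /Rp -{1}[dotp x x]powRr1 ?dotp_ge0// -powRD ?(gt_eqF q0) ?implybT//.
  by congr (_ `^ _); ring.
apply: (mulfI c0); rewrite mulVKf// /c -mulr_natl; ring.
Qed.

Variable a : R.
Hypothesis ha : forall j : nat, a - j%:R != 0 /\ 2 * (a - j%:R) - 2 + d%:R != 0.
Hypothesis ka : allkilled (Rp a).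

Lemma allkilled_Rp (j : nat) : allkilled (Rp (a - j%:R)).
Proof.
elim: j => [|j IH]; first by rewrite subr0.
have [h1 h2] := ha j.
by have := allkilled_laplacian h1 h2 IH; rewrite -addrA -opprD natr1.
Qed.

(** With [b = a - j - n], the derivative of [p q ^ b] along [i] is [2 b x_i p q ^ (b - 1)] plus
    [(pd i p) q ^ b]. The latter has lower degree, and strong induction on the degree covers it
    because [pd i p] is not a subterm of the construction of [p]. *)
Lemma allkilled_hom n p : hom n p -> forall j : nat,
  allkilled (fun x => p x * Rp (a - j%:R - n%:R) x).
Proof.
elim/ltn_ind: n p => n IH p hp.
elim: hp IH => {n p} [c|i n p hp _|n p q _ IHp _ IHq] IH j.
- by apply: allkilledZ; rewrite subr0; exact: allkilled_Rp.
- pose b := a - j%:R - n%:R.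
  have b0 : b != 0 by have [+ _] := ha (j + n)%N; rewrite natrD opprD addrA.
  have sp : sm punctured p by exact: sm_hom hp.
  have sR := sm_Rp (d := d) b.
  have e x : punctured x -> x 0 i * p x * Rp (a - j%:R - n.+1%:R) x =
      (2 * b)^-1 * (pd i (fun x => p x * Rp b x) x + (-1) * (pd i p x * Rp b x)).
    move=> xp; rewrite pdM; [|exact: (sm_derivable sp)|exact: (sm_derivable sR)].
    rewrite pd_Rp// (_ : a - j%:R - n.+1%:R = b - 1); last by rewrite /b -natr1; ring.
    by field.
  apply: (allkilled_ext (k := fun x =>
      (2 * b)^-1 * (pd i (fun x => p x * Rp b x) x + (-1) * (pd i p x * Rp b x)))).
    by move=> x /e ->.
  apply: allkilledZ; apply: allkilledD; first by apply: allkilled_pd; exact: IH.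
  apply: allkilledZ.
  case: n => [|n] in hp IH b b0 sR e *.
    apply: allkilled_ext allkilled0 => x _.
    by rewrite (hom_pd i hp) mul0r.
  (* Here [p] has degree [n + 1]; the exponent for degree [n] and index [j + 1] is
     [a - (j + 1) - n = b]. *)
  have := IH n (ltnW (ltnSn _)) _ (hom_pd i hp) j.+1.
  by apply: allkilled_ext => x _; congr (_ * Rp _ _); rewrite /b -[n.+1%:R]natr1 -[j.+1%:R]natr1; ring.
- apply: allkilled_ext (allkilledD (IHp IH j) (IHq IH j)) => x _.
  by rewrite mulrDl.
Qed.

(* [Rp (- 1)] is bounded above and away from [0] on the annulus, so that
   [t = 1 - Rp (- 1) / M] has powers tending to [0], while [1 - t ^+ n] is a
   polynomial in [Rp (- 1)] without constant term. *)
Lemma killed_down v : sm punctured v ->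
  (forall j : nat, killed (fun x => v x * Rp (- 1) x ^+ j.+1)) -> killed v.
Proof.
move=> sv kv; split=> //.
(* On the annulus [q >= dl ^ 2], so [Rp (- 1) / M <= 1 / 2] and [t] stays nonnegative. *)
pose M := 2 / dl ^+ 2.
have M0 : 0 < M by rewrite divr_gt0 ?exprn_gt0.
pose t x := 1 - M^-1 * Rp (- 1) x.
have sw := sm_Rp (d := d) (- 1).
have st : sm punctured t by apply: smB => //; [exact: sm_cst|exact: smZ].
have k1 n : forall j : nat, killed (fun x => v x * Rp (- 1) x ^+ j.+1 * t x ^+ n).
  elim: n => [|n IH] j; first by apply: killed_ext (kv j) => x _; rewrite mulr1.
  apply: killed_ext (killed_lin (- M^-1) (IH j.+1) (IH j)) => x _.
  rewrite (exprS _ n) {3}/t [in LHS]exprS; ring.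
(* Telescoping: [1 - t ^ (n + 1) = (1 - t ^ n) + M^-1 Rp (- 1) t ^ n]. *)
have k2 n : killed (fun x => v x * (1 - t x ^+ n)).
  elim: n => [|n IH]; first by apply: killed_ext killed0 => x _; rewrite subrr mulr0.
  apply: killed_ext (killed_lin M^-1 (k1 n 0%N) IH) => x _.
  rewrite (exprS _ n) {3}/t expr1; ring.
have uE n : u (fun x => chi x * (v x * t x ^+ n)) = u (fun x => chi x * v x).
  have svt : sm punctured (fun x => v x * t x ^+ n) by apply: smM => //; exact: smX.
  have [s2 u2] := k2 n.
  rewrite -[LHS]add0r -u2 -rdistD//; [|exact: rtest_chi|exact: rtest_chi].
  by congr u; apply/funext => x; ring.
have [q [q0 q1 tq]] : exists q : R, [/\ 0 <= q, q < 1 &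
    forall x, annulus dl rho x -> `|t x| <= q].
  (* An upper bound for the squared Euclidean norm on the annulus. The summand [dl ^ 2] keeps
     [D >= dl ^ 2], hence the ratio in [[0, 1)], whatever [rho] is. *)
  pose D := d%:R * rho ^+ 2 + dl ^+ 2.
  have dl2 : 0 < dl ^+ 2 by rewrite exprn_gt0.
  have D0 : 0 < D by rewrite ltr_wpDl// mulr_ge0// sqr_ge0.
  have dlD : dl ^+ 2 <= D by rewrite lerDr mulr_ge0// sqr_ge0.
  exists (1 - dl ^+ 2 / 2 / D); split.
  - rewrite subr_ge0 ler_pdivrMr// mul1r; apply: le_trans dlD.
    by rewrite ler_pdivrMr// ler_peMr ?ltW// ltr1n.
  - by rewrite ltrBlDr ltrDl !divr_gt0.
  - move=> x Ax; have xp := annulus_punctured dl0 Ax.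
    move: Ax => /andP[dx xr]; have q0 := dotp_gt0 xp.
    have h1 : dl ^+ 2 <= dotp x x.
      by apply: le_trans (dotp_ge_norm x); rewrite lerXn2r ?nnegrE// ltW.
    have h2 : dotp x x <= D.
      apply: le_trans (dotp_le_norm x) _; rewrite ler_wpDr ?sqr_ge0// ler_wpM2l//.
      by rewrite lerXn2r ?nnegrE// (le_trans _ xr).
    have wE : M^-1 * Rp (- 1) x = dl ^+ 2 / 2 / dotp x x.
      by rewrite /Rp powR_inv1 ?dotp_ge0// /M invf_div.
    have t0 : 0 <= t x.
      rewrite /t wE subr_ge0 ler_pdivrMr// mul1r; apply: le_trans h1.
      by rewrite ler_pdivrMr// ler_peMr ?ltW// ltr1n.
    rewrite ger0_norm// /t wE lerD2l lerN2 ler_pM2l ?divr_gt0//.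
    by rewrite lef_pV2.
apply/eqP; rewrite -normr_le0; apply/ler_addgt0Pl => eps eps0.
have [N HN] := rdist_lim dl0 ru achi
  (fun n => smM oP sv (smX n oP st)) (geometric_unif0 dl0 sv st q0 q1 tq) eps0.
by rewrite addr0 -(uE N); exact: HN.
Qed.

(** Each use of [killed_down] raises the power of [q] by one. It asks for all lower powers, so the
    induction on [J] keeps every [j]: only [j = 0] is new, the others are the previous stage. *)
Lemma killed_hom n p : hom n p -> killed (fun x => p x * Rp a x).
Proof.
move=> hp; have sp : sm punctured p by exact: sm_hom hp.
suff : forall J, (J <= n)%N -> forall j : nat,
    killed (fun x => p x * Rp (a - (n - J)%:R - j%:R) x).
  move=> /(_ n (leqnn n) 0%N); apply: killed_ext => x _.
  by rewrite subnn !subr0.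
elim=> [_ j|J IH Jn].
  apply: killed_ext (allkilledW (allkilled_hom hp j)) => x _.
  by rewrite subn0 addrAC.
have {}IH := IH (ltnW Jn).
have e : (n - J)%N = (n - J.+1).+1 by rewrite subnSK.
case=> [|j]; last first.
  apply: killed_ext (IH j) => x _; congr (_ * Rp _ _).
  by rewrite e -natr1 -[j.+1%:R]natr1; ring.
apply: killed_down => [|j]; first by apply: smM => //; exact: sm_Rp.
apply: killed_ext (IH j) => x xp; rewrite -mulrA; congr (_ * _).
have q0 := dotp_gt0 xp.
rewrite /Rp -powR_mulrn ?powR_ge0// -powRrM -powRD ?(gt_eqF q0) ?implybT//.
by congr (_ `^ _); rewrite e -natr1 -[j.+1%:R]natr1; ring.
Qed.

End annihilator.

(** * Landau kernels and density *)

Section landau_kernel.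
Context {R : realType} {d : nat}.
Local Notation E := 'rV[R]_d.
Implicit Types (Phi : E -> R) (x y w : E).
Variable L : R.
Hypothesis L0 : 0 < L.

(** The classical one-variable kernel in each coordinate. The weight below cuts it to the cube
    [|y| <= L], where every factor lies in [[0, 1]]. *)
Definition landau_poly (n : nat) y : R := \prod_(i < d) (1 - (y 0 i / L) ^+ 2) ^+ n.

Definition landau_weight (n : nat) y : R := landau_poly n y * bx L y.

Definition landau (n : nat) y : R := (Int (landau_weight n))^-1 * landau_weight n y.

Lemma continuous_landau_poly n : continuous (landau_poly n).
Proof.
apply: (sm_continuous (Phi := landau_poly n)); have oT := @openT E.
apply: sm_prod => // i; apply: smX => //; apply: smB => //; first exact: sm_cst.
by apply: smX => //; under eq_fun do rewrite mulrC; apply: smZ => //; exact: sm_coord.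
Qed.

Lemma integ_landau_weight n : integ (landau_weight n).
Proof. exact: (locint_cont (@continuous_landau_poly n)).2. Qed.

Lemma coord_ratio y i : `|y| <= L -> 0 <= 1 - (y 0 i / L) ^+ 2 <= 1.
Proof.
move=> yL; have yi := le_trans (norm_coord y i) yL.
rewrite subr_ge0 gerBl sqr_ge0 andbT -real_normK ?num_real// expr_le1//.
by rewrite normrM normfV (gtr0_norm L0) ler_pdivrMr// mul1r.
Qed.

Lemma landau_weight_ge0 n y : 0 <= landau_weight n y.
Proof.
rewrite /landau_weight; have [yL|Ly] := leP `|y| L; last by rewrite bx0// mulr0.
rewrite bx1// mulr1; apply: prodr_ge0 => i _; apply: exprn_ge0.
by have /andP[] := coord_ratio i yL.
Qed.

Lemma locint_landau_weight n : locint (landau_weight n).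
Proof.
split=> [|r]; first exact: integ_mrow (integ_landau_weight n).
apply: (integ_le _ _ (integ_landau_weight n)).
  by apply: mrowM; [exact: integ_mrow (integ_landau_weight n)|exact: mrow_bx].
move=> y; rewrite normrM (ger0_norm (bx_ge0 _ _)) ler_piMr//.
exact: bx_le1.
Qed.

(** On the smaller cube [|y| <= eta L] each of the [d] factors is at least [(1 - eta ^ 2) ^ n], and
    the volume of that cube is explicit. *)
Lemma Int_landau_weight_ge n (eta : R) : 0 < eta -> eta < 1 ->
  ((1 - eta ^+ 2) ^+ d) ^+ n * (2 * (eta * L)) ^+ d <= Int (landau_weight n).
Proof.
move=> e0 e1; have eL : 0 <= eta * L by rewrite mulr_ge0// ltW.
rewrite -(ge0_IntE (@bx_ge0 R d (eta * L)) (integral_bx eL)) -IntZ; last exact: integ_bx.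
apply: Int_le; [by apply: integZ; exact: integ_bx|exact: integ_landau_weight|move=> y].
have [ye|ey] := leP `|y| (eta * L); last by rewrite bx0// mulr0 landau_weight_ge0.
have yL : `|y| <= L by apply: le_trans ye _; rewrite ger_pMl// ltW.
rewrite /landau_weight !bx1// !mulr1 -exprM mulnC exprM -[d in leLHS]card_ord -prodr_const.
have e21 : eta ^+ 2 <= 1 by rewrite expr_le1// ltW.
apply: ler_prod => i _; rewrite exprn_ge0 ?subr_ge0//=.
rewrite lerXn2r ?nnegrE ?subr_ge0//; last first.
  rewrite lerD2l lerN2 -real_normK ?num_real// lerXn2r ?nnegrE ?(ltW e0)//.
  rewrite normrM normfV (gtr0_norm L0) ler_pdivrMr//.
  exact: le_trans (norm_coord y i) ye.
by have /andP[] := coord_ratio i yL; rewrite subr_ge0.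
Qed.

Lemma Int_landau_weight_gt0 n : 0 < Int (landau_weight n).
Proof.
have h : 0 < 2^-1 :> R by rewrite invr_gt0.
have h1 : 2^-1 < 1 :> R by rewrite invf_lt1// ltr1n.
apply: lt_le_trans (Int_landau_weight_ge n h h1).
rewrite mulr_gt0 ?exprn_gt0 ?mulr_gt0//.
by rewrite subr_gt0 expr_lt1// ltW.
Qed.

Lemma bernoulli (x : R) (n : nat) : 0 <= x <= 1 -> 1 - n%:R * x <= (1 - x) ^+ n.
Proof.
move=> /andP[x0 x1]; elim: n => [|n IH]; first by rewrite mul0r subr0.
rewrite exprS; apply: (@le_trans _ _ ((1 - x) * (1 - n%:R * x))); last first.
  by apply: ler_wpM2l => //; rewrite subr_ge0.
rewrite -subr_ge0 (_ : _ - _ = n%:R * x ^+ 2); last by rewrite -natr1; ring.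
by rewrite mulr_ge0// sqr_ge0.
Qed.

(** If [|y| > r] in the sup norm, some coordinate exceeds [r]: its factor gives the bound, and the
    remaining factors are at most 1. *)
Lemma landau_tail_le n (r : R) y : 0 < r -> r < L ->
  landau_weight n y * (1 - bx r y) <= (1 - (r / L) ^+ 2) ^+ n * bx L y.
Proof.
move=> r0 rL; have rL1 : (r / L) ^+ 2 <= 1.
  by rewrite expr_le1 ?divr_ge0 ?ltW// ltr_pdivrMr// mul1r.
have b0 : 0 <= (1 - (r / L) ^+ 2) ^+ n by rewrite exprn_ge0// subr_ge0.
have [yr|ry] := leP `|y| r; first by rewrite (bx1 yr) subrr mulr0 mulr_ge0// bx_ge0.
rewrite (bx0 ry) subr0 mulr1.
have [yL|Ly] := leP `|y| L; last by rewrite /landau_weight bx0// !mulr0.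
rewrite /landau_weight bx1// !mulr1.
have [i yi] : exists i, r < `|y 0 i|.
  apply: contrapT => /forallNP H.
  move: ry; rewrite ltNge => /negP; apply; apply: norm_le_coord; first exact: ltW.
  by move=> i; rewrite leNgt; apply/negP.
rewrite /landau_poly (bigD1 i)//= -[leRHS]mulr1.
have hi j := coord_ratio j yL.
apply: ler_pM.
- by apply: exprn_ge0; have /andP[] := hi i.
- by apply: prodr_ge0 => j _; apply: exprn_ge0; have /andP[] := hi j.
- rewrite lerXn2r ?nnegrE ?subr_ge0//.
    by have /andP[+ _] := hi i; rewrite subr_ge0.
  rewrite lerD2l lerN2 -[leRHS]real_normK ?num_real// lerXn2r ?nnegrE ?divr_ge0 ?(ltW r0) ?(ltW L0)//.
  by rewrite normrM normfV (gtr0_norm L0) ler_pM2r ?invr_gt0// ltW.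
- apply: prodr_ile1 => j _; have /andP[h0 h1] := hi j.
  by rewrite exprn_ge0//= exprn_ile1.
Qed.

(** The tail is at most [b ^ n (2 L) ^ d] and the total mass at least [p ^ n (2 eta L) ^ d], so the
    normalised tail decays like [(b / p) ^ n] provided [b < p]. *)
Lemma approx_id_landau : approx_id landau.
Proof.
have c0 n := Int_landau_weight_gt0 n.
split.
- move=> n; have [mw iw] := locint_landau_weight n.
  split; first by apply: mrowM => //; exact: measurable_cst.
  by move=> r; under eq_fun do rewrite -mulrA; exact: integZ.
- by move=> n; apply: integZ; exact: integ_landau_weight.
- by move=> n y; rewrite mulr_ge0 ?landau_weight_ge0// invr_ge0 ltW.
- move=> n; rewrite /landau IntZ; last exact: integ_landau_weight.
  by rewrite mulVf// gt_eqF.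
move=> r eps r0 eps0; have [Lr|rL] := leP L r.
  exists 0%N => n _; rewrite (_ : (fun y => _) = fun=> 0).
    by rewrite /Int Rintegral_cst// mul0r ltW.
  apply/funext => y; have [yr|ry] := leP `|y| r; first by rewrite bx1// subrr mulr0.
  by rewrite /landau /landau_weight (bx0 (le_lt_trans Lr ry)) !mulr0 mul0r.
pose b := 1 - (r / L) ^+ 2.
have rL0 : 0 < r / L by rewrite divr_gt0.
have rL1 : r / L < 1 by rewrite ltr_pdivrMr// mul1r.
have b0 : 0 <= b by rewrite subr_ge0 expr_le1// ltW.
(* By Bernoulli's inequality [p >= 1 - d eta ^ 2]; dividing by [d + 1] gives
   [d eta ^ 2 < (r / L) ^ 2], whence [b < p]. *)
pose eta := r / L / d.+1%:R.
have dp : 0 < d.+1%:R :> R by [].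
have e0 : 0 < eta by rewrite divr_gt0.
have e1 : eta < 1 by rewrite ltr_pdivrMr// mul1r (lt_le_trans rL1)// ler1n.
pose p := (1 - eta ^+ 2) ^+ d.
have bp : b < p.
  apply: lt_le_trans (bernoulli d _); last by rewrite sqr_ge0 expr_le1// ltW.
  rewrite ltrD2l ltrN2 /eta expr_div_n mulrCA gtr_pMr ?exprn_gt0//.
  rewrite ltr_pdivrMr ?exprn_gt0// mul1r expr2 -natrM ltr_nat.
  by rewrite mulnS addSn ltnS leq_addr.
have p0 : 0 < p by apply: le_lt_trans bp.
pose K := (2 * L) ^+ d / (2 * (eta * L)) ^+ d.
have e2 : 0 < (2 * (eta * L)) ^+ d.
  by apply: exprn_gt0; apply: mulr_gt0; [|exact: mulr_gt0].
have K0 : 0 < K.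
  by apply: divr_gt0 => //; apply: exprn_gt0; exact: mulr_gt0.
have [||N HN] := @poly_geometric_cvg _ 0 (b / p) (eps / K) _ _ (divr_gt0 eps0 K0).
- by rewrite divr_ge0// ltW.
- by rewrite ltr_pdivrMr// mul1r.
exists N => n nN.
have itail : integ (fun y => landau_weight n y * (1 - bx r y)).
  have := integB (integ_landau_weight n) ((locint_landau_weight n).2 r).
  by under eq_fun do rewrite -[X in X - _]mulr1 -mulrBr.
have -> : (fun y => landau n y * (1 - bx r y)) =
    (fun y => (Int (landau_weight n))^-1 * (landau_weight n y * (1 - bx r y))).
  by apply/funext => y; rewrite /landau -mulrA.
rewrite IntZ// ler_pdivrMl//.
apply: (@le_trans _ _ (b ^+ n * (2 * L) ^+ d)).
  rewrite -(ge0_IntE (@bx_ge0 R d L) (integral_bx (ltW L0))) -IntZ; last exact: integ_bx.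
  apply: Int_le => //; first by apply: integZ; exact: integ_bx.
  by move=> y; exact: landau_tail_le.
apply: (@le_trans _ _ (p ^+ n * (2 * (eta * L)) ^+ d * eps)); last first.
  by apply: ler_wpM2r; [exact: ltW|exact: Int_landau_weight_ge].
have := HN n nN; rewrite expr0 mul1r ler_pdivlMr// expr_div_n => h.
have pn : 0 < p ^+ n by rewrite exprn_gt0.
rewrite -mulrA -ler_pdivrMl// -ler_pdivrMl//.
by apply: le_trans h; rewrite /K mulrC !mulrA [p ^- n * _]mulrC.
Qed.

(** Finite sums of [c w * p x] with [p] homogeneous. Integrated in [w] against a test function, they
    become finite sums of homogeneous polynomials in [x], to which [killed_hom] applies. *)
Inductive polyk : (E -> E -> R) -> Prop :=
| polyk_mono c n p : continuous (c : E -> R) -> hom n p -> polyk (fun w x => c w * p x)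
| polyk_add Q1 Q2 : polyk Q1 -> polyk Q2 -> polyk (fun w x => Q1 w x + Q2 w x).

Lemma polykZ (b : E -> R) Q : continuous b -> polyk Q -> polyk (fun w x => b w * Q w x).
Proof.
move=> cb; elim=> {Q} [c n p cc hp|Q1 Q2 _ IH1 _ IH2].
  have cbc : continuous (fun w => b w * c w) by move=> w; apply: continuousM; [exact: cb|exact: cc].
  have := polyk_mono cbc hp; congr polyk.
  by apply/funext => w; apply/funext => x; rewrite mulrA.
have := polyk_add IH1 IH2; congr polyk.
by apply/funext => w; apply/funext => x; rewrite mulrDr.
Qed.

Lemma polykX i Q : polyk Q -> polyk (fun w x => x 0 i * Q w x).
Proof.
elim=> {Q} [c n p cc hp|Q1 Q2 _ IH1 _ IH2].
  have := polyk_mono cc (homX i hp); congr polyk.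
  by apply/funext => w; apply/funext => x; rewrite mulrCA.
have := polyk_add IH1 IH2; congr polyk.
by apply/funext => w; apply/funext => x; rewrite mulrDr.
Qed.

Lemma polyk_factor i Q : polyk Q -> polyk (fun w x => (1 - ((w 0 i - x 0 i) / L) ^+ 2) * Q w x).
Proof.
move=> pQ; have oT := @openT E; have sc := sm_coord i oT.
have h1 : polyk (fun w x => (1 - L^-1 ^+ 2 * w 0 i ^+ 2) * Q w x).
  apply: polykZ => //; apply: sm_continuous; apply: smB => //; first exact: sm_cst.
  by apply: smZ => //; exact: smX.
have h2 : polyk (fun w x => (2 * L^-1 ^+ 2 * w 0 i) * (x 0 i * Q w x)).
  apply: (polykZ (b := fun w => 2 * L^-1 ^+ 2 * w 0 i)); last exact: polykX.
  by apply: sm_continuous; exact: smZ.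
have h3 : polyk (fun w x => (- L^-1 ^+ 2) * (x 0 i * (x 0 i * Q w x))).
  apply: (polykZ (b := fun w => - L^-1 ^+ 2)); last by apply: polykX; exact: polykX.
  by move=> w; exact: cst_continuous.
have := polyk_add h1 (polyk_add h2 h3); congr polyk.
by apply/funext => w; apply/funext => x; ring.
Qed.

Lemma polyk_landau n : polyk (fun w x => landau_poly n (w - x)).
Proof.
have h0 : polyk (fun w x => 1).
  have c1 : continuous (fun _ : E => 1 : R) by move=> w; exact: cst_continuous.
  have := polyk_mono c1 (hom0 (1 : R)); congr polyk.
  by apply/funext => w; apply/funext => x; rewrite mulr1.
have key (r : seq 'I_d) : polyk (fun w x => \prod_(i <- r) (1 - ((w - x) 0 i / L) ^+ 2) ^+ n).
  elim: r => [|i r IH].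
    by move: h0; congr polyk; apply/funext => w; apply/funext => x; rewrite big_nil.
  have h m : polyk (fun w x => (1 - ((w 0 i - x 0 i) / L) ^+ 2) ^+ m *
      \prod_(j <- r) (1 - ((w - x) 0 j / L) ^+ 2) ^+ n).
    elim: m => [|m IHm].
      by move: IH; congr polyk; apply/funext => w; apply/funext => x; rewrite mul1r.
    have := polyk_factor i IHm; congr polyk.
    by apply/funext => w; apply/funext => x; rewrite (exprS _ m) mulrA.
  by have := h n; congr polyk; apply/funext => w; apply/funext => x; rewrite big_cons !mxE.
exact: key.
Qed.

Lemma rtest_integM (c : E -> R) Phi : continuous c -> rtest Phi -> integ (fun w => c w * Phi w).
Proof.
move=> cc tP; have [_ [r P0]] := tP; have [M M0 HM] := rtest_bounded tP.
apply: (integ_locintM (r := r) (M := M) (locint_cont cc)).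
  by apply: mrow_continuous; exact: rtest_continuous.
move=> y; have [yr|ry] := leP `|y| r; first by rewrite bx1// mulr1.
by rewrite P0// normr0 mulr_ge0// bx_ge0.
Qed.

Lemma polyk_integ Q Phi x : polyk Q -> rtest Phi -> integ (fun w => Q w x * Phi w).
Proof.
move=> pQ tP; elim: pQ => {Q} [c n p cc hp|Q1 Q2 _ IH1 _ IH2].
  have := integZ (p x) (rtest_integM cc tP); congr integ.
  by apply/funext => w; ring.
by have := integD IH1 IH2; congr integ; apply/funext => w; rewrite mulrDl.
Qed.

(** If [|x|] and [|w|] are at most [L / 2] then [|w - x| <= L], so the cut-off of the weight is 1
    and a genuine polynomial in [x] remains. *)
Lemma conv_landauE n Phi x : (forall y, L / 2 < `|y| -> Phi y = 0) -> rtest Phi ->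
  `|x| <= L / 2 -> conv (landau n) Phi x =
  (Int (landau_weight n))^-1 * Int (fun w => landau_poly n (w - x) * Phi w).
Proof.
move=> P0 tP xL; have [lk _ _ _ _] := approx_id_landau.
rewrite /conv (Int_affine (- x) (oner_neq0 R) (integ_conv x (lk n) tP)).
rewrite normr1 expr1n mul1r -IntZ; last exact: (polyk_integ x (polyk_landau n) tP).
congr Int; apply/funext => w; rewrite scale1r (addrC w) addrA subrr add0r (addrC _ w).
rewrite /landau /landau_weight; have [wL|Lw] := leP `|w| (L / 2); last by rewrite P0// !mulr0.
rewrite bx1; first by rewrite mulr1 mulrA.
apply: le_trans (ler_normB _ _) _; rewrite (splitr L).
exact: lerD.
Qed.

End landau_kernel.

Lemma three_quarters (R : realFieldType) (t : R) :
  0 < t -> t / 2 < 3 * (t / 4) /\ 3 * (t / 4) < t.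
Proof. by move=> t0; split; lra. Qed.

Section density.
Context {R : realType} {d : nat}.
Local Notation E := 'rV[R]_d.
Implicit Types (k p Phi phi g : E -> R) (x y : E) (s : seq 'I_d).
Variables (u : (E -> R) -> R) (chi : E -> R) (dl rho a : R).
Hypotheses (ru : rdist u) (dl0 : 0 < dl) (achi : annular dl rho chi).

Lemma killed_conv_landau (L : R) n Phi : 0 < L -> rho <= L / 2 ->
  (forall n p, hom n p -> killed u chi (fun x => p x * Rp a x)) ->
  rtest Phi -> (forall y, L / 2 < `|y| -> Phi y = 0) ->
  u (fun x => chi x * (conv (landau L n) Phi x * Rp a x)) = 0.
Proof.
move=> L0 rL hk tP P0.
pose c := (Int (landau_weight L n : E -> R))^-1.
have key Q : polyk Q -> killed u chi (fun x => Int (fun w => Q w x * Phi w) * Rp a x).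
  elim=> {Q} [b m p cb hp|Q1 Q2 p1 IH1 p2 IH2].
    have i1 := rtest_integM cb tP.
    apply: (killed_ext dl0 achi _ (killedZ ru dl0 achi (Int (fun w => b w * Phi w)) (hk _ _ hp))) => x _.
    rewrite mulrA; congr (_ * _); rewrite mulrC -IntZ//.
    by congr Int; apply/funext => w; ring.
  apply: (killed_ext dl0 achi _ (killedD ru dl0 achi IH1 IH2)) => x _.
  rewrite -mulrDl -IntD; [|exact: polyk_integ|exact: polyk_integ].
  by congr (Int _ * _); apply/funext => w; rewrite mulrDl.
have [_ <-] := killedZ ru dl0 achi c (key _ (polyk_landau L n)).
congr u; apply/funext => x; have [Ax|nAx] := pselect (annulus dl rho x); last first.
  by rewrite (annular0 achi nAx) !mul0r.
congr (_ * _); rewrite mulrA; congr (_ * _); apply: conv_landauE => //.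
by case/andP : Ax => _ /le_trans; exact.
Qed.

Lemma killed_rtest Phi :
  (forall n p, hom n p -> killed u chi (fun x => p x * Rp a x)) ->
  rtest Phi -> u (fun x => chi x * (Phi x * Rp a x)) = 0.
Proof.
move=> hk tP; have [_ [r P0]] := tP.
(* [L / 2] exceeds both the radius of the support of [Phi] and the outer radius [rho]. *)
pose L := 2 * (`|r| + `|rho| + 1).
have L2 : L / 2 = `|r| + `|rho| + 1 by rewrite /L mulrC mulKf ?pnatr_eq0.
have L0 : 0 < L by rewrite mulr_gt0// ltr_wpDl// addr_ge0.
have rL : rho <= L / 2.
  by rewrite L2; have := ler_norm rho; have := normr_ge0 r; lra.
have P0' y : L / 2 < `|y| -> Phi y = 0.
  rewrite L2 => h; apply: P0; apply: le_lt_trans h.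
  by rewrite -addrA (le_trans (ler_norm r))// lerDl addr_ge0.
pose X x := chi x * Rp a x.
have sR := sm_Rp (d := d) a.
have aX : annular dl rho X by exact: annularM.
have al : approx_id (landau L : nat -> E -> R) := approx_id_landau L0.
have [lk _ _ _ _] := al.
have se n : sm punctured (fun x => conv (landau L n) Phi x - Phi x).
  apply: smB; first exact: open_punctured.
    by apply: sm_sub (sm_conv (lk n) tP).
  by apply: sm_sub (rtest_sm tP).
apply/eqP; rewrite -normr_le0; apply/ler_addgt0Pl => eps eps0.
have [N HN] := rdist_lim dl0 ru aX se (approx_id_unif0 dl rho al tP) eps0.
rewrite addr0; apply: le_trans (HN N (leqnn N)); rewrite -normrN.
have tXP : rtest (fun x => chi x * (Phi x * Rp a x)).
  apply: annular_rtest (annularM dl0 achi _); apply: smM => //.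
    exact: open_punctured.
  by apply: sm_sub (rtest_sm tP).
have tXC : rtest (fun x => chi x * (conv (landau L N) Phi x * Rp a x)).
  apply: annular_rtest (annularM dl0 achi _); apply: smM => //.
    exact: open_punctured.
  by apply: sm_sub (sm_conv (lk N) tP).
have -> : (fun x => X x * (conv (landau L N) Phi x - Phi x)) =
    (fun x => (-1) * (chi x * (Phi x * Rp a x)) + chi x * (conv (landau L N) Phi x * Rp a x)).
  by apply/funext => x; rewrite /X; ring.
by rewrite ru.1// killed_conv_landau// addr0 mulN1r.
Qed.

Definition cutoff x : R := bump (dl / 4) (dl / 2) x.

Lemma cutoff_radius : 0 < dl / 4 /\ dl / 4 < dl / 2.
Proof. by split; [rewrite divr_gt0|rewrite ltr_pM2l// ltf_pV2 ?posrE// ltr_nat]. Qed.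

(** A test function equal to [q ^ a] on a neighbourhood of the annulus: the convergence of
    mollifications is available for test functions, not for the singular kernel. *)
Definition Rp_cut x : R := bump (`|rho| + 1) (`|rho| + 2) x * (1 - cutoff x) * Rp a x.

Lemma Rp_cutE x : dl / 2 <= `|x| -> `|x| <= `|rho| + 1 -> Rp_cut x = Rp a x.
Proof.
move=> h1 h2; have [c1 c2] := cutoff_radius.
rewrite /Rp_cut /cutoff (bump0 c1 c2 h1) bump1//; first by rewrite subr0 !mul1r.
by rewrite ltrD2l ltr1n.
Qed.

Lemma annular_cut : annular (dl / 4) (`|rho| + 2)
  (fun x => bump (`|rho| + 1) (`|rho| + 2) x * (1 - cutoff x)).
Proof.
have [c1 c2] := cutoff_radius; have oT := @openT E.
split.
- apply: smM => //; first exact: sm_bump.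
  by apply: smB => //; [exact: sm_cst|exact: sm_bump].
- by move=> x xd; rewrite /cutoff (bump1 c1 c2 (ltW xd)) subrr mulr0.
- move=> x rx; rewrite bump0 ?mul0r ?(ltW rx)//.
  by rewrite ltrD2l ltr1n.
Qed.

Lemma rtest_Rp_cut : rtest Rp_cut.
Proof.
have [c1 _] := cutoff_radius.
exact: annular_rtest (annularM c1 annular_cut (sm_Rp a)).
Qed.

(** Convolution is symmetric because both the kernel and the mollifier are even. The mollifier sees
    only points within [min (dl / 4) (1 / 2)] of [x], that is, between the radii [dl / 2] and
    [|rho| + 1], where the cut-off changes nothing. *)
Lemma conv_Rp_mollifier n x : - (d%:R / 2) < a ->
  n.+1%:R^-1 <= Num.min (dl / 4) (1 / 2) ->
  3 * (dl / 4) < `|x| -> `|x| < `|rho| + 1 / 2 ->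
  conv (Rp a) (mollifier n) x = conv (mollifier n) Rp_cut x.
Proof.
move=> ad nd dx xr; have lR := locint_Rp (d := d) ad.
have tm := @rtest_mollifier R d n.
rewrite /conv (Int_affine (- x) (oner_neq0 R) (integ_conv x lR tm)).
rewrite normr1 expr1n mul1r.
have iF : integ (fun y => mollifier n y * Rp_cut (x + y)).
  by apply: integ_conv => //; [exact: locint_cont (@rtest_continuous _ _ _ tm)|exact: rtest_Rp_cut].
have m1 : (-1 : R) != 0 by rewrite oppr_eq0 oner_neq0.
rewrite (Int_affine 0 m1 iF) normrN1 expr1n mul1r.
congr Int; apply/funext => w.
rewrite scale1r scaleN1r addr0 (addrC w) addrA subrr add0r mollifierN mulrC.
have [nw|wn] := leP n.+1%:R^-1 `|w|; first by rewrite mollifier0// !mul0r.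
congr (_ * _); rewrite (addrC _ w) -RpN opprD opprK addrC.
move: nd; rewrite le_min => /andP[n1 n2].
have w1 : `|w| <= dl / 4 by apply: le_trans n1; exact: ltW.
have w2 : `|w| <= 1 / 2 by apply: le_trans n2; exact: ltW.
rewrite Rp_cutE//.
  have := ler_normB (x - w) (- w); rewrite opprK subrK normrN => h; lra.
by apply: le_trans (ler_normB _ _) _; lra.
Qed.

Variables (eta : R) (g : E -> R).
Hypotheses (eta0 : 0 < eta) (ad : - (d%:R / 2) < a).
Hypothesis uchi : forall Phi, sm setT Phi -> u Phi = u (fun x => chi x * Phi x).
Hypothesis sg : sm [set x : E | `|x| < eta] g.
Hypothesis ug : forall phi, rtest phi -> small_supp eta phi ->
  u (conv (Rp a) phi) = Int (fun y => g y * phi y).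
Hypothesis g0 : forall s, pds s g 0 = 0.

(** Up to mollification, the pairing of [u] with [chi d^s q ^ a] equals, up to sign, the integral of
    [d^(rev s) g] against the mollifier, by [ug] and integration by parts. This tends to
    [d^(rev s) g (0) = 0]. *)
Lemma allkilled_Rp0 : allkilled u chi (Rp a).
Proof.
have sR := sm_Rp (d := d) a; have oP := @open_punctured R d.
split=> // s; have lR := locint_Rp (d := d) ad.
have tC := rtest_Rp_cut.
have aid := @approx_id_mollifier R d.
have [dl3 dl4] := three_quarters dl0.
pose O : set E := [set x | 3 * (dl / 4) < `|x|] `&` [set x | `|x| < `|rho| + 1 / 2].
have oO : open O by apply: openI; [exact: open_norm_gt|exact: open_norm_lt].
have AO x : annulus dl rho x -> O x.
  move=> /andP[h1 h2]; have hr := ler_norm rho; rewrite /O /=.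
  split; first exact: lt_le_trans dl4 h1.
  by apply: le_lt_trans h2 _; apply: le_lt_trans hr _; rewrite ltrDl divr_gt0.
have cutE x : O x -> Rp_cut x = Rp a x.
  move=> [/= h1 h2]; apply: Rp_cutE; first exact: ltW (lt_trans dl3 h1).
  by apply: ltW (lt_trans h2 _); rewrite ltrD2l; lra.
(* The two functions agree on the open neighbourhood [O] of the annulus, so their derivatives agree
   on the annulus. *)
have -> : (fun x => chi x * pds s (Rp a) x) = (fun x => chi x * pds s Rp_cut x).
  apply/funext => x; have [Ax|nAx] := pselect (annulus dl rho x); last first.
    by rewrite (annular0 achi nAx) !mul0r.
  by congr (_ * _); apply/esym; apply: (pds_ext s oO cutE); exact: AO.
apply/eqP; rewrite -normr_le0; apply/ler_addgt0Pl => eps eps0; rewrite addr0.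
have e2 : 0 < eps / 2 by rewrite divr_gt0.
have tC1 := rtest_pds s tC.
have [lk _ _ _ _] := aid.
have se n : sm punctured (fun x => conv (mollifier n) (pds s Rp_cut) x - pds s Rp_cut x).
  apply: smB => //; first by apply: sm_sub (sm_conv (lk n) tC1).
  by apply: sm_sub (rtest_sm tC1).
have [N1 H1] := rdist_lim dl0 ru achi se (approx_id_unif0 dl rho aid tC1) e2.
have sgr := sm_pds (rev s) sg.
have cg : {for (0 : E), continuous (pds (rev s) g)}.
  by apply: (sm_cont sgr); rewrite /= normr0.
have [N2 H2] := mollifier_cvg eta0 cg sgr e2.
(* The first two bounds are those of [conv_Rp_mollifier]; [eta / 2] puts the support of the
   mollifier strictly inside the ball where [g] represents the potential. *)
pose m := Num.min (Num.min (dl / 4) (1 / 2)) (eta / 2).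
have m0 : 0 < m by rewrite !lt_min !divr_gt0.
have [N3 H3] : exists N : nat, N.+1%:R^-1 < m.
  by have [N _ /(_ N (leqnn N))] := near_infty_natSinv_lt (PosNum m0); exists N.
pose n := maxn N1 (maxn N2 N3).
have n1 : (N1 <= n)%N by exact: leq_maxl.
have n2 : (N2 <= n)%N by rewrite /n; apply: leq_trans (leq_maxr _ _); exact: leq_maxl.
have n3 : (N3 <= n)%N by rewrite /n; apply: leq_trans (leq_maxr _ _); exact: leq_maxr.
have nm : n.+1%:R^-1 <= m.
  by apply: le_trans (ltW H3); rewrite lef_pV2 ?posrE// ler_nat ltnS.
move: nm; rewrite le_min => /andP[nm1 nm2].
have tm := @rtest_mollifier R d n.
have hm : small_supp eta (mollifier n : E -> R).
  exists n.+1%:R^-1; last by move=> x /ltW; exact: mollifier0.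
  by apply: le_lt_trans nm2 _; rewrite ltr_pdivrMr// ltr_pMr// ltr1n.
(* [ug] is used for a derivative of the mollifier. Inside [u] the derivative is moved from the
   mollifier to [Rp_cut], which is legitimate on the annulus; in the integral it is moved to [g]. *)
have u1 : u (fun x => chi x * conv (mollifier n) (pds s Rp_cut) x) =
    (-1) ^+ size s * Int (fun x => pds (rev s) g x * mollifier n x).
  rewrite -(Int_by_parts_seq s sg tm hm) -(ug (rtest_pds s tm) (small_supp_pds s hm)).
  rewrite [RHS]uchi; last by apply: sm_conv => //; exact: rtest_pds.
  congr u; apply/funext => x; have [Ax|nAx] := pselect (annulus dl rho x); last first.
    by rewrite (annular0 achi nAx) !mul0r.
  congr (_ * _); rewrite -(pds_conv s lR tm) -(pds_conv s (lk n) tC).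
  apply/esym; apply: (pds_ext s oO) (AO _ Ax) => y [/= h1 h2].
  exact: conv_Rp_mollifier.
have -> : u (fun x => chi x * pds s Rp_cut x) =
    (-1) ^+ size s * Int (fun x => pds (rev s) g x * mollifier n x) -
    u (fun x => chi x * (conv (mollifier n) (pds s Rp_cut) x - pds s Rp_cut x)).
  rewrite -u1.
  have r1 : rtest (fun x => chi x * conv (mollifier n) (pds s Rp_cut) x).
    by apply: (rtest_chi dl0 achi); apply: sm_sub (sm_conv (lk n) tC1).
  have r2 : rtest (fun x => chi x * (conv (mollifier n) (pds s Rp_cut) x - pds s Rp_cut x)).
    exact: (rtest_chi dl0 achi).
  rewrite addrC -[X in X + _]mulN1r -ru.1//.
  by congr u; apply/funext => x; ring.
rewrite (splitr eps); apply: le_trans (ler_normB _ _) _; apply: lerD; last exact: H1.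
rewrite normrM normrX normrN1 expr1n mul1r.
by have := H2 n n2; rewrite g0 subr0.
Qed.

Hypothesis ha : forall j : nat, a - j%:R != 0 /\ 2 * (a - j%:R) - 2 + d%:R != 0.

Lemma unique_continuation phi : rtest phi -> u phi = 0.
Proof.
move=> tp; have [c1 c2] := cutoff_radius; have oT := @openT E.
have ah : annular (dl / 4) (`|rho| + 2)
    (fun x => bump (`|rho| + 1) (`|rho| + 2) x * (1 - cutoff x)) := annular_cut.
(* The cut-offs make [phi q ^ (- a)] a test function, and they equal 1 on the annulus. *)
have tP : rtest (fun x => phi x * (bump (`|rho| + 1) (`|rho| + 2) x * (1 - cutoff x) * Rp (- a) x)).
  have aP := annularM c1 ah (sm_Rp (- a)).
  have [sP _ _] := aP; have [sp [r p0]] := tp.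
  split; first exact: smM.
  by exists r => x rx; rewrite p0// mul0r.
rewrite uchi; last exact: rtest_sm.
have hk n p (hp : hom n p) := killed_hom ru dl0 achi ha allkilled_Rp0 hp.
rewrite -(killed_rtest hk tP); congr u; apply/funext => x.
have [Ax|nAx] := pselect (annulus dl rho x); last by rewrite (annular0 achi nAx) !mul0r.
congr (_ * _); have xp := annulus_punctured dl0 Ax; case/andP : Ax => dx xr.
have q0 := dotp_gt0 xp.
have x1 : `|x| <= `|rho| + 1 by have := ler_norm rho; lra.
have x2 : dl / 2 <= `|x| by lra.
rewrite /cutoff (bump0 c1 c2 x2) bump1//; last by rewrite ltrD2l ltr1n.
rewrite subr0 !mul1r -mulrA /Rp -powRD ?(gt_eqF q0) ?implybT//.
by rewrite addNr powRr0 mulr1.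
Qed.

End density.

(** * Polar coordinates and line integrals *)

Section power_tail.
Context {R : realType}.
Local Notation leb := (@lebesgue_measure R).

Lemma measurable_bool_natr d' (T' : measurableType d') (b : T' -> bool) :
  measurable_fun setT b -> measurable_fun setT (fun x => (b x)%:R : R).
Proof.
move=> mb; rewrite (_ : (fun x => _) = (fun x => if b x then 1 else 0)).
  exact: measurable_fun_ifT.
by apply/funext => x; case: (b x).
Qed.

Lemma measurable_expV d' (T' : measurableType d') (f : T' -> R) k :
  measurable_fun setT f -> (forall x, 0 <= f x) -> measurable_fun setT (fun x => f x ^- k).
Proof.
move=> mf f0; rewrite (_ : (fun x => _) = (@powR R ^~ (- k%:R)) \o f); last first.
  by apply/funext => x /=; rewrite powRN powR_mulrn.
by apply: measurableT_comp => //; exact: measurable_powR.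
Qed.

Lemma derive_expV (n : nat) (t : R) : 0 < t ->
  is_derive t (1 : R) (fun s : R => - (n.+1%:R^-1 * s ^- n.+1)) (t ^- n.+2).
Proof.
move=> t0; have t1 : t ^+ n.+1 != 0 by rewrite expf_neq0// gt_eqF.
have hX : is_derive t (1 : R) (fun s : R => s ^+ n.+1) ((n.+1%:R * t ^+ n) *: 1).
  rewrite (_ : (fun s => _) = @GRing.exp (R -> R) id n.+1); first exact: is_deriveX.
  by apply/funext => s; rewrite exprfctE.
have hV := @is_deriveV R (fun s => s ^+ n.+1) t _ 1 t1 hX.
have hZ := is_deriveZ (- n.+1%:R^-1) hV.
have -> : (fun s => - (n.+1%:R^-1 * s ^- n.+1)) = (- n.+1%:R^-1 : R) \*: (fun s : R => (s ^+ n.+1)^-1).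
  by apply/funext => s; rewrite -mulNr.
suff <- : - n.+1%:R^-1 *: (- t ^+ n.+1 ^- 2 *: ((n.+1%:R * t ^+ n) *: (1 : R))) = t ^- n.+2 by [].
rewrite /GRing.scale /= mulr1 mulNr mulNr mulrN opprK mulrCA mulKf ?pnatr_eq0//.
by rewrite !exprS; field; rewrite ?expf_neq0 ?gt_eqF.
Qed.

Lemma power_tail_half (n : nat) (r : R) : 0 < r ->
  (\int[leb]_t ((r <= t)%R%:R * t ^- n.+2)%:E = (n.+1%:R^-1 * r ^- n.+1)%:E)%E.
Proof.
move=> r0.
have -> : (\int[leb]_t ((r <= t)%R%:R * t ^- n.+2)%:E = \int[leb]_(t in `[r, +oo[) (t ^- n.+2)%:E)%E.
  rewrite [RHS]integral_mkcond; apply: eq_integral => t _; rewrite patchE.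
  rewrite mem_setE in_itv/= andbT; case: ifP => _; by rewrite ?mul1r ?mul0r.
have c0 t : 0 < t -> {for t, continuous (fun s : R => s ^- n.+2)}.
  move=> t0; apply: cvgV; first by rewrite expf_neq0// gt_eqF.
  exact: exprn_continuous.
rewrite (@ge0_continuous_FTC2y R _ (fun t => - (n.+1%:R^-1 * t ^- n.+1)) r 0).
- by rewrite sub0e -EFinN opprK.
- by move=> x rx; rewrite invr_ge0 exprn_ge0// (le_trans (ltW r0) rx).
- apply: continuous_in_subspaceT => x; rewrite inE/= in_itv/= andbT => rx.
  by apply: c0; exact: lt_le_trans rx.
- apply/cvgrPdist_le => e e0; near=> t.
  have t1 : 1 <= t by near: t; apply: nbhs_pinfty_ge; rewrite num_real.
  have te : e^-1 <= t by near: t; apply: nbhs_pinfty_ge; rewrite num_real.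
  have t0 : 0 < t by exact: lt_le_trans t1.
  rewrite sub0r opprK ger0_norm; last by rewrite mulr_ge0// ?invr_ge0 ?exprn_ge0 ?ler0n// ltW.
  apply: (@le_trans _ _ (1 * t^-1)); last by rewrite mul1r invf_ple.
  rewrite ler_pM ?invr_ge0 ?exprn_ge0 ?(ltW t0)//.
    by rewrite invf_le1 ?ltr0n// ler1n.
  by rewrite lef_pV2 ?posrE ?exprn_gt0// exprS ler_peMr ?(ltW t0)// exprn_ege1.
- by move=> x rx; have [] := derive_expV n (lt_trans r0 rx).
- apply: cvg_at_right_filter; have [/derivable1_diffP/differentiable_continuous h _] := derive_expV n r0.
  exact: h.
- move=> x; rewrite in_itv/= andbT => rx; rewrite derive1E.
  by have [_ ->] := derive_expV n (lt_trans r0 rx).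
Unshelve. all: by end_near.
Qed.

Lemma power_tail (n : nat) (r : R) : 0 < r ->
  (\int[leb]_t ((r <= `|t|)%R%:R * `|t| ^- n.+2)%:E = (2 / n.+1%:R * r ^- n.+1)%:E)%E.
Proof.
move=> r0; pose F (t : R) : \bar R := ((r <= t)%R%:R * t ^- n.+2)%:E.
have F0 t : (0 <= F t)%E.
  rewrite lee_fin; case: (leP r t) => rt; last by rewrite mul0r.
  by rewrite mul1r invr_ge0 exprn_ge0// (le_trans (ltW r0) rt).
have mF : measurable_fun [set: measurableTypeR R] F.
  apply/measurable_EFinP.
  rewrite (_ : (fun t => _) = (fun t : measurableTypeR R => (r <= t)%R%:R * t `^ (- n.+2%:R)%R)%R).
    apply: measurable_funM; last exact: measurable_powR.
    by apply: measurable_bool_natr; apply: measurable_fun_ler.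
  apply/funext => t; case: (leP r t) => rt; last by rewrite !mul0r.
  by rewrite powRN powR_mulrn// (le_trans (ltW r0) rt).
have FN : (\int[leb]_t F (- t)%R = \int[leb]_t F t)%E.
  have m1 : (-1 : R) != 0 by rewrite oppr_eq0 oner_neq0.
  rewrite [RHS](ge0_integral_affine1 0 m1 mF F0).
  rewrite normrN1 mul1e; apply: eq_integral => t _; by rewrite mulN1r addr0.
transitivity (\int[leb]_t (F t + F (- t)%R))%E.
  apply: eq_integral => t _; rewrite /F -EFinD; congr (_ %:E).
  have [t0|t0] := leP 0 t.
    by rewrite ger0_norm// [in X in _ + X]leNgt (_ : - t < r)%R /= ?mul0r ?addr0//; lra.
  by rewrite ltr0_norm// [in X in X + _]leNgt (_ : t < r)%R /= ?mul0r ?add0r//; lra.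
rewrite ge0_integralD//; last first.
  apply: (measurableT_comp mF); exact: oppr_measurable.
rewrite FN power_tail_half// -EFinD; congr EFin; ring.
Qed.

End power_tail.
Section polar_coordinates.
Context {R : realType} {n : nat}.
Local Notation E := 'rV[R]_n.+1.
Local Notation T := (n.+1.-tuple (measurableTypeR R)).
Local Notation leb := (@lebesgue_measure R).
Local Notation mu := (lebesgue_tuple R n.+1).
Implicit Types (K : E -> R) (w x y : E).

Lemma enorm_ge0 w : 0 <= enorm w. Proof. exact: sqrtr_ge0. Qed.

Lemma enormZ (c : R) w : enorm (c *: w) = `|c| * enorm w.
Proof. by rewrite /enorm dotpZ sqrtrM ?sqr_ge0// sqrtr_sqr. Qed.

Lemma continuous_enorm : continuous (@enorm R n.+1).
Proof.
move=> x; apply: continuous_comp; last exact: sqrt_continuous.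
exact: (sm_continuous (sm_dotp (@openT E))).
Qed.

Lemma measurable_scaled_row K : mrow K ->
  measurable_fun setT (fun p : measurableTypeR R * T => K (p.1 *: row_of_tuple p.2)).
Proof.
move=> mK; pose sc (p : measurableTypeR R * T) : T := [tuple p.1 * tnth p.2 i | i < n.+1].
rewrite (_ : (fun p => _) = (fun t : T => K (row_of_tuple t)) \o sc); last first.
  apply/funext => p /=; congr K; apply/rowP => i.
  by rewrite !mxE tnth_mktuple.
apply: measurableT_comp => //; apply/measurable_fun_tnthP => i.
rewrite (_ : _ \o _ = (fun p : measurableTypeR R * T => p.1 * tnth p.2 i)); last first.
  by apply/funext => p /=; rewrite tnth_mktuple.
apply: measurable_funM; first exact: measurable_fst.
exact: (measurableT_comp (measurable_tnth i) measurable_snd).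
Qed.

Lemma measurable_line K (v : E) : mrow K ->
  measurable_fun setT (fun s : measurableTypeR R => K (s *: v)).
Proof.
move=> mK; pose f (s : measurableTypeR R) : measurableTypeR R * T := (s, [tuple v 0 i | i < n.+1]).
rewrite (_ : (fun s => _) = (fun p : measurableTypeR R * T => K (p.1 *: row_of_tuple p.2)) \o f).
  apply: measurableT_comp; first exact: measurable_scaled_row.
  by apply/measurable_fun_pairP; split; [exact: measurable_id|exact: measurable_cst].
apply/funext => s /=; congr (K (_ *: _)); apply/rowP => i.
by rewrite mxE tnth_mktuple.
Qed.

Definition unit_punctured_ball : set E := [set x | 0 < enorm x <= 1].

(** The sphere integral is defined over the punctured unit ball, so no polar map is needed.
    Replacing [s] by [|t| s] removes the normalisation of the direction; Tonelli's theorem and the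
    dilation [y = s t] then give the integral of [|y| K y] times [|s| ^ - (n + 2)] over
    [|s| >= |y|], and integrating in [s] leaves [2 / (n + 1) |y| ^ - n K y]. *)
Lemma polar_coordinates K : mrow K -> (forall y, 0 <= K y) ->
  (\int[mu]_(t in @row_of_tuple R n.+1 @^-1` unit_punctured_ball)
     \int[leb]_s (K (s *: ((enorm (row_of_tuple t))^-1 *: row_of_tuple t)))%:E =
   (2 / n.+1%:R)%:E * \int[mu]_t ((0 < enorm (row_of_tuple t))%R%:R *
      (enorm (row_of_tuple t) ^- n * K (row_of_tuple t)))%:E)%E.
Proof.
move=> mK K0.
pose N (t : T) : R := enorm (row_of_tuple t).
have mN : measurable_fun setT N by exact: mrow_continuous continuous_enorm.
pose H (p : measurableTypeR R * T) : R :=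
  (0 < N p.2 <= 1)%R%:R * (N p.2 * K (p.1 *: row_of_tuple p.2)).
(* [H] is the integrand before the dilation [y = s t], and [G] the integrand after it, Jacobian
   included. *)
pose G (p : measurableTypeR R * T) : R :=
  (0 < N p.2)%R%:R * (N p.2 * K (row_of_tuple p.2)) * ((N p.2 <= `|p.1|)%R%:R * `|p.1| ^- n.+2).
have N0 t : 0 <= N t by exact: enorm_ge0.
have H0 p : (0 <= (H p)%:E)%E by rewrite lee_fin !mulr_ge0.
have G0 p : (0 <= (G p)%:E)%E by rewrite lee_fin !mulr_ge0// invr_ge0 exprn_ge0.
have mN2 : measurable_fun setT (fun p : measurableTypeR R * T => N p.2).
  exact: (measurableT_comp mN measurable_snd).
have mpos : measurable_fun setT (fun p : measurableTypeR R * T => (0 < N p.2)%R).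
  exact: measurable_fun_ltr.
have mH : measurable_fun setT (fun p => (H p)%:E).
  apply/measurable_EFinP; apply: measurable_funM.
    by apply: measurable_bool_natr; apply: measurable_and => //; exact: measurable_fun_ler.
  by apply: measurable_funM => //; exact: measurable_scaled_row.
have mG : measurable_fun setT (fun p => (G p)%:E).
  apply/measurable_EFinP; apply: measurable_funM.
    apply: measurable_funM; first exact: measurable_bool_natr.
    by apply: measurable_funM => //; exact: (measurableT_comp mK measurable_snd).
  have mf : measurable_fun setT (fun p : measurableTypeR R * T => `|p.1| : R).
    by apply: measurableT_comp => //; exact: measurable_fst.
  apply: measurable_funM; first by apply: measurable_bool_natr; exact: measurable_fun_ler.
  by apply: measurable_expV => // p; exact: normr_ge0.
transitivity (\int[mu]_t \int[leb]_s (H (s, t))%:E)%E.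
  rewrite integral_mkcond; apply: eq_integral => t _; rewrite patchE /H /= -/(N t).
  case: ifPn => [/set_mem /= /andP[n0 n1]|]; last first.
    rewrite notin_setE /= => /negP nA.
    rewrite /N (negbTE nA); under eq_integral do rewrite mul0r.
    by rewrite integral0.
  rewrite -/(N t) in n0 n1 *; rewrite n0 n1.
  have mF (v : E) : measurable_fun setT (fun s : measurableTypeR R => (K (s *: v))%:E).
    by apply/measurable_EFinP; exact: measurable_line.
  rewrite (ge0_integral_affine1 0 (lt0r_neq0 n0) (mF _)); last by move=> s; rewrite lee_fin.
  under eq_integral => s _.
    rewrite addr0 scalerA mulrAC mulfV ?mul1r ?gt_eqF//; over.
  rewrite ger0_norm ?(ltW n0)// -ge0_integralZl//.
  - by apply: eq_integral => s _; rewrite mul1r -EFinM.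
  - by move=> s _; rewrite lee_fin.
  - by rewrite lee_fin ltW.
transitivity (\int[leb]_s \int[mu]_t (G (s, t))%:E)%E.
  rewrite -(fubini_tonelli _ mH H0).
  apply: ge0_ae_eq_integral => //.
  - exact: (measurable_fun_fubini_tonelli_F _ mH H0).
  - exact: (measurable_fun_fubini_tonelli_F _ mG G0).
  - by move=> s _; apply: integral_ge0.
  - by move=> s _; apply: integral_ge0.
  (* The dilation requires [s] to be nonzero, which excludes only a null set. *)
  exists [set 0]; split; [exact: measurable_set1|exact: lebesgue_measure_set1|].
  move=> s /= /not_implyP[_]; apply: contra_notP => /eqP s0.
  pose g (y : E) : R := (0 < enorm y)%R%:R * (enorm y * K y) *
    ((enorm y <= `|s|)%R%:R * `|s| ^- n.+2).
  have mg : mrow g.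
    by apply/measurable_EFinP; exact: (measurableT_comp mG (@pair1_measurable _ _ _ _ s)).
  have g0 y : (0 <= (g y)%:E)%E.
    by rewrite lee_fin !mulr_ge0 ?enorm_ge0// invr_ge0 exprn_ge0.
  have sp : 0 < `|s| by rewrite normr_gt0.
  have mgs : mrow (fun y => g (s *: y + 0)) by exact: mrow_affine.
  rewrite [RHS](_ : _ = (\int[mu]_t (g (row_of_tuple t))%:E)%E)//.
  rewrite (@ge0_Int_affineE _ _ s 0 (fun y => (g y)%:E) s0 _ g0); last exact/measurable_EFinP.
  rewrite -(ge0_integralZl _ measurableT (f := fun t => (g (s *: row_of_tuple t + 0))%:E)); first last.
  - by rewrite lee_fin exprn_ge0.
  - by [].
  - exact/measurable_EFinP.
  apply: eq_integral => t _; rewrite /g /H /= -EFinM addr0 enormZ -/(N t).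
  congr (_%:E); rewrite pmulr_rgt0// ger_pMr//.
  case: (ltP 0 (N t)) => n0; last by rewrite !mul0r mulr0.
  case: (leP (N t) 1) => n1; last by rewrite !mul0r !mulr0.
  by rewrite /= !mul1r !exprS; field; rewrite ?expf_neq0 ?gt_eqF.
rewrite (fubini_tonelli _ mG G0).
have mk : measurable_fun setT (fun t : T => (0 < N t)%R%:R * (N t ^- n * K (row_of_tuple t))).
  apply: measurable_funM; first exact/measurable_bool_natr/measurable_fun_ltr.
  by apply: measurable_funM => //; exact: measurable_expV.
rewrite -[RHS](ge0_integralZl mu measurableT
  (f := fun t => ((0 < N t)%R%:R * (N t ^- n * K (row_of_tuple t)))%:E)); first last.
- by rewrite lee_fin divr_ge0.
- by move=> t _; rewrite lee_fin !mulr_ge0// invr_ge0 exprn_ge0.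
- exact/measurable_EFinP.
apply: eq_integral => t _; rewrite /G /= -/(N t).
case: (ltP 0 (N t)) => n0; last first.
  by under eq_integral do rewrite !mul0r; rewrite integral0 mul0r mule0.
under eq_integral do rewrite mul1r EFinM.
rewrite ge0_integralZl//; first last.
- by rewrite lee_fin mulr_ge0.
- apply/measurable_EFinP; apply: measurable_funM; last exact: measurable_expV.
  by apply: measurable_bool_natr; apply: measurable_fun_ler => //; exact: measurableT_comp.
rewrite power_tail// -!EFinM; congr (_%:E).
by rewrite mul1r exprS; field; rewrite ?expf_neq0 ?gt_eqF.
Qed.

End polar_coordinates.

Section line_integrals.
Context {R : realType} {n : nat}.
Local Notation E := 'rV[R]_n.+1.
Local Notation T := (n.+1.-tuple (measurableTypeR R)).
Local Notation leb := (@lebesgue_measure R).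
Local Notation mu := (lebesgue_tuple R n.+1).
Local Notation B := (@row_of_tuple R n.+1 @^-1` unit_punctured_ball).
Implicit Types (K : E -> R) (v w x y : E).

(** Unlike smoothness, this condition is inherited by positive and negative parts, and it still
    makes all line integrals converge. *)
Definition bounded_support K := mrow K /\ exists r M : R, 0 <= M /\ forall y, `|K y| <= M * bx r y.

Lemma bounded_support_pos K : bounded_support K -> bounded_support (fun y => Num.max (K y) 0).
Proof.
move=> [mK [r [M [M0 HM]]]]; split.
  by apply: measurable_maxr => //; exact: measurable_cst.
exists r, M; split=> // y; apply: le_trans (HM y).
by rewrite ger0_norm ?le_max ?lexx ?orbT// ge_max ler_norm normr_ge0.
Qed.

Lemma bounded_supportN K : bounded_support K -> bounded_support (fun y => - K y).
Proof.
move=> [mK [r [M [M0 HM]]]]; split; first exact: measurable_funN.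
by exists r, M; split=> // y; rewrite normrN.
Qed.

Definition line_integral K v : R := \int[leb]_s K (s *: v).

Lemma integrable_line K v : bounded_support K -> v != 0 ->
  leb.-integrable setT (fun s => (K (s *: v))%:E).
Proof.
move=> [mK [r [M [M0 HM]]]] v0; have nv : 0 < `|v| by rewrite normr_gt0.
pose b := `|r| / `|v|; have b0 : 0 <= b by rewrite divr_ge0.
have mKv : measurable_fun setT (fun s : measurableTypeR R => K (s *: v)).
  exact: measurable_line.
have mI := @measurable_interval1 R b.
apply: (@le_integrable _ _ _ leb _ measurableT _ (fun s => (M * (`|s| <= b)%R%:R)%:E)) => //.
- exact/measurable_EFinP.
- move=> s _; rewrite lee_fin; apply: le_trans (HM _) _.
  rewrite ger0_norm ?mulr_ge0// ler_wpM2l// /bx ler_nat normrZ.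
  have [h|//] := boolP (`|s| * `|v| <= r).
  by rewrite /b ler_pdivlMr// (le_trans h (ler_norm _)).
- apply/integrableP; split.
    by apply/measurable_EFinP; apply: measurable_funM.
  under eq_integral => s _ do rewrite gee0_abs ?lee_fin ?mulr_ge0// EFinM.
  rewrite ge0_integralZl//; last exact/measurable_EFinP.
  by rewrite integral_interval1// -EFinM ltry.
Qed.

Lemma line_integral_ge0E K v : bounded_support K -> (forall y, 0 <= K y) -> v != 0 ->
  ((line_integral K v)%:E = \int[leb]_s (K (s *: v))%:E)%E.
Proof.
move=> bK K0 v0; rewrite /line_integral /Rintegral fineK//.
have /integrableP[/measurable_EFinP mf fy] := integrable_line bK v0.
by rewrite -integral_fin_num_abs.
Qed.

Lemma line_integral_posneg K v : bounded_support K -> v != 0 ->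
  line_integral K v = line_integral (fun y => Num.max (K y) 0) v -
    line_integral (fun y => Num.max (- K y) 0) v.
Proof.
move=> bK v0; rewrite /line_integral -RintegralB//.
- apply: eq_Rintegral => s _; rewrite /Num.max oppr_lt0.
  by case: ltrgt0P => [_|_|->]; rewrite ?subr0 ?sub0r ?opprK.
- exact: integrable_line (bounded_support_pos bK) v0.
- exact: integrable_line (bounded_support_pos (bounded_supportN bK)) v0.
Qed.

Lemma unit_vector_neq0 (t : T) : B t -> (enorm (row_of_tuple t))^-1 *: row_of_tuple t != 0.
Proof.
move=> /= /andP[t0 _]; rewrite scaler_eq0 invr_eq0 negb_or (gt_eqF t0)/=.
by apply/negP => /eqP t00; move: t0; rewrite t00 /enorm dotp0 sqrtr0 ltxx.
Qed.

Lemma measurable_unit_ball : measurable B.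
Proof.
have mN : measurable_fun setT (fun t : T => enorm (row_of_tuple t)).
  exact: mrow_continuous continuous_enorm.
rewrite (_ : B = (fun t : T => enorm (row_of_tuple t)) @^-1` `]0, 1]).
  by rewrite -[X in measurable X]setTI; apply: mN => //; exact: measurable_itv.
by apply/seteqP; split => t /=; rewrite in_itv.
Qed.

Lemma measurable_line_integral K : bounded_support K -> (forall y, 0 <= K y) ->
  measurable_fun B (fun t : T => line_integral K ((enorm (row_of_tuple t))^-1 *: row_of_tuple t)).
Proof.
move=> bK K0; have [mK _] := bK.
apply/measurable_EFinP.
pose I (t : T) : \bar R := (\int[leb]_s (K (s *: row_of_tuple t))%:E)%E.
pose u (t : T) : T := [tuple (enorm (row_of_tuple t))^-1 * tnth t i | i < n.+1].
apply: (eq_measurable_fun (I \o u)) => [t /set_mem Bt|].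
  rewrite /= line_integral_ge0E ?unit_vector_neq0// /I; apply: eq_integral => s _.
  congr (_%:E); congr (K (_ *: _)); apply/rowP => i; by rewrite !mxE tnth_mktuple.
apply: measurable_funTS; apply: measurableT_comp.
  have mS := measurable_scaled_row mK.
  apply: (measurable_fun_fubini_tonelli_G (fun p : measurableTypeR R * T => (K (p.1 *: row_of_tuple p.2))%:E)).
    exact/measurable_EFinP.
  by move=> p; rewrite lee_fin.
apply/measurable_fun_tnthP => i.
rewrite (_ : _ \o _ = (fun t : T => enorm (row_of_tuple t) ^- 1 * tnth t i)); last first.
  by apply/funext => t /=; rewrite tnth_mktuple expr1.
apply: measurable_funM; last exact: measurable_tnth.
apply: measurable_expV => [|t]; last exact: enorm_ge0.
exact: mrow_continuous continuous_enorm.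
Qed.

Definition sphere_line_integral K : R :=
  \int[mu]_(t in B) line_integral K ((enorm (row_of_tuple t))^-1 *: row_of_tuple t).

Hypothesis n0 : (0 < n)%N.

Lemma ge0_sphere_line_integralE K : bounded_support K -> (forall y, 0 <= K y) ->
  (\int[mu]_(t in B) (line_integral K ((enorm (row_of_tuple t))^-1 *: row_of_tuple t))%:E =
  (2 / n.+1%:R * Int (fun y => Rp (- (n%:R / 2)) y * K y))%:E)%E.
Proof.
move=> bK K0; have [mK [r [M [M0 HM]]]] := bK.
under eq_integral => t /set_mem Bt do rewrite line_integral_ge0E ?unit_vector_neq0//.
rewrite polar_coordinates// [RHS]EFinM; congr (_ * _)%E.
have lR : locint (Rp (- (n%:R / 2)) : E -> R).
  by apply: locint_Rp; rewrite ltrN2 ltr_pM2r// ltr_nat.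
have iR := integ_locintM lR mK HM.
rewrite /Int /Rintegral fineK; last first.
  by move/integP : iR => [mf fy]; rewrite -integral_fin_num_abs.
apply: eq_integral => t _; congr (_%:E).
rewrite -mulNr -enorm_powR powRN powR_mulrn; last exact: enorm_ge0.
(* At the origin both sides are 0: since [n > 0], the inverse of [0 ^ n] is the inverse of 0, which
   is 0. *)
have := enorm_ge0 (row_of_tuple t); rewrite le_eqVlt => /predU1P[<-|->]; last by rewrite mul1r.
by rewrite ltxx mul0r expr0n gtn_eqF// invr0 mul0r.
Qed.

Lemma sphere_line_integralE K : bounded_support K ->
  sphere_line_integral K = 2 / n.+1%:R * Int (fun y => Rp (- (n%:R / 2)) y * K y).
Proof.
move=> bK; have bp := bounded_support_pos bK.
have bn := bounded_support_pos (bounded_supportN bK).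
have p0 y : 0 <= Num.max (K y) 0 by rewrite le_max lexx orbT.
have q0 y : 0 <= Num.max (- K y) 0 by rewrite le_max lexx orbT.
have int K' : bounded_support K' -> (forall y, 0 <= K' y) -> mu.-integrable B
  (EFin \o (fun t : T => line_integral K' ((enorm (row_of_tuple t))^-1 *: row_of_tuple t))).
  move=> b0 K0; apply/integrableP; split.
    by apply/measurable_EFinP; exact: measurable_line_integral.
  under eq_integral => t _ do rewrite gee0_abs ?lee_fin ?Rintegral_ge0//.
  by rewrite ge0_sphere_line_integralE// ltry.
rewrite /sphere_line_integral.
under eq_Rintegral => t /set_mem Bt do rewrite line_integral_posneg ?unit_vector_neq0//.
rewrite RintegralB//; [|exact: measurable_unit_ball|exact: int|exact: int].
rewrite /Rintegral !ge0_sphere_line_integralE//= -mulrBr; congr (_ * _).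
have lR : locint (Rp (- (n%:R / 2)) : E -> R).
  by apply: locint_Rp; rewrite ltrN2 ltr_pM2r// ltr_nat.
have iR K' : bounded_support K' -> integ (fun y => Rp (- (n%:R / 2)) y * K' y).
  by move=> [mK' [r [M [M0 HM]]]]; exact: integ_locintM lR mK' HM.
rewrite -IntB; [|exact: iR|exact: iR].
congr Int; apply/funext => y; rewrite -mulrBr; congr (_ * _); rewrite /Num.max oppr_lt0.
by case: ltrgt0P => [_|_|->]; rewrite ?subr0 ?sub0r ?opprK.
Qed.

End line_integrals.

(** * Complex-valued functions and distributions *)

Section complex_functions.
Context {R : realType} {d : nat}.
Local Notation E := 'rV[R]_d.
Local Notation Re g := (fun x => complex.Re (g x)).
Local Notation Im g := (fun x => complex.Im (g x)).
Implicit Types (U : set E) (g : E -> R[i]) (k phi : E -> R) (x b : E).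

Definition rc k : E -> R[i] := fun x => ((k x)%:C)%C.

Lemma pderivsE s g : pderivs s g = fun x => Complex (pds s (Re g) x) (pds s (Im g) x).
Proof.
elim: s => [|i s IH] /=; first by apply/funext => x; case: (g x).
by rewrite IH /pderiv !pdE.
Qed.

Lemma smooth_onP U g : smooth_on U g <-> sm U (Re g) /\ sm U (Im g).
Proof.
split=> [H|[s1 s2] s x Ux].
  split; apply: sm_pointwise => s x Ux; have := H s x Ux; rewrite pderivsE /=.
    by move=> [? ? ? ?].
  by move=> [? ? ? ?].
rewrite pderivsE /=; split.
- exact: (sm_cont (sm_pds s s1) Ux).
- exact: (sm_cont (sm_pds s s2) Ux).
- by move=> i; exact: (sm_derivable (sm_pds s s1) Ux).
- by move=> i; exact: (sm_derivable (sm_pds s s2) Ux).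
Qed.

Lemma complex_eq0 (z : R[i]) : (z == 0) = (complex.Re z == 0) && (complex.Im z == 0).
Proof. by case: z => a b; rewrite eq_complex. Qed.

Lemma compact_norm_sub_le (x0 : E) (r : R) : compact [set x : E | `|x - x0| <= r].
Proof.
apply: bounded_closed_compact.
  exists (r + `|x0|); split; first exact: num_real.
  move=> M rM x /= xr; apply: le_trans (ltW rM).
  by rewrite -[X in `|X|](subrK x0); apply: le_trans (ler_normD _ _) _; rewrite lerD2r.
apply: (@closed_comp _ _ (fun x : E => `|x - x0|) [set y | y <= r]); last exact: closed_le.
move=> x _; apply: continuous_comp; last exact: norm_continuous.
by apply: continuousB; [exact: id|exact: cst_continuous].
Qed.

Lemma fsupp_bounded (x0 : E) g (r : R) : (forall x, r < `|x - x0| -> g x = 0) ->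
  compact (fsupp g) /\ fsupp g `<=` [set x | `|x - x0| <= r].
Proof.
move=> g0; have cK := @compact_norm_sub_le x0 r.
have sub : fsupp g `<=` [set x | `|x - x0| <= r].
  have /closure_id -> := compact_closed (@norm_hausdorff _ _) cK.
  rewrite /fsupp; apply: closure_subset => x /=.
  by apply: contraNT; rewrite -ltNge => /g0 ->.
by split=> //; apply: subclosed_compact sub => //; exact: closed_closure.
Qed.

Lemma test_functionP g : test_function setT g <-> rtest (Re g) /\ rtest (Im g).
Proof.
split=> [[/smooth_onP[s1 s2] cg _]|[[s1 [r1 h1]] [s2 [r2 h2]]]].
  have [M [_ HM]] := compact_bounded cg.
  have g0 x : M + 1 < `|x| -> g x = 0.
    move=> Mx; apply/eqP; apply: contraTT Mx => gx; rewrite -leNgt.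
    by apply: HM; [rewrite ltrDl|exact: subset_closure].
  by split; split=> //; exists (M + 1) => x /g0 ->.
have g0 x : Num.max r1 r2 < `|x - 0| -> g x = 0.
  rewrite subr0 gt_max => /andP[/h1 g1 /h2 g2]; apply/eqP.
  by rewrite complex_eq0 g1 g2 eqxx.
by split; [exact/smooth_onP|exact: (fsupp_bounded g0).1|].
Qed.

Lemma test_function_rc k : test_function setT (rc k) <-> rtest k.
Proof.
split=> [/test_functionP[]//|tk]; apply/test_functionP; split=> //.
by split; [apply: sm_cst; exact: openT|exists 0].
Qed.

Lemma normc_le (z : R[i]) : Normc.normc z <= `|complex.Re z| + `|complex.Im z|.
Proof.
case: z => x y /=; rewrite -[leRHS]ger0_norm ?addr_ge0// -sqrtr_sqr ler_wsqrtr//.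
rewrite -(real_normK (num_real x)) -(real_normK (num_real y)).
by rewrite sqrrD lerD2r lerDl mulrn_wge0// mulr_ge0.
Qed.

Lemma normc_ge0 (z : R[i]) : 0 <= Normc.normc z.
Proof. by case: z => x y /=; rewrite sqrtr_ge0. Qed.

Lemma normc_ge_Re (z : R[i]) : `|complex.Re z| <= Normc.normc z.
Proof. by case: z => x y /=; rewrite -sqrtr_sqr ler_wsqrtr// lerDl sqr_ge0. Qed.

Lemma normc_ge_Im (z : R[i]) : `|complex.Im z| <= Normc.normc z.
Proof. by case: z => x y /=; rewrite -sqrtr_sqr ler_wsqrtr// lerDr sqr_ge0. Qed.

(** The factor 2 comes from [|z| <= |Re z| + |Im z|]. The absolute value is there because the
    constant in [distribution] carries no sign. *)
Lemma seminorm_bound (m : nat) g (M : R) :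
  (forall s, (size s <= m)%N -> forall x, `|pds s (Re g) x| <= M /\ `|pds s (Im g) x| <= M) ->
  `|seminorm m g| <= 2 * M.
Proof.
move=> H; rewrite /seminorm; set A := [set r | _].
have uA : ubound A (2 * M).
  move=> _ [e [x [em ->]]]; apply: le_trans (normc_le _) _; rewrite /mderiv pderivsE /=.
  set s := flatten _; have sm : (size s <= m)%N.
    rewrite size_flatten /shape -map_comp sumnE big_map big_enum /=.
    by under eq_bigr do rewrite /= size_nseq.
  by have [h1 h2] := H s sm x; rewrite mulrDl mul1r lerD.
have A0 : A (Normc.normc (mderiv (fun=> 0%N) g 0)).
  by exists (fun=> 0%N), 0; rewrite big1.
have sA : 0 <= sup A.
  apply: (@le_trans _ _ (Normc.normc (mderiv (fun=> 0%N) g 0))).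
    by rewrite normc_ge0.
  by apply: ub_le_sup => //; exists (2 * M).
by rewrite ger0_norm//; apply: ge_sup => //; exists (Normc.normc (mderiv (fun=> 0%N) g 0)).
Qed.

(** A sequence of indices is a permutation of the sorted sequence with the same multiplicities, and
    partial derivatives commute. *)
Lemma mderiv_pds U g x : open U -> U x -> smooth_on U g ->
  (forall b : 'I_d -> nat, mderiv b g x = 0) ->
  forall s, pds s (Re g) x = 0 /\ pds s (Im g) x = 0.
Proof.
move=> oU Ux /smooth_onP[s1 s2] H s.
have ps : perm_eq s (flatten [seq nseq (count_mem i s) i | i <- enum 'I_d]).
  apply/allP => j _ /=; rewrite count_flatten -map_comp sumnE big_map big_enum /=.
  rewrite (bigD1 j)//= count_nseq /= eqxx mul1n big1 ?addn0// => i ij.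
  by rewrite count_nseq /= (negbTE ij).
have := H (fun i => count_mem i s); rewrite /mderiv pderivsE => /eqP.
rewrite complex_eq0 /= => /andP[/eqP h1 /eqP h2].
by rewrite (pds_perm oU s1 Ux ps) (pds_perm oU s2 Ux ps).
Qed.

End complex_functions.

(** * Translation to the origin and reduction to real functionals *)

Section translation.
Context {R : realType} {d : nat}.
Local Notation E := 'rV[R]_d.
Implicit Types (U : set E) (g : E -> R) (x v b : E).

Lemma derive_translate g b v x :
  'D_v (fun y => g (y + b)) x = 'D_v g (x + b) /\
  (derivable g (x + b) v -> derivable (fun y => g (y + b)) x v).
Proof.
have H : (fun h : R => h^-1 *: (((fun y => g (y + b)) \o shift x) (h *: v) - g (x + b))) =
    (fun h : R => h^-1 *: ((g \o shift (x + b)) (h *: v) - g (x + b))).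
  by apply/funext => h /=; rewrite addrA.
by rewrite /derive /derivable H.
Qed.

Lemma pds_translate s g b : pds s (fun x => g (x + b)) = fun x => pds s g (x + b).
Proof.
elim: s => //= i s ->; apply/funext => x.
by rewrite !pdE (derive_translate _ _ _ _).1.
Qed.

Lemma sm_translate U g b : sm U g -> sm [set x | U (x + b)] (fun x => g (x + b)).
Proof.
move=> sg; apply: sm_pointwise => s x Ux; rewrite pds_translate; split=> [|i].
  have h1 : {for x, continuous (fun y : E => y + b)}.
    by apply: (@continuousD _ _ _ (@id E) (fun=> b)); [exact: id|exact: cst_continuous].
  have h2 : {for x + b, continuous (pds s g)} := sm_cont (sm_pds s sg) Ux.
  exact: (continuous_comp h1 h2).
by apply: (derive_translate _ _ _ _).2; exact: (sm_derivable (sm_pds s sg) Ux).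
Qed.

Lemma rtest_translate g b : rtest g -> rtest (fun x => g (x + b)).
Proof.
move=> [sg [r g0]]; split; first exact: (sm_translate b sg).
exists (r + `|b|) => x rx; apply: g0; have := ler_normB (x + b) b.
by rewrite addrK; lra.
Qed.

Lemma Int_translate g b : integ g -> Int (fun x => g (x + b)) = Int g.
Proof.
move=> ig; rewrite [RHS](Int_affine b (oner_neq0 R) ig) normr1 expr1n mul1r.
by under [in RHS]eq_fun do rewrite scale1r.
Qed.

End translation.

Lemma open_shell {R : realType} {d : nat} (x0 : 'rV[R]_d) (r1 r2 : R) :
  open [set x : 'rV[R]_d | r1 < `|x - x0| < r2].
Proof.
have -> : [set x : 'rV[R]_d | r1 < `|x - x0| < r2] =
    (fun x => x - x0) @^-1` ([set x | r1 < `|x|] `&` [set x | `|x| < r2]).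
  by apply/seteqP; split => x /= => [/andP|[-> ->]].
apply: open_comp; last by apply: openI; [exact: open_norm_gt|exact: open_norm_lt].
by move=> x _; apply: (@continuousB _ _ _ (@id 'rV[R]_d) (fun=> x0)); [exact: id|exact: cst_continuous].
Qed.

Section reduction.
Context {R : realType} {d : nat}.
Local Notation E := 'rV[R]_d.
Implicit Types (x y : E) (g : E -> R[i]) (k phi Phi : E -> R).
Variables (f : functional R d) (V : set E) (x0 : E) (P : R[i] -> R).
Hypotheses (cf : compact_distribution f) (oV : open V) (Vx0 : V x0) (fV : vanishes_on V f).
Hypothesis PE : P = @complex.Re R \/ P = @complex.Im R.

(** The functional [f] translated so that [x0] becomes the origin, on real functions; [P] stands for
    the real or the imaginary part and lets one argument serve both. *)
Definition local_part k : R := P (f (rc (fun x => k (x - x0)))).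

Lemma rc_lin (c : R) k1 k2 :
  rc (fun x => c * k1 x + k2 x) = fun x => (c%:C)%C * rc k1 x + rc k2 x.
Proof. by apply/funext => x; rewrite /rc rmorphD rmorphM. Qed.

Lemma partD (z1 z2 : R[i]) : P (z1 + z2) = P z1 + P z2.
Proof. by case: PE => ->; case: z1 z2 => [? ?] []. Qed.

Lemma partZ (c : R) (z : R[i]) : P ((c%:C)%C * z) = c * P z.
Proof. by case: PE => ->; case: z => a b; rewrite /= mul0r ?subr0 ?addr0. Qed.

Lemma part_le (z : R[i]) : `|P z| <= Normc.normc z.
Proof. by case: PE => ->; [exact: normc_ge_Re|exact: normc_ge_Im]. Qed.

Lemma rdist_local_part : rdist local_part.
Proof.
have [[fl fb] _ _] := cf; split=> [c g1 g2 t1 t2|r].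
  rewrite /local_part rc_lin fl ?partD ?partZ//.
    by apply/test_function_rc; exact: rtest_translate.
  by apply/test_function_rc; exact: rtest_translate.
have Kc := @compact_norm_sub_le R d x0 r; have [C [m H]] := fb _ Kc.
exists (`|C| * 2), m => g M tg g0 HM.
have tg' : rtest (fun x => g (x - x0)) by exact: rtest_translate.
have [tr tc _] := (test_function_rc (fun x => g (x - x0))).2 tg'.
apply: le_trans (part_le _) _; apply: le_trans (H _ _) _.
  split=> //; apply: (fsupp_bounded _).2 => x rx.
  by rewrite /rc g0.
apply: le_trans (ler_norm _) _; rewrite normrM -mulrA ler_wpM2l//.
apply: seminorm_bound => s sm x; split.
  by rewrite [X in pds s X](_ : _ = fun x => g (x - x0))// pds_translate; exact: HM.
rewrite (pds_zero (U := setT)) ?normr0//; last exact: openT.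
by apply: le_trans (HM s sm x).
Qed.

(** The support stays at distance [dl] from [x0]. The weaker strict bounds define an open set, so a
    cut-off equal to 1 there is 1 on a neighbourhood of the support, as [compact_distribution]
    demands. *)
Lemma support_radii : exists dl rho : R, 0 < dl /\
  forall x, dsupp f x -> dl / 2 < `|x - x0| < `|rho| + 1.
Proof.
have [_ cs _] := cf.
have [dl /= dl0 dlV] : nbhs_ball x0 V by apply/nbhs_ballP; exact: open_nbhs_nbhs.
have [M [_ HM]] := compact_bounded cs.
exists dl, (`|M| + 1 + `|x0|); split=> // x sx; apply/andP; split.
  apply: (@lt_le_trans _ _ dl); first lra.
  rewrite leNgt; apply/negP => xd; apply: sx.
  exists V; split=> //; apply: dlV.
  by rewrite -ball_normE /= distrC.
have h : `|x| <= `|M| + 1 by apply: HM => //; have := ler_norm M; lra.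
have := ler_normB x x0; rewrite (ger0_norm (x := `|M| + 1 + `|x0|)) ?addr_ge0//; lra.
Qed.

Variables (a c : R) (U : set E) (g : E -> R[i]).
Hypotheses (c0 : c != 0) (oU : open U) (Ux0 : U x0) (sg : smooth_on U g).
Hypothesis fg : forall phi, rtest phi -> fsupp (rc phi) `<=` U ->
  f (rc (fun x => c * conv (Rp a) phi x)) = dist_of_fun g (rc phi).
Hypothesis g0 : forall b : 'I_d -> nat, mderiv b g x0 = 0.
Hypothesis ad : - (d%:R / 2) < a.
Hypothesis ha : forall j : nat, a - j%:R != 0 /\ 2 * (a - j%:R) - 2 + d%:R != 0.

(** Translated to the origin and divided by [c], the function [g] fulfils the hypotheses of
    [unique_continuation] for the functional [local_part]. *)
Lemma local_part_eq0 phi : rtest phi -> local_part phi = 0.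
Proof.
move=> tphi; have [dl [rho [dl0 hs]]] := support_radii.
have [_ _ fchi] := cf.
pose chi (x : E) := bump (`|rho| + 1) (`|rho| + 2) x * (1 - cutoff dl x).
have achi : annular (dl / 4) (`|rho| + 2) chi by exact: annular_cut.
have dl4 : 0 < dl / 4 by rewrite divr_gt0.
have ru := rdist_local_part.
have [eta /= eta0 etaU] : nbhs_ball x0 U by apply/nbhs_ballP; exact: open_nbhs_nbhs.
have smP : sm U (fun x => P (g x)).
  by have [s1 s2] := (smooth_onP U g).1 sg; case: PE => ->.
have sg2 : sm [set x : E | `|x| < eta] (fun x => P (g (x + x0))).
  apply: sm_sub (sm_translate x0 smP) => x /= xe; apply: etaU.
  by rewrite -ball_normE /= opprD addrCA subrr addr0 normrN.
have sg1 : sm [set x : E | `|x| < eta] (fun x => c^-1 * P (g (x + x0))).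
  by apply: smZ => //; exact: open_norm_lt.
have tchi := annular_rtest achi.
have cut1 y : dl / 2 <= `|y| -> `|y| <= `|rho| + 1 -> chi y = 1.
  move=> h1 h2; have [q1 q2] := cutoff_radius dl0.
  by rewrite /chi /cutoff (bump0 q1 q2 h1) bump1 ?subr0 ?mulr1// ?ltrD2l ?ltr1n// ltr_wpDl.
(* The potentials are smooth but not compactly supported. The last clause of [compact_distribution]
   gives the value of [f] on them through a cut-off. *)
have uchi Phi : sm setT Phi -> local_part Phi = local_part (fun x => chi x * Phi x).
  move=> sP; rewrite /local_part; congr P.
  rewrite (fchi _ (rc (fun x => chi (x - x0)))).
  - by congr f; apply/funext => x; rewrite /rc -rmorphM.
  - apply/smooth_onP; split; first exact: (sm_translate (- x0) sP).
    by apply: sm_cst; exact: openT.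
  - by apply/test_function_rc; exact: rtest_translate.
  - move=> x /hs hx.
    have hn : nbhs x [set y | dl / 2 < `|y - x0| < `|rho| + 1].
      by apply: open_nbhs_nbhs; split=> //; exact: open_shell.
    apply: (@filterS _ _ (nbhs_filter x) _ _ _ hn).
    by move=> y /andP[/ltW h1 /ltW h2]; rewrite /rc cut1.
apply: (unique_continuation ru dl4 achi eta0 ad uchi sg1 _ _ ha tphi) => [psi tpsi spsi|s].
  have sc : sm setT (conv (Rp a) psi) by apply: sm_conv => //; exact: locint_Rp.
  have tcc : rtest (fun x => chi x * conv (Rp a) psi x).
    by apply: (rtest_chi dl4 achi); exact: sm_sub sc.
  have tpsi' : rtest (fun x => psi (x - x0)) by exact: rtest_translate.
  have spsi' : fsupp (rc (fun x => psi (x - x0))) `<=` U.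
    have [r re psi0] := spsi.
    have /fsupp_bounded[_ h] x : r < `|x - x0| -> rc (fun x => psi (x - x0)) x = 0.
      by move=> /psi0; rewrite /rc => ->.
    apply: subset_trans h _ => x /= xr; apply: etaU.
    by rewrite -ball_normE /= distrC; exact: le_lt_trans re.
  have /(congr1 P) := fg tpsi' spsi'.
  have -> : f (rc (fun x => c * conv (Rp a) (fun x => psi (x - x0)) x)) =
      f (rc (fun x => (fun y => c * conv (Rp a) psi y) (x - x0))).
    congr f; congr rc; apply/funext => x; congr (_ * _); congr Int; apply/funext => y.
    by rewrite addrAC.
  (* Linearity is available on test functions only, so the cut-off is inserted before [c] is pulled
     out and removed afterwards. *)
  rewrite -/(local_part (fun y => c * conv (Rp a) psi y)) uchi; last by apply: smZ => //; exact: openT.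
  have -> : (fun x => chi x * (c * conv (Rp a) psi x)) = (fun x => c * (chi x * conv (Rp a) psi x)).
    by apply/funext => x; rewrite mulrCA.
  rewrite (rdistZ _ ru tcc) -uchi// => /(canRL (mulKf c0)) ->.
  have tg := rtest_small_mul sg1 tpsi spsi.
  have -> : P (dist_of_fun g (rc (fun x => psi (x - x0)))) =
      Int (fun x => P (g x) * psi (x - x0)).
    by case: PE => ->; rewrite /dist_of_fun /cintegral /= preimage_setT /Int;
      apply: eq_Rintegral => t _; case: (g _) => p q; rewrite /rc /= mulr0 ?subr0 ?add0r.
  pose Q (y : E) := P (g (y + x0)) * psi y.
  have QE : Q = fun y => c * (c^-1 * P (g (y + x0)) * psi y).
    by apply/funext => y; rewrite -mulrA mulVKf.
  have iQ : integ Q by rewrite QE; apply: integZ; exact: rtest_integ.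
  have <- : Int Q = Int (fun x => P (g x) * psi (x - x0)).
    rewrite -(Int_translate (- x0) iQ); congr Int; apply/funext => x.
    by rewrite /Q subrK.
  by rewrite -IntZ//; congr Int; apply/funext => y; rewrite /Q mulrA.
have s0 : [set x : E | `|x| < eta] 0 by rewrite /= normr0.
rewrite (pdsZ s c^-1 (open_norm_lt (r := eta)) sg2 s0).
rewrite (pds_translate s (fun x => P (g x)) x0) add0r.
have [h1 h2] := mderiv_pds oU Ux0 sg g0 s.
by case: PE => ->; rewrite ?h1 ?h2 mulr0.
Qed.

End reduction.

(** * Riesz potentials and the normal operator *)

Section vanishing.
Context {R : realType} {d : nat}.
Local Notation E := 'rV[R]_d.
Implicit Types (x y : E) (g : E -> R[i]) (k phi : E -> R).

(** Common form of both conclusions: [c = 1] and [a = - alpha / 2] for the Riesz potential, [c = 2]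
    and [a = - (d - 1) / 2] for the normal operator. *)
Lemma vanishes_of_convolution (f : functional R d) (V U : set E) (x0 : E) (a c : R) g :
  compact_distribution f -> open V -> V x0 -> vanishes_on V f ->
  c != 0 -> open U -> U x0 -> smooth_on U g ->
  (forall phi, rtest phi -> fsupp (rc phi) `<=` U ->
    f (rc (fun x => c * conv (Rp a) phi x)) = dist_of_fun g (rc phi)) ->
  (forall b : 'I_d -> nat, mderiv b g x0 = 0) ->
  - (d%:R / 2) < a ->
  (forall j : nat, a - j%:R != 0 /\ 2 * (a - j%:R) - 2 + d%:R != 0) ->
  vanishes_on setT f.
Proof.
move=> cf oV Vx0 fV c0 oU Ux0 sg fg g0 ad ha.
have fr phi : rtest phi -> f (rc phi) = 0.
  move=> tphi; have tphi' : rtest (fun x => phi (x + x0)) by exact: rtest_translate.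
  have H P (PE : P = @complex.Re R \/ P = @complex.Im R) : P (f (rc phi)) = 0.
    have := local_part_eq0 cf oV Vx0 fV PE c0 oU Ux0 sg fg g0 ad ha tphi'.
    by rewrite /local_part; under eq_fun do rewrite subrK.
  apply/eqP; rewrite complex_eq0.
  by rewrite (H _ (or_introl erefl)) (H _ (or_intror erefl)) eqxx.
move=> h /test_functionP[tr ti]; have [[fl _] _ _] := cf.
have -> : h = fun x => 'i%C * rc (fun x => complex.Im (h x)) x + rc (fun x => complex.Re (h x)) x.
  by apply/funext => x; rewrite addrC /rc; case: (h x) => p q; simpc.
rewrite fl; [|exact/test_function_rc|exact/test_function_rc].
by rewrite !fr// mulr0 addr0.
Qed.

Lemma cintegral_rc k : cintegral setT (rc k) = ((Int k)%:C)%C.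
Proof.
rewrite /cintegral preimage_setT /= /Int; congr Complex.
by under eq_Rintegral do rewrite /=; rewrite /Rintegral integral0.
Qed.

(** The reflection of the kernel cancels the one in [conv_test], leaving the integral of
    [h y * phi (x + y)], and [|y| ^ - alpha = q ^ (- alpha / 2)]. *)
Lemma riesz_potential_rc (alpha : R) (f : functional R d) phi :
  riesz_potential alpha f (rc phi) = f (rc (conv (Rp (- alpha / 2)) phi)).
Proof.
rewrite /riesz_potential /conv_dist; congr f; apply/funext => x.
rewrite /conv_test /reflect_dist /dist_of_fun /rc -cintegral_rc; congr (cintegral _ _).
apply/funext => y; rewrite /riesz_kernel /rc /conv opprK enorm_powR.
by rewrite -rmorphM.
Qed.

End vanishing.

Lemma Rintegral_translate {R : realType} (F : measurableTypeR R -> R) (b : R) :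
  measurable_fun setT F ->
  \int[@lebesgue_measure R]_s F (s + b) = \int[@lebesgue_measure R]_s F s.
Proof.
move=> mF; rewrite /Rintegral; congr fine.
have mE : measurable_fun setT (fun s => (F s)%:E) by exact/measurable_EFinP.
rewrite integralE [RHS]integralE.
rewrite [in RHS](ge0_integral_affine1 b (oner_neq0 R) (measurable_funepos mE))//.
rewrite [X in _ = (_ - X)%E](ge0_integral_affine1 b (oner_neq0 R) (measurable_funeneg mE))//.
rewrite normr1 !mul1e; congr (_ - _)%E; apply: eq_integral => s _.
  by rewrite !funeposE mul1r.
by rewrite !funenegE mul1r.
Qed.

Lemma dotpDZl {R : realType} {d : nat} (c : R) (x y z : 'rV[R]_d) :
  dotp (x + c *: y) z = dotp x z + c * dotp y z.
Proof.
rewrite /dotp mulr_sumr -big_split; apply: eq_bigr => i _.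
by rewrite !mxE mulrDl mulrA.
Qed.

(** The X-ray transform along the line through [x] with direction [theta] is the integral of
    [phi (x + s theta)] in [s]; its mean over directions is the polar formula in dimension
    [n + 2]. *)
Lemma backprojection_xray_rc {R : realType} {n : nat} (phi : 'rV[R]_n.+2 -> R) : rtest phi ->
  backprojection (xray (rc phi)) =
  rc (fun x => 2 * conv (Rp (- (n.+1%:R / 2))) phi x).
Proof.
move=> tphi; apply/funext => x.
pose K y := phi (x + y).
have bK : bounded_support K.
  have [_ [r p0]] := tphi; have [M M0 HM] := rtest_bounded tphi.
  split; first exact: mrow_shift (@rtest_continuous _ _ _ tphi).
  by exists (r + `|x|), M; split=> //; exact: shift_supp.
(* The factor [d] in [sphere_integral] cancels the [1 / d] of [sphere_line_integralE], leaving the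
   constant 2. *)
have -> : rc (fun x => 2 * conv (Rp (- (n.+1%:R / 2))) phi x) x =
    n.+2%:R * (sphere_line_integral K)%:C%C.
  rewrite sphere_line_integralE// /rc -[n.+2%:R](rmorph_nat (real_complex R)) -rmorphM; congr (_%:C)%C.
  by rewrite mulrA mulrCA mulfV ?mulr1// pnatr_eq0.
rewrite /backprojection /sphere_integral; congr (_ * _).
have lineE t : (@row_of_tuple R n.+2 @^-1` unit_punctured_ball) t ->
    let th := (enorm (row_of_tuple t))^-1 *: row_of_tuple t in
    oapp (xray (rc phi)) 0 (insub (x - dotp x th *: th, th) : option (line R n.+2)) =
    ((line_integral K th)%:C)%C.
  move=> Bt th; have th1 : dotp th th = 1.
    rewrite dotpZ exprVn -[X in _ * X](sqr_sqrtr (dotp_ge0 _)) mulVf// expf_neq0//.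
    by case/andP : Bt => /gt_eqF ->.
  have th2 : dotp (x - dotp x th *: th) th = 0.
    by rewrite -scaleNr dotpDZl th1 mulr1 subrr.
  rewrite insubT /=; first by rewrite th1 th2 !eqxx.
  move=> h; rewrite /xray /=; congr Complex; last first.
    by rewrite /Rintegral integral0.
  have mK := measurable_line th bK.1.
  (* The line is parametrised from its point orthogonal to [th]; the shift by the scalar product of
     [x] and [th] moves the base point to [x]. *)
  rewrite /line_integral -(Rintegral_translate (- dotp x th) mK).
  apply: eq_Rintegral => s _; rewrite /K; congr phi.
  by rewrite scalerDl scaleNr addrCA addrC addrAC.
rewrite /cintegral; congr Complex.
  apply: eq_Rintegral => t /set_mem Bt /=; by rewrite lineE.
rewrite -[RHS](_ : \int[lebesgue_tuple R n.+2]_(t in @row_of_tuple R n.+2 @^-1` unit_punctured_ball) 0 = _).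
  by apply: eq_Rintegral => t /set_mem Bt /=; rewrite lineE.
by rewrite /Rintegral integral0.
Qed.

(** For [alpha = d - 1] both numbers are negative, the second being [- 1 - 2 j]. Otherwise a zero
    would make [alpha] equal to one of the integers [- 2 j] and [d - 2 j - 2]. *)
Lemma riesz_exponent_conditions {R : realType} (d : nat) (alpha : R) : (2 <= d)%N ->
  alpha = d%:R - 1 \/ (alpha \isn't a Num.int /\ alpha < d%:R) ->
  - (d%:R / 2) < - alpha / 2 /\
  forall j : nat, - alpha / 2 - j%:R != 0 /\ 2 * (- alpha / 2 - j%:R) - 2 + d%:R != 0.
Proof.
move=> d2 H; split.
  rewrite mulNr ltrN2 ltr_pM2r//; case: H => [->|[]//].
  by rewrite ltrBlDr ltrDl.
have d1 : 2 <= d%:R :> R by rewrite ler_nat.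
move=> j; have j0 : 0 <= j%:R :> R by [].
case: H => [->|[ai _]].
  split; first by apply/eqP; lra.
  by apply/eqP; lra.
split; apply: contraNneq ai => h.
  have -> : alpha = - (2 * j)%:R by rewrite natrM; lra.
  by rewrite rpredN natr_int.
have -> : alpha = d%:R - (2 * j)%:R - 2 by rewrite natrM; lra.
by rewrite !rpredB// natr_int.
Qed.

Theorem theorem1p1 (R : realType) (d : nat) (f : functional R d)
    (V : set 'rV[R]_d) (x0 : 'rV[R]_d) :
  (2 <= d)%N ->
  compact_distribution f ->
  open V -> V !=set0 -> V x0 ->
  vanishes_on V f ->
  (forall alpha : R,
     alpha = d%:R - 1 \/ (alpha \isn't a Num.int /\ alpha < d%:R) ->
     vanishes_to_infinite_order (riesz_potential alpha f) x0 ->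
     vanishes_on setT f) /\
  (vanishes_to_infinite_order (normal_operator f) x0 ->
   vanishes_on setT f).
Proof.
move=> d2 cf oV _ Vx0 fV; split=> [alpha ha|].
  move=> [U [g [oU Ux0 sg fg g0]]].
  have [ad aj] := riesz_exponent_conditions d2 ha.
  apply: (vanishes_of_convolution cf oV Vx0 fV (oner_neq0 R) oU Ux0 sg _ g0 ad aj).
  move=> phi tphi sphi; rewrite -fg; last first.
    by have [? ? _] := (test_function_rc phi).2 tphi; split.
  by rewrite riesz_potential_rc; under eq_fun do rewrite mul1r.
case: d d2 f V x0 cf oV Vx0 fV => [|[|n]]// d2 f V x0 cf oV Vx0 fV.
move=> [U [g [oU Ux0 sg fg g0]]].
have [] := @riesz_exponent_conditions R n.+2 n.+1%:R d2.
  by left; rewrite -[n.+2]addn1 natrD addrK.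
rewrite mulNr => ad aj.
have two0 : 2 != 0 :> R by rewrite pnatr_eq0.
apply: (vanishes_of_convolution cf oV Vx0 fV two0 oU Ux0 sg _ g0 ad aj).
move=> phi tphi sphi; rewrite -fg; last first.
  by have [? ? _] := (test_function_rc phi).2 tphi; split.
by rewrite /normal_operator /backprojection_dist /xray_dist backprojection_xray_rc.
Qed.
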